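(* Let $R\ge0$, let $\tau_1,\dots,\tau_R\in\mathbb{T}$ be distinct with $\operatorname{Im}\tau_r>0$, and let $\alpha^\pm,\beta^\pm,\alpha_r^\pm,\beta_r$ ($1\le r\le R$) be complex parameters with $|\operatorname{Re}\alpha^\pm|<1/2$ and $|\operatorname{Re}\alpha_r^\pm|<1/2$. Put $\alpha_r=\frac{\alpha_r^++\alpha_r^-}{2}$, $\gamma^\pm=\alpha^\pm+\beta^\pm$, $\gamma_r=\alpha_r+\beta_r$. Let $c,d$ be smooth nonvanishing functions on $\mathbb{T}$ with winding number zero, with $d\tilde d=1$ and $d(\pm1)=1$. Define $$a=c\,v_{1,\alpha^+}v_{-1,\alpha^-}\prod_{r=1}^R v_{\tau_r,\alpha_r^+}v_{\bar\tau_r,\alpha_r^-},$$ $$b=c\,d\,v_{1,\alpha^+}u_{1,\beta^+}v_{-1,\alpha^-}u_{-1,\beta^-}\prod_{r=1}^R v_{\tau_r,\alpha_r}u_{\tau_r,\beta_r}v_{\bar\tau_r,\alpha_r}u_{\bar\tau_r,\beta_r},$$ $$\psi=u_{1,\alpha^+}u_{-1,\alpha^-}\prod_{r=1}^R u_{\tau_r,\alpha_r^+}u_{\bar\tau_r,\alpha_r^-},\qquad \phi=u_{1,\gamma^+}u_{-1,\gamma^-}\prod_{r=1}^R u_{\tau_r,\gamma_r}u_{\bar\tau_r,\gamma_r}.$$ Then for every $n\ge1$ $$\det P_nM(a,b)P_n=\det\Big(P_nT^{-1}(\psi)\,M(c,c\,d\,\phi)\,T^{-1}(\psi^{-1})P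_n\Big).$$
   Context: $\mathbb{T}$ is the unit circle, $f_k$ the $k$-th Fourier coefficient of $f\in L^1(\mathbb{T})$, $\tilde f(e^{i\theta})=f(e^{-i\theta})$. For $\tau=e^{i\varphi}\in\mathbb{T}$: $u_{\tau,\beta}(e^{i\theta})=\exp(i\beta(\theta-\varphi-\pi))$ for $0<\theta-\varphi<2\pi$, and $v_{\tau,\alpha}(e^{i\theta})=(2-2\cos(\theta-\varphi))^\alpha$. $T(f)=(f_{j-k})_{j,k\ge0}$ and $H(f)=(f_{j+k+1})_{j,k\ge0}$ are the Toeplitz and Hankel operators, bounded on $\ell^2=\ell^2(\{0,1,2,\dots\})$ for $f\in L^\infty(\mathbb{T})$; for $f\in L^1(\mathbb{T})$ they are regarded as infinite matrices acting on finitely supported sequences. $M(a,b)=T(a)+H(b)$. $P_n$ is the projection of $\ell^2$ onto the first $n$ coordinates, and $\det P_nAP_n$ is the determinant of the $n\times n$ upper left block of $A$. $T^{-1}(f)$ denotes the inverse of $T(f)$; under the given conditions on $\alpha^\pm,\alpha_r^\pm$, the operators $T(\psi)$ and $T(\psi^{-1})$ are invertible on $\ell^2$. *)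

(* Defs.v *)
From HB Require Import structures.
From mathcomp Require Import all_boot all_order all_algebra.
From mathcomp Require Import all_classical all_reals all_analysis.
From mathcomp Require Export complex.
Import Order.TTheory GRing.Theory Num.Theory.
Import numFieldNormedType.Exports.

Set Implicit Arguments.
Unset Strict Implicit.
Unset Printing Implicit Defensive.

Local Open Scope classical_set_scope.
Local Open Scope ring_scope.
Local Open Scope complex_scope.

(* A function on the unit circle is represented by a function R[i] -> R[i]
   of which only the values at points of modulus 1 are ever used. *)

Section CircleFunctions.
Variable R : realType.
Local Notation C := R[i].
Implicit Types (f : C -> C) (tau beta alpha t z : C) (theta : R).

Definition cexp z : C :=
  (expR (complex.Re z))%:C * (cos (complex.Im z) +i* sin (complex.Im z)).

Definition expi theta : C := cexp ('i%C * theta%:C).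

(* The argument in ]0, 2 pi[ of a point z <> 1 of the unit circle; the junk
   value at z = 1 only affects the functions u and v below at their jump,
   respectively singular, point. *)
Definition arg2pi z : R :=
  xget 0 [set x : R | 0 < x < 2 * pi /\ expi x = z].

(* For t = e^(i theta) and tau = e^(i phi), arg2pi (t / tau) is the
   representative of theta - phi in ]0, 2 pi[. *)
Definition u tau beta t : C :=
  cexp ('i%C * beta * (arg2pi (t / tau) - pi)%:C).

Definition rpowc (x : R) alpha : C := cexp (alpha * (ln x)%:C).

Definition v tau alpha t : C := rpowc (2 - 2 * cos (arg2pi (t / tau))) alpha.

Definition tilde f t : C := f (t^*)%C.

Definition on_circle (P : C -> Prop) := forall t, `|t| = 1 -> P t.

Definition smooth_real (g : R -> R) :=
  forall (n : nat) (x : R), derivable (derive1n n g) x 1.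

Definition smooth_on_circle f :=
  smooth_real (fun theta => complex.Re (f (expi theta))) /\
  smooth_real (fun theta => complex.Im (f (expi theta))).

(* omega is a continuous branch of the argument of f along the circle. *)
Definition has_winding_number f (k : int) :=
  exists omega : R -> R,
    [/\ continuous omega,
        forall theta, f (expi theta) = `|f (expi theta)| * expi (omega theta)
      & omega (2 * pi) - omega 0 = 2 * pi * k%:~R].

Definition cintegral (D : set R) (g : R -> C) : C :=
  Rintegral lebesgue_measure D (fun x => complex.Re (g x)) +i*
  Rintegral lebesgue_measure D (fun x => complex.Im (g x)).

Definition fourier f (k : int) : C :=
  ((2 * pi)^-1)%:C *
  cintegral `[0, 2 * pi] (fun theta => f (expi theta) * expi (- (k%:~R * theta))).

End CircleFunctions.

Section Operators.
Variable R : realType.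
Local Notation C := R[i].
Implicit Types (f a b : C -> C) (x y : nat -> C) (A : (nat -> C) -> nat -> C).

Definition csum (s : nat -> C) : C :=
  limn (series (fun k => complex.Re (s k))) +i*
  limn (series (fun k => complex.Im (s k))).

Definition ell2 x : Prop :=
  cvgn (series (fun k => complex.Re (x k) ^+ 2 + complex.Im (x k) ^+ 2)).

(* On a finitely supported x, and on x in ell2 when f is bounded, the series
   defining T f x and H f x converge absolutely. *)
Definition T f x : nat -> C :=
  fun j => csum (fun k => fourier f (j%:Z - k%:Z) * x k).

Definition H f x : nat -> C :=
  fun j => csum (fun k => fourier f (j%:Z + k%:Z + 1) * x k).

Definition M a b x : nat -> C := fun j => T a x j + H b x j.

(* The inverse of A on ell2: when A is invertible on ell2, ell2_inv A y is, for
   y in ell2, the unique x in ell2 such that A x = y. *)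
Definition ell2_inv A y : nat -> C :=
  xget (fun=> 0) [set x | ell2 x /\ A x = y].

Definition basis_vector (k : nat) : nat -> C := fun j => (j == k)%:R.

Definition det_truncation (n : nat) A : C :=
  \det (\matrix_(j < n, k < n) A (basis_vector k) j).

End Operators.

(* Main.v *)
Require Import Defs.
From mathcomp Require Import all_boot all_order all_algebra.
From mathcomp Require Import all_classical all_reals all_analysis.
From mathcomp Require Import measurable_realfun ring lra zify.
Import Order.TTheory GRing.Theory Num.Theory.
Import numFieldNormedType.Exports.
Import ComplexField.Normc.

(** Write psi_+(t) for the product of the (1 - t / tau_j)^(alpha_j) over all the
    singular points tau_j, and psi_-(t) for the product of the
    (1 - tau_j / t)^(- alpha_j).  A pure jump is a quotient and a pure
    Fisher-Hartwig modulus a product of the two boundary values,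
      u_(tau,alpha) = (1 - t / tau)^alpha (1 - tau / t)^(- alpha),
      v_(tau,alpha) = (1 - t / tau)^alpha (1 - tau / t)^alpha,
    so psi = psi_+ psi_-, a = psi_-^-1 c psi_+ and, because the set of singular
    points is stable under conjugation and alpha_r is the mean of alpha_r^+ and
    alpha_r^-, b = psi_-^-1 c d phi psi_+~ where psi_+~(t) = psi_+(1 / t).

    For f antianalytic and h analytic, T(f g h) = T(f) T(g) T(h) and
    H(f g h~) = T(f) H(g) T(h); hence, formally,
    M(a, b) = T(psi_-^-1) M(c, c d phi) T(psi_+) and T(psi) = T(psi_-) T(psi_+), and
      T^-1(psi) M(c, c d phi) T^-1(psi^-1) = T(psi_+^-1) M(a, b) T(psi_-).
    The outer factors are triangular with unit diagonal, so they do not change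
    the determinants of the finite sections.

    The factors psi_+ and psi_- are in general unbounded, so their Toeplitz operators are
    not available on all of l2.  They are however square integrable, which is
    where |Re alpha| < 1/2 enters, and the argument only needs single columns:
    T^-1(psi^-1) e_n is a finite combination of the columns of T(psi_+), and
    applying the rows of T(psi_-^-1), which are in l2, gives a matrix identity
    L X = A U with L and U unitriangular [det_toep_hank].  The convolution
    identities it uses [conv_plus, conv_minus, conv_hankel] hold for functions
    of the Hardy class, here the mean square limits of polynomials with
    constant coefficient 1 [hardy_mul]; psi_+ and psi_- belong to it
    [hardy_etas] because for radius r < 1 the binomial series converges
    uniformly [eta_binpoly], and because the limit r -> 1 is dominated by a
    product of functions |1 - w|^(- 2 k) with k < 1/2 and distinct
    singularities, each integrable by Parseval's identity applied to the
    square summable binomial coefficients [sqint_eta1, bincoef_sum].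

    The invertibility of T(psi) [toep_jumps_bijective] is obtained by comparing
    psi with its regularization psi_r of radius r < 1.  The factors of psi_r are
    bounded with bounded inverses, so T(psi) is invertible as soon as T(psi / psi_r)
    is.  For r close to 1 the quotient is close to 1 away from the jumps, and at
    one jump its argument is at most (pi / 2) 2 |Re alpha| < pi / 2, so that
    psi / psi_r takes values in a sector of the right half plane [jumps_sector] and
    a Neumann series inverts its Toeplitz operator [toep_sectorial]. *)

Set Implicit Arguments.
Unset Strict Implicit.
Unset Printing Implicit Defensive.

Local Open Scope classical_set_scope.
Local Open Scope ring_scope.
Local Open Scope complex_scope.

(** * The modulus of complex numbers and limits of complex sequences *)

Section Modulus.
Variable R : realType.
Local Notation C := R[i].
Implicit Types (x y z : C).

Lemma modcE z : normc z ^+ 2 = complex.Re z ^+ 2 + complex.Im z ^+ 2.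
Proof. by case: z => a b /=; rewrite sqr_sqrtr // addr_ge0 ?sqr_ge0. Qed.

Lemma modc_ge0 z : 0 <= normc z.
Proof. by case: z => a b /=; rewrite sqrtr_ge0. Qed.

Lemma modcN z : normc (- z) = normc z.
Proof. by case: z => a b /=; rewrite !sqrrN. Qed.

Lemma modcD x y : normc (x + y) <= normc x + normc y.
Proof. exact: (@le_normcD R x y). Qed.

Lemma modcBC x y : normc (x - y) = normc (y - x).
Proof. by rewrite -modcN opprB. Qed.

Lemma modcJ z : normc z^*%C = normc z.
Proof. by case: z => a b /=; rewrite sqrrN. Qed.

Lemma modc_real (r : R) : normc r%:C = `|r|.
Proof. by rewrite /= expr0n /= addr0 sqrtr_sqr. Qed.

Lemma modcX z n : normc (z ^+ n) = normc z ^+ n.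
Proof. by elim: n => [|n IH]; rewrite ?normc1 // !exprS normcM IH. Qed.

Lemma modc_sum (I : Type) (s : seq I) (P : pred I) (F : I -> C) :
  normc (\sum_(i <- s | P i) F i) <= \sum_(i <- s | P i) normc (F i).
Proof.
elim/big_ind2 : _ => // [|x1 x2 y1 y2 h1 h2]; first by rewrite normc0.
by apply: le_trans (modcD _ _) _; apply: lerD.
Qed.

Lemma modc_prod (I : Type) (s : seq I) (P : pred I) (F : I -> C) :
  normc (\prod_(i <- s | P i) F i) = \prod_(i <- s | P i) normc (F i).
Proof. by elim/big_ind2 : _ => // [|x1 x2 y1 y2 <- <-]; rewrite ?normc1 ?normcM. Qed.

Lemma Re_le_modc z : `|complex.Re z| <= normc z.
Proof.
by rewrite -ler_sqr ?nnegrE ?modc_ge0// modcE -normrX ger0_norm ?sqr_ge0// lerDl sqr_ge0.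
Qed.

Lemma Im_le_modc z : `|complex.Im z| <= normc z.
Proof.
by rewrite -ler_sqr ?nnegrE ?modc_ge0// modcE -normrX ger0_norm ?sqr_ge0// lerDr sqr_ge0.
Qed.

Lemma modc_le_ReIm z : normc z <= `|complex.Re z| + `|complex.Im z|.
Proof.
rewrite -ler_sqr ?nnegrE ?modc_ge0 ?addr_ge0// modcE -(real_normK (num_real (complex.Re z))).
rewrite -(real_normK (num_real (complex.Im z))).
have := normr_ge0 (complex.Re z); have := normr_ge0 (complex.Im z); nra.
Qed.

Lemma modc_eq0 z : normc z = 0 -> z = 0.
Proof. exact: eq0_normc. Qed.

Lemma modc1P z : (`|z| == 1) = (normc z == 1).
Proof.
rewrite normc_def -(inj_eq (@complexI R)).
by case: z => a b.
Qed.

Lemma ReD x y : complex.Re (x + y) = complex.Re x + complex.Re y.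
Proof. by case: x; case: y. Qed.
Lemma ImD x y : complex.Im (x + y) = complex.Im x + complex.Im y.
Proof. by case: x; case: y. Qed.
Lemma ReN x : complex.Re (- x) = - complex.Re x. Proof. by case: x. Qed.
Lemma ImN x : complex.Im (- x) = - complex.Im x. Proof. by case: x. Qed.
Lemma ReM x y : complex.Re (x * y) =
  complex.Re x * complex.Re y - complex.Im x * complex.Im y.
Proof. by case: x; case: y. Qed.
Lemma ImM x y : complex.Im (x * y) =
  complex.Re x * complex.Im y + complex.Im x * complex.Re y.
Proof. by case: x => a b; case: y. Qed.
Lemma Re_sum (I : Type) (s : seq I) (P : pred I) (F : I -> C) :
  complex.Re (\sum_(i <- s | P i) F i) = \sum_(i <- s | P i) complex.Re (F i).
Proof. by elim/big_ind2 : _ => // x1 x2 y1 y2 <- <-; rewrite ReD. Qed.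
Lemma Im_sum (I : Type) (s : seq I) (P : pred I) (F : I -> C) :
  complex.Im (\sum_(i <- s | P i) F i) = \sum_(i <- s | P i) complex.Im (F i).
Proof. by elim/big_ind2 : _ => // x1 x2 y1 y2 <- <-; rewrite ImD. Qed.
Lemma complex_ext x y : complex.Re x = complex.Re y ->
  complex.Im x = complex.Im y -> x = y.
Proof. by case: x => a b; case: y => a' b' /= -> ->. Qed.

(** A weight t replaces the Cauchy-Schwarz inequality throughout: choosing t
    afterwards gives the same bounds without square roots. *)
Lemma modc_young (t : R) x y : 0 < t ->
  normc (x * y) <= (t * normc x ^+ 2 + t^-1 * normc y ^+ 2) / 2.
Proof.
move=> t0; rewrite normcM.
set a := normc x; set b := normc y.
have -> : a * b = (t * a ^+ 2 + t^-1 * b ^+ 2) / 2 - t^-1 * (t * a - b) ^+ 2 / 2.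
  by field; rewrite gt_eqF.
by rewrite lerBlDr lerDl divr_ge0// mulr_ge0 ?sqr_ge0// invr_ge0 ltW.
Qed.

Lemma modcD_young (t : R) x y : 0 < t ->
  normc (x + y) ^+ 2 <= (1 + t) * normc x ^+ 2 + (1 + t^-1) * normc y ^+ 2.
Proof.
move=> t0; have : normc (x + y) ^+ 2 <= (normc x + normc y) ^+ 2.
  by rewrite ler_sqr ?nnegrE ?addr_ge0 ?modc_ge0// modcD.
move=> /le_trans; apply.
have := @modc_young t x y t0; rewrite normcM; lra.
Qed.

End Modulus.

Section ComplexLimits.
Variable R : realType.
Local Notation C := R[i].
Implicit Types (s : nat -> C) (l : C).

(** Convergence is spelled out on real and imaginary parts, which is how the
    series and integrals of complex functions are defined. *)
Definition ccvg s l :=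
  (fun n => complex.Re (s n)) @ \oo --> complex.Re l /\
  (fun n => complex.Im (s n)) @ \oo --> complex.Im l.

Lemma ccvgP s l : ccvg s l <->
  forall e : R, 0 < e -> exists N, forall n, (N <= n)%N -> normc (s n - l) <= e.
Proof.
split=> [[h1 h2] e e0|h].
  have e2 : 0 < e / 2 by rewrite divr_gt0.
  move: h1 h2 => /cvgrPdist_le/(_ _ e2)[N1 _ H1] /cvgrPdist_le/(_ _ e2)[N2 _ H2].
  exists (maxn N1 N2) => n; rewrite geq_max => /andP[n1 n2].
  rewrite modcBC; apply: le_trans (modc_le_ReIm _) _; rewrite ReD ImD ReN ImN.
  by have := H1 n n1; have := H2 n n2 => /=; lra.
split; apply/cvgrPdist_le => e e0; have [N HN] := h e e0; exists N => // n /= Nn.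
  by rewrite -ReN -ReD; apply: le_trans (Re_le_modc _) _; rewrite modcBC; exact: HN.
by rewrite -ImN -ImD; apply: le_trans (Im_le_modc _) _; rewrite modcBC; exact: HN.
Qed.

Lemma ccvg_unique s l l' : ccvg s l -> ccvg s l' -> l = l'.
Proof.
move=> [h1 h2] [h3 h4]; apply: complex_ext.
  by rewrite -(cvg_lim (@Rhausdorff R) h1) -(cvg_lim (@Rhausdorff R) h3).
by rewrite -(cvg_lim (@Rhausdorff R) h2) -(cvg_lim (@Rhausdorff R) h4).
Qed.

Lemma ccvgD s s' l l' : ccvg s l -> ccvg s' l' -> ccvg (fun n => s n + s' n) (l + l').
Proof.
move=> [h1 h2] [h3 h4]; split.
  by under eq_fun do rewrite ReD; rewrite ReD; exact: cvgD.
by under eq_fun do rewrite ImD; rewrite ImD; exact: cvgD.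
Qed.

Lemma ccvgZ a s l : ccvg s l -> ccvg (fun n => a * s n) (a * l).
Proof.
move=> [h1 h2]; split.
  by under eq_fun do rewrite ReM; rewrite ReM; apply: cvgB; exact: cvgMr.
by under eq_fun do rewrite ImM; rewrite ImM; apply: cvgD; exact: cvgMr.
Qed.

Lemma ccvg_cst l : ccvg (fun=> l) l.
Proof. by split; exact: cvg_cst. Qed.

Lemma ccvg_eventually s l N : (forall n, (N <= n)%N -> s n = l) -> ccvg s l.
Proof.
by move=> h; apply/ccvgP => e e0; exists N => n Nn; rewrite h// subrr normc0 ltW.
Qed.

Lemma ccvg_shift s l : ccvg s l -> ccvg (fun n => s n.+1) l.
Proof.
by move=> /ccvgP h; apply/ccvgP => e /h[N HN]; exists N => n Nn; apply: HN; exact: leqW.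
Qed.

Lemma ccvg_sum (I : Type) (r : seq I) (F : I -> nat -> C) (l : I -> C) :
  (forall i, ccvg (F i) (l i)) ->
  ccvg (fun n => \sum_(i <- r) F i n) (\sum_(i <- r) l i).
Proof.
move=> h; elim: r => [|i r IH].
  by rewrite big_nil; under eq_fun do rewrite big_nil; exact: ccvg_cst.
by rewrite big_cons; under eq_fun do rewrite big_cons; exact: ccvgD.
Qed.

Lemma ccvg_mod2 s l : ccvg s l ->
  (fun n => normc (s n) ^+ 2) @ \oo --> normc l ^+ 2.
Proof.
move=> [h1 h2]; under eq_fun do rewrite modcE; rewrite modcE.
by apply: cvgD; rewrite expr2; under eq_fun do rewrite expr2; exact: cvgM.
Qed.

(** Closed balls are closed. *)
Lemma ccvg_dist_le s l a (B : R) : 0 <= B -> ccvg s l ->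
  (exists N, forall n, (N <= n)%N -> normc (s n - a) <= B) -> normc (l - a) <= B.
Proof.
move=> B0 /ccvgP h [N hN]; apply/ler_addgt0Pr => e /h[N' hN'].
have := hN' (maxn N N') (leq_maxr _ _); have := hN (maxn N N') (leq_maxl _ _).
rewrite (modcBC _ l); set z := s _ => h1 h2.
have -> : l - a = (z - a) + (l - z) by ring.
by apply: le_trans (modcD _ _) _; rewrite lerD.
Qed.

Lemma abs_cvg_series (w : nat -> R) (B : R) :
  (forall N, \sum_(k < N) `|w k| <= B) -> cvgn (series w).
Proof.
move=> h; apply: (@normed_cvg R).
have -> : [normed series w] = (fun N => \sum_(k < N) `|w k|).
  by apply/funext => N /=; rewrite seriesEord.
apply: nondecreasing_is_cvgn.
  by apply/nondecreasing_seqP => n; rewrite big_ord_recr lerDl normr_ge0.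
by exists B => _ [n _ <-].
Qed.

Lemma csum_ccvg s l : ccvg (fun N => \sum_(k < N) s k) l -> csum s = l.
Proof.
move=> [h1 h2]; rewrite /csum; apply: complex_ext => /=; apply: cvg_lim => //;
 rewrite seriesEord/=; [move: h1|move: h2].
  by under eq_fun do rewrite Re_sum.
by under eq_fun do rewrite Im_sum.
Qed.

Lemma csum_abs_cvg s (B : R) : (forall N, \sum_(k < N) normc (s k) <= B) ->
  ccvg (fun N => \sum_(k < N) s k) (csum s).
Proof.
move=> h; split; rewrite /csum/=.
  under eq_fun do rewrite Re_sum.
  suff : cvgn (series (fun k => complex.Re (s k))) by rewrite seriesEord.
  apply: (@abs_cvg_series _ B) => N; apply: le_trans (h N).
  by apply: ler_sum => i _; exact: Re_le_modc.
under eq_fun do rewrite Im_sum.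
suff : cvgn (series (fun k => complex.Im (s k))) by rewrite seriesEord.
apply: (@abs_cvg_series _ B) => N; apply: le_trans (h N).
by apply: ler_sum => i _; exact: Im_le_modc.
Qed.

Lemma csum_finite s N : (forall k, (N <= k)%N -> s k = 0) ->
  csum s = \sum_(k < N) s k.
Proof.
move=> h; apply: csum_ccvg; apply: (@ccvg_eventually _ _ N) => n Nn.
rewrite -!(big_mkord xpredT s) (@big_cat_nat _ _ _ N)//= [X in _ + X = _]big_nat_cond [X in _ + X = _]big1 ?addr0//.
by move=> i /andP[/andP[Ni _] _]; exact: h.
Qed.

End ComplexLimits.

(** * Square summable sequences and weak convergence *)

Section SequenceSpace.
Variable R : realType.
Local Notation C := R[i].
Local Notation seqs := (nat -> C).
Implicit Types (x y f : seqs) (A B : R) (X : nat -> seqs).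

(** [l2b B x] keeps track of a bound B for the squared norm; only such bounds,
    never the norm itself, are needed. *)
Definition l2b B x := forall N, \sum_(k < N) normc (x k) ^+ 2 <= B.
Definition l2 x := exists B, l2b B x.

Lemma ell2P x : ell2 x <-> l2 x.
Proof.
rewrite /ell2; split => [h|[B hB]].
  exists (limn (series (fun k => complex.Re (x k) ^+ 2 + complex.Im (x k) ^+ 2))) => N.
  under eq_bigr do rewrite modcE.
  rewrite -(big_mkord xpredT (fun k => complex.Re (x k) ^+ 2 + complex.Im (x k) ^+ 2)).
  have := @nondecreasing_cvgn_le R _ _ h N; rewrite [X in X -> _]/= seriesEnat; apply.
  apply/nondecreasing_seqP => n /=; rewrite big_nat_recr//= lerDl.
  by rewrite addr_ge0 ?sqr_ge0.
apply: (@abs_cvg_series _ _ B) => N; apply: le_trans (hB N).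
by apply: ler_sum => k _; rewrite modcE ger0_norm// addr_ge0 ?sqr_ge0.
Qed.

Lemma l2b_ge0 B x : l2b B x -> 0 <= B.
Proof. by move=> /(_ 0%N); rewrite big_ord0. Qed.

Lemma l2bW A B x : A <= B -> l2b A x -> l2b B x.
Proof. by move=> AB h N; exact: le_trans (h N) AB. Qed.

Lemma l2b_young (t : R) A B x y : 0 < t -> l2b A x -> l2b B y ->
  l2b ((1 + t) * A + (1 + t^-1) * B) (fun k => x k + y k).
Proof.
move=> t0 hx hy N; have t1 : 0 < t^-1 by rewrite invr_gt0.
apply: (@le_trans _ _ (\sum_(k < N) ((1 + t) * normc (x k) ^+ 2 + (1 + t^-1) * normc (y k) ^+ 2))).
  by apply: ler_sum => k _; exact: modcD_young.
rewrite big_split/= -!mulr_sumr; by apply: lerD; apply: ler_wpM2l; [lra|exact: hx|lra|exact: hy].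
Qed.

Lemma l2bZ (c : C) B x : l2b B x -> l2b (normc c ^+ 2 * B) (fun k => c * x k).
Proof.
move=> h N; under eq_bigr do rewrite normcM exprMn.
by rewrite -mulr_sumr ler_wpM2l ?sqr_ge0.
Qed.

(** Finite sections of the squared norm pass to the limit, hence so does their
    common bound. *)
Lemma l2b_lim B X x : (forall i, l2b B (X i)) ->
  (forall k, ccvg (fun i => X i k) (x k)) -> l2b B x.
Proof.
move=> hX hx N.
have h : (fun i => \sum_(k < N) normc (X i k) ^+ 2) @ \oo --> \sum_(k < N) normc (x k) ^+ 2.
  by apply: cvg_big => [|k _]; [exact: add_continuous|exact: ccvg_mod2].
have <- := cvg_lim (@Rhausdorff R) h.
by apply: limr_le; [apply/cvg_ex; eexists; exact: h|apply: nearW => i; exact: hX].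
Qed.

Lemma l2D x y : l2 x -> l2 y -> l2 (fun k => x k + y k).
Proof. by move=> [A hA] [B hB]; eexists; exact: (l2b_young ltr01 hA hB). Qed.

Lemma l2Z c x : l2 x -> l2 (fun k => c * x k).
Proof. by move=> [A hA]; eexists; exact: (l2bZ c hA). Qed.

Lemma l2_finite x N : (forall k, (N <= k)%N -> x k = 0) -> l2 x.
Proof.
move=> h; exists (\sum_(k < N) normc (x k) ^+ 2) => M.
have S := big_mkord xpredT (fun k => normc (x k) ^+ 2); rewrite -!S.
case: (leqP M N) => MN.
  by rewrite [leRHS](@big_cat_nat _ _ _ M)//= lerDl sumr_ge0// => i _; exact: sqr_ge0.
rewrite (@big_cat_nat _ _ _ N) ?(ltnW MN)//= gerDl big_nat_cond big1// => i /andP[/andP[Ni _] _].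
by rewrite h// normc0 expr0n.
Qed.

Lemma l2_basis k : l2 (basis_vector R k).
Proof.
by apply: (@l2_finite _ k.+1) => j; rewrite /basis_vector; case: eqP => // ->; rewrite ltnn.
Qed.

Lemma l2_sum (n : nat) (F : 'I_n -> seqs) : (forall i, l2 (F i)) ->
  l2 (fun k => \sum_(i < n) F i k).
Proof.
elim: n F => [|n IH] F h.
  by apply: (@l2_finite _ 0%N) => k _; rewrite big_ord0.
by under eq_fun do rewrite big_ord_recr /=; apply: l2D; [exact: IH|exact: h].
Qed.

Lemma l2b_tail B x (d : R) : l2b B x -> 0 < d ->
  exists K, forall N, \sum_(K <= k < N) normc (x k) ^+ 2 <= d.
Proof.
move=> hx d0; pose u n := \sum_(0 <= k < n) normc (x k) ^+ 2.
have ndu : {homo u : n m / (n <= m)%N >-> n <= m}.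
  by apply/nondecreasing_seqP => n /=; rewrite /u big_nat_recr//= lerDl sqr_ge0.
have cu : cvgn u.
  apply: nondecreasing_is_cvgn => //.
  by exists B => _ [n _ <-]; rewrite /u big_mkord.
have /cvgrPdist_le/(_ _ d0)[K _ hK] := cu.
exists K => N; case: (leqP N K) => [NK|/ltnW KN].
  by rewrite big_geq// ltW.
have -> : \sum_(K <= k < N) normc (x k) ^+ 2 = u N - u K.
  by rewrite /u (@big_cat_nat _ _ _ K 0%N N)//= addrAC subrr add0r.
have := hK K (leqnn _); rewrite /= => /ler_normlP[_ h].
have := nondecreasing_cvgn_le ndu cu N; lra.
Qed.

(** The bilinear pairing, without conjugation: the rows of an infinite matrix
    act on sequences through it. *)
Definition dot f x : C := csum (fun k => f k * x k).

Lemma dot_range (t : R) A B f x (K N : nat) : 0 < t ->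
  \sum_(K <= k < N) normc (f k) ^+ 2 <= A -> \sum_(K <= k < N) normc (x k) ^+ 2 <= B ->
  normc (\sum_(K <= k < N) f k * x k) <= (t * A + t^-1 * B) / 2.
Proof.
move=> t0 hA hB; have t1 : 0 < t^-1 by rewrite invr_gt0.
apply: le_trans (modc_sum _ _ _) _.
apply: (@le_trans _ _ (\sum_(K <= k < N) (t * normc (f k) ^+ 2 + t^-1 * normc (x k) ^+ 2) / 2)).
  by apply: ler_sum => k _; exact: modc_young.
rewrite -mulr_suml big_split/= -!mulr_sumr ler_wpM2r// ?invr_ge0//.
by apply: lerD; apply: ler_wpM2l => //; exact: ltW.
Qed.

Lemma dot_cvg f x : l2 f -> l2 x -> ccvg (fun N => \sum_(k < N) f k * x k) (dot f x).
Proof.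
move=> [A hA] [B hB]; apply: (@csum_abs_cvg _ _ ((1 * A + 1^-1 * B) / 2)) => N.
apply: (@le_trans _ _ (\sum_(k < N) (1 * normc (f k) ^+ 2 + 1^-1 * normc (x k) ^+ 2) / 2)).
  by apply: ler_sum => k _; exact: modc_young.
rewrite -mulr_suml big_split/= -!mulr_sumr invr1 !mul1r ler_wpM2r ?invr_ge0//.
by apply: lerD; [exact: hA|exact: hB].
Qed.

Lemma dotD f x y : l2 f -> l2 x -> l2 y ->
  dot f (fun k => x k + y k) = dot f x + dot f y.
Proof.
move=> hf hx hy; apply: csum_ccvg; under eq_fun do under eq_bigr do rewrite mulrDr.
by under eq_fun do rewrite big_split; apply: ccvgD; exact: dot_cvg.
Qed.

Lemma dotZ f c x : l2 f -> l2 x -> dot f (fun k => c * x k) = c * dot f x.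
Proof.
move=> hf hx; apply: csum_ccvg; under eq_fun do under eq_bigr do rewrite mulrCA.
by under eq_fun do rewrite -mulr_sumr; apply: ccvgZ; exact: dot_cvg.
Qed.

(** Bounded coordinatewise convergence is weak convergence: the tail of f is
    small against bounded sequences, the remaining coordinates are finitely many. *)
Lemma dot_weak f B X x : l2 f -> (forall i, l2b B (X i)) ->
  (forall k, ccvg (fun i => X i k) (x k)) ->
  ccvg (fun i => dot f (X i)) (dot f x).
Proof.
move=> lf hX hx; have hxB := l2b_lim hX hx; have B0 := l2b_ge0 hxB.
apply/ccvgP => e e0; have [A hA] := lf.
pose D := 4 * B + 1; have D0 : 0 < D by rewrite /D; lra.
pose d := e / 2 / D; have d0 : 0 < d by rewrite !divr_gt0.
have dd0 : 0 < d ^+ 2 * D by rewrite mulr_gt0 ?exprn_gt0.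
have [K hK] := l2b_tail hA dd0.
have : ccvg (fun i => \sum_(k < K) f k * (X i k - x k)) (\sum_(k < K) f k * 0).
  apply: ccvg_sum => k; apply: ccvgZ; rewrite -(subrr (x k)).
  by apply: ccvgD => //; exact: ccvg_cst.
rewrite big1 ?mulr0// => [|? _]; last by rewrite mulr0.
move=> /ccvgP/(_ (e / 2)); rewrite divr_gt0// => /(_ isT)[i0 hi0].
exists i0 => i /hi0; rewrite subr0 => hi.
pose y k := X i k - x k; have ly : l2b D y.
  have := l2b_young ltr01 (hX i) (l2bZ (-1) hxB).
  rewrite normcN normc1 expr1n invr1 => h.
  rewrite /y; under eq_fun do rewrite -mulN1r.
  by apply: l2bW h; rewrite /D; lra.
have <- : dot f y = dot f (X i) - dot f x.
  rewrite /y; under eq_fun do rewrite -mulN1r.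
  rewrite dotD ?dotZ ?mulN1r//; first by exists B.
  - by exists B.
  - by apply: l2Z; exists B.
have cy := dot_cvg lf (ex_intro _ D ly).
rewrite -[dot f y]subr0; apply: (ccvg_dist_le (ltW e0) cy); exists K => n Kn.
rewrite subr0 -(big_mkord xpredT (fun k => f k * y k)) (@big_cat_nat _ _ _ K)//= big_mkord.
apply: le_trans (modcD _ _) _; rewrite [e]splitr; apply: lerD => //.
apply: le_trans (@dot_range (d^-1) (d ^+ 2 * D) D f y K n _ (hK n) _) _.
- by rewrite invr_gt0.
- apply: le_trans (ly n); rewrite -[leRHS](big_mkord xpredT (fun k => normc (y k) ^+ 2)).
  by rewrite [leRHS](@big_cat_nat _ _ _ K)//= lerDr sumr_ge0// => k _; exact: sqr_ge0.
have eD : d * D = e / 2 by rewrite /d divfK// gt_eqF.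
have -> : d^-1 * (d ^+ 2 * D) = d * D by field; rewrite gt_eqF.
by rewrite invrK eD; lra.
Qed.

End SequenceSpace.

(** * Weakly continuous functionals and bounded operators *)

Section Operators.
Variable R : realType.
Local Notation C := R[i].
Local Notation seqs := (nat -> C).
Local Notation basis_vector := (basis_vector R).
Implicit Types (x y f : seqs) (X : nat -> seqs) (L : seqs -> C) (A : seqs -> seqs).

(** Weak continuity is asked on bounded sequences of vectors only; it follows
    for the pairing with an l2 sequence, and together with linearity it makes a
    functional determined by its values on the standard basis. *)
Record wfun L : Prop := Wfun {
  wfunD : forall x y, l2 x -> l2 y -> L (fun k => x k + y k) = L x + L y;
  wfunZ : forall c x, l2 x -> L (fun k => c * x k) = c * L x;
  wfun_weak : forall (B : R) X x, (forall i, l2b B (X i)) ->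
    (forall k, ccvg (fun i => X i k) (x k)) -> ccvg (fun i => L (X i)) (L x) }.

Definition opb (M : R) A := forall (B : R) x, l2b B x -> l2b (M * B) (A x).

Record bop A : Prop := Bop {
  bop_bound : exists M, opb M A;
  bop_coord : forall j, wfun (fun x => A x j) }.

Lemma bop_l2 A x : bop A -> l2 x -> l2 (A x).
Proof. by move=> [[M hM] _] [B hB]; exists (M * B); exact: hM. Qed.

Lemma bopD A x y : bop A -> l2 x -> l2 y ->
  A (fun k => x k + y k) = (fun k => A x k + A y k).
Proof. by move=> hA hx hy; apply/funext => j; exact: (wfunD (bop_coord hA j)). Qed.

Lemma bopZ A c x : bop A -> l2 x -> A (fun k => c * x k) = (fun k => c * A x k).
Proof. by move=> hA hx; apply/funext => j; exact: (wfunZ (bop_coord hA j)). Qed.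

Lemma wfun_comp L A : wfun L -> bop A -> wfun (fun x => L (A x)).
Proof.
move=> hL hA; split.
- move=> x y hx hy; rewrite (bopD hA hx hy) (wfunD hL)//; exact: bop_l2.
- move=> c x hx; rewrite (bopZ c hA hx) (wfunZ hL)//; exact: bop_l2.
- move=> B X x hX cX; have [M hM] := bop_bound hA.
  apply: (wfun_weak hL (B := M * B)) => [i|j]; first exact: hM.
  exact: (wfun_weak (bop_coord hA j) hX cX).
Qed.

Lemma bop_comp A A' : bop A -> bop A' -> bop (fun x => A (A' x)).
Proof.
move=> hA hA'; split=> [|j]; last exact: (wfun_comp (bop_coord hA j) hA').
have [M hM] := bop_bound hA; have [M' hM'] := bop_bound hA'.
by exists (M * M') => B x hx; rewrite -mulrA; apply: hM; exact: hM'.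
Qed.

Lemma bop_add A A' : bop A -> bop A' -> bop (fun x j => A x j + A' x j).
Proof.
move=> hA hA'; split=> [|j]; last split.
- have [M hM] := bop_bound hA; have [M' hM'] := bop_bound hA'.
  exists (2 * M + 2 * M') => B x hx.
  have := l2b_young ltr01 (hM _ _ hx) (hM' _ _ hx); apply: l2bW.
  by rewrite invr1; lra.
- by move=> x y hx hy; rewrite (bopD hA hx hy) (bopD hA' hx hy) addrACA.
- by move=> c x hx; rewrite (bopZ c hA hx) (bopZ c hA' hx) mulrDr.
- move=> B X x hX cX; apply: ccvgD.
    exact: (wfun_weak (bop_coord hA j) hX cX).
  exact: (wfun_weak (bop_coord hA' j) hX cX).
Qed.

Lemma wfun_dot f : l2 f -> wfun (dot f).
Proof.
move=> hf; split; [by move=> *; exact: dotD|by move=> *; exact: dotZ|].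
by move=> B X x; exact: dot_weak.
Qed.

Lemma wfun0 L : wfun L -> L (fun=> 0) = 0.
Proof.
move=> hL; have h0 : l2 (fun=> 0 : C) by apply: (@l2_finite _ _ 0%N).
by have := wfunZ hL 0 h0; rewrite !mul0r.
Qed.

Lemma wfun_sum L (n : nat) (F : 'I_n -> seqs) : wfun L -> (forall i, l2 (F i)) ->
  L (fun k => \sum_(i < n) F i k) = \sum_(i < n) L (F i).
Proof.
move=> hL; elim: n F => [|n IH] F hF.
  by rewrite big_ord0 -[RHS](wfun0 hL); congr L; apply/funext => k; rewrite big_ord0.
rewrite [RHS]big_ord_recr /= -(IH (fun i => F (widen_ord (leqnSn n) i)))//.
rewrite -[RHS](wfunD hL)//; last by apply: l2_sum.
by congr L; apply/funext => k; rewrite big_ord_recr.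
Qed.

Lemma finite_basisE x N : (fun k => if (k < N)%N then x k else 0) =
  (fun k => \sum_(i < N) x i * basis_vector i k).
Proof.
apply/funext => k; rewrite /basis_vector.
case: ifP => kN; last first.
  rewrite big1// => i _; case: eqP; rewrite ?mulr0// => ki.
  by move: kN; rewrite ki ltn_ord.
rewrite (bigD1 (Ordinal kN))//= eqxx mulr1 big1 ?addr0// => i ik.
by case: eqP; rewrite ?mulr0// => ki; case/negP: ik; apply/eqP/val_inj.
Qed.

Lemma wfun_finite L x N : wfun L ->
  L (fun k => if (k < N)%N then x k else 0) = \sum_(i < N) x i * L (basis_vector i).
Proof.
move=> hL; rewrite finite_basisE (@wfun_sum _ _ (fun (i : 'I_N) k => x i * basis_vector i k))//.
  by apply: eq_bigr => i _; rewrite (wfunZ hL)//; exact: l2_basis.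
by move=> i; apply: l2Z; exact: l2_basis.
Qed.

(** The truncations of x are bounded by x and converge to it coordinatewise. *)
Lemma wfun_cvg L x : wfun L -> l2 x ->
  ccvg (fun N => \sum_(i < N) x i * L (basis_vector i)) (L x).
Proof.
move=> hL [B hB]; under eq_fun do rewrite -wfun_finite//.
apply: (wfun_weak hL (B := B)) => [N M|k].
  apply: le_trans (hB M); apply: ler_sum => k _; case: ifP => // _.
  by rewrite normc0 expr0n/= sqr_ge0.
by apply: (@ccvg_eventually _ _ _ k.+1) => n kn; rewrite kn.
Qed.

(** This reduces the operator identities below to identities between matrix
    entries, that is, between Fourier coefficients. *)
Lemma wfun_ext L L' : wfun L -> wfun L' ->
  (forall k, L (basis_vector k) = L' (basis_vector k)) -> forall x, l2 x -> L x = L' x.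
Proof.
move=> hL hL' h x hx; have := wfun_cvg hL hx; have := wfun_cvg hL' hx.
under eq_fun do under eq_bigr do rewrite -h.
by move=> h1 h2; exact: ccvg_unique h2 h1.
Qed.

Lemma bop_ext A A' : bop A -> bop A' ->
  (forall k j, A (basis_vector k) j = A' (basis_vector k) j) ->
  forall x, l2 x -> A x = A' x.
Proof.
move=> hA hA' h x hx; apply/funext => j.
exact: (wfun_ext (bop_coord hA j) (bop_coord hA' j) (fun k => h k j) hx).
Qed.

Lemma bop_id : bop (fun x => x).
Proof.
split; first by exists 1 => B x; rewrite mul1r.
by move=> j; split=> // B X x _; apply.
Qed.

Lemma bop_scale (c : C) : bop (fun x k => c * x k).
Proof.
split; first by exists (normc c ^+ 2) => B x; exact: l2bZ.
move=> j; split=> [x y _ _|d x _|B X x _ h]; first by rewrite mulrDr.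
  by rewrite mulrCA.
exact: ccvgZ.
Qed.

(** Fatou on finite sections: a bound for the rectangular blocks of a matrix
    bounds the operator. *)
Lemma mop_opb (a : nat -> nat -> C) (M : R) : 0 <= M -> (forall j, l2 (a j)) ->
  (forall x J N, \sum_(j < J) normc (\sum_(k < N) a j k * x k) ^+ 2
     <= M * \sum_(k < N) normc (x k) ^+ 2) ->
  opb M (fun x j => dot (a j) x).
Proof.
move=> M0 ha h B x hx J.
have cv : (fun N => \sum_(j < J) normc (\sum_(k < N) a j k * x k) ^+ 2) @ \oo -->
          \sum_(j < J) normc (dot (a j) x) ^+ 2.
  apply: cvg_big => [|j _]; first exact: add_continuous.
  by apply: ccvg_mod2; apply: dot_cvg => //; exists B.
have <- := cvg_lim (@Rhausdorff R) cv.
apply: limr_le; first by apply/cvg_ex; eexists; exact: cv.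
by apply: nearW => N; apply: le_trans (h x J N) _; apply: ler_wpM2l => //; exact: hx.
Qed.

Lemma mop_bop (a : nat -> nat -> C) (M : R) : (forall j, l2 (a j)) ->
  opb M (fun x j => dot (a j) x) -> bop (fun x j => dot (a j) x).
Proof. by move=> ha h; split=> [|j]; [exists M|exact: wfun_dot]. Qed.

Lemma dot_basis f k : dot f (basis_vector k) = f k.
Proof.
rewrite /dot (@csum_finite _ _ k.+1) => [|j kj].
  rewrite (bigD1 (Ordinal (ltnSn k)))//= big1 ?addr0 => [|i ik].
    by rewrite /Defs.basis_vector eqxx mulr1.
  rewrite /Defs.basis_vector; case: eqP; rewrite ?mulr0// => ki.
  by case/negP: ik; apply/eqP/val_inj.
by rewrite /Defs.basis_vector; case: eqP kj => [->|]; rewrite ?ltnn ?mulr0.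
Qed.

(** Each application of A shrinks the bound of a fixed point by the factor q. *)
Lemma contraction_inj A (q : R) : opb q A -> 0 <= q < 1 ->
  forall x, l2 x -> A x = x -> x = (fun=> 0).
Proof.
move=> hA /andP[q0 q1] x [B hB] Ax.
have hn n : l2b (q ^+ n * B) x.
  elim: n => [|n IH]; first by rewrite expr0 mul1r.
  by rewrite -Ax exprS -mulrA; exact: hA.
apply/funext => k; apply: modc_eq0; apply/eqP.
rewrite -sqrf_eq0 eq_le sqr_ge0 andbT.
have h0 : (fun n => q ^+ n * B) @ \oo --> (0 : R).
  by rewrite -[X in _ --> X](mul0r B); apply: cvgMl; apply: cvg_expr; rewrite ger0_norm.
have <- := cvg_lim (@Rhausdorff R) h0.
apply: limr_ge; first by apply/cvg_ex; eexists; exact: h0.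
apply: nearW => n; apply: le_trans (hn n k.+1).
by rewrite big_ord_recr /= lerDr sumr_ge0// => i _; exact: sqr_ge0.
Qed.

(** The Neumann series for (1 - A)^-1 y, as the limit of the iterates of
    x |-> A x + y.  The squared norms of consecutive differences decay like q ^+ n,
    so the iterates converge coordinatewise and stay bounded; weak continuity
    of A then identifies the limit as a fixed point. *)
Lemma contraction_fixpoint A (q : R) : bop A -> opb q A -> 0 <= q < 1 ->
  forall y, l2 y -> exists2 x, l2 x & x = (fun k => A x k + y k).
Proof.
move=> bA hA /andP[q0 q1] y [Y hY]; have Y0 := l2b_ge0 hY.
pose X := fix X n : seqs := if n is n'.+1 then (fun k => A (X n') k + y k) else (fun=> 0).
(* t is small enough for q' = (1 + t) q to remain below 1 *)
pose t := (1 - q) / 2; have t0 : 0 < t by rewrite /t; lra.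
have tV : 0 < t^-1 by rewrite invr_gt0.
pose q' := (1 + t) * q; have q'1 : q' < 1 by rewrite /q' /t; nra.
have q'0 : 0 <= q' by rewrite /q' mulr_ge0// addr_ge0// ltW.
pose B := (1 + t^-1) * Y / (1 - q').
have B0 : 0 <= B.
  by rewrite /B divr_ge0 ?mulr_ge0// ?subr_ge0 ?addr_ge0// ltW.
have eB : q' * B + (1 + t^-1) * Y = B.
  by rewrite /B; field; rewrite gt_eqF ?subr_gt0// gt_eqF.
have hX n : l2b B (X n).
  elim: n => [|n IH] /=.
    by move=> N; rewrite big1// => k _; rewrite normc0 expr0n.
  have := l2b_young t0 (hA _ _ IH) hY; apply: l2bW.
  by rewrite mulrA -/q' eB.
have lX n : l2 (X n) by exists B.
pose D n k := X n.+1 k - X n k.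
have hD n : l2b (q ^+ n * Y) (D n).
  elim: n => [|n IH].
    rewrite expr0 mul1r /D /= => N; apply: le_trans (hY N).
    apply: ler_sum => k _; rewrite subr0.
    by rewrite (wfun0 (bop_coord bA k)) add0r.
  rewrite exprS -mulrA; have := hA _ _ IH.
  have -> : A (D n) = D n.+1; last by [].
  apply/funext => k; rewrite /D; under eq_fun do rewrite -mulN1r.
  rewrite (bopD bA)//; last exact: l2Z.
  by rewrite (bopZ _ bA)//= mulN1r opprD addrACA subrr addr0.
have sq0 : 0 <= Num.sqrt q := sqrtr_ge0 q.
have sq1 : Num.sqrt q < 1 by rewrite -sqrtr1 ltr_sqrt.
have Dle n k : normc (D n k) <= Num.sqrt Y * Num.sqrt q ^+ n.
  rewrite -ler_sqr ?nnegrE ?modc_ge0 ?mulr_ge0 ?exprn_ge0 ?sqrtr_ge0//.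
  rewrite exprMn sqr_sqrtr// exprAC sqr_sqrtr// mulrC.
  apply: le_trans (hD n k.+1).
  by rewrite big_ord_recr /= lerDr sumr_ge0// => i _; exact: sqr_ge0.
have Xsum n k : X n k = \sum_(i < n) D i k.
  elim: n => [|n IH]; first by rewrite big_ord0.
  by rewrite big_ord_recr -IH /D/= addrC subrK.
have cX k : ccvg (fun n => X n k) (csum (fun n => D n k)).
  under eq_fun do rewrite Xsum.
  apply: (@csum_abs_cvg _ _ (Num.sqrt Y / (1 - Num.sqrt q))) => N.
  apply: (@le_trans _ _ (\sum_(i < N) Num.sqrt Y * Num.sqrt q ^+ i)).
    by apply: ler_sum => i _; exact: Dle.
  rewrite -mulr_sumr ler_wpM2l ?sqrtr_ge0//.
  have s1 : 0 < 1 - Num.sqrt q by rewrite subr_gt0.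
  rewrite -[leRHS]mul1r ler_pdivlMr// mulrC.
  by have := subrX1 (Num.sqrt q) N; have := exprn_ge0 N sq0; lra.
pose x k := csum (fun n => D n k).
exists x; first by exists B; exact: l2b_lim hX cX.
apply/funext => k; apply: (ccvg_unique (ccvg_shift (cX k))) => /=.
apply: ccvgD; last exact: ccvg_cst.
exact: (wfun_weak (bop_coord bA k) hX cX).
Qed.

End Operators.

(** * The complex exponential *)

Section ComplexExponential.
Variable R : realType.
Local Notation C := R[i].
Implicit Types (z w : C) (t : R).

Lemma Re_cexp z : complex.Re (cexp z) = expR (complex.Re z) * cos (complex.Im z).
Proof. by rewrite /cexp ReM /= mul0r subr0. Qed.

Lemma Im_cexp z : complex.Im (cexp z) = expR (complex.Re z) * sin (complex.Im z).
Proof. by rewrite /cexp ImM /= mul0r addr0. Qed.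

Lemma cexpD z w : cexp (z + w) = cexp z * cexp w.
Proof.
apply: complex_ext.
  rewrite (ReM (cexp z)) !Re_cexp !Im_cexp ReD ImD expRD cosD; ring.
rewrite (ImM (cexp z)) !Re_cexp !Im_cexp ReD ImD expRD sinD; ring.
Qed.

Lemma cexp0 : cexp (0 : C) = 1.
Proof. by apply: complex_ext; rewrite ?Re_cexp ?Im_cexp /= expR0 ?cos0 ?sin0 mul1r. Qed.

Lemma modc_cexp z : normc (cexp z) = expR (complex.Re z).
Proof.
apply/eqP; rewrite -(@eqrXn2 _ 2) ?modc_ge0 ?expR_ge0// modcE Re_cexp Im_cexp !exprMn.
by rewrite -mulrDr cos2Dsin2 mulr1.
Qed.

Lemma cexp_sum (I : Type) (s : seq I) (P : pred I) (F : I -> C) :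
  cexp (\sum_(i <- s | P i) F i) = \prod_(i <- s | P i) cexp (F i).
Proof.
by elim/big_ind2 : _ => // [|x1 x2 y1 y2 <- <-]; rewrite ?cexp0 ?cexpD.
Qed.

Lemma expiE t : expi t = cos t +i* sin t.
Proof.
apply: complex_ext; rewrite ?Re_cexp ?Im_cexp (ReM 'i) (ImM 'i) /=;
by rewrite !mul0r !mulr0 subr0 ?add0r ?addr0 expR0 !mul1r.
Qed.

Lemma Re_expi t : complex.Re (expi t) = cos t. Proof. by rewrite expiE. Qed.
Lemma Im_expi t : complex.Im (expi t) = sin t. Proof. by rewrite expiE. Qed.

Lemma expiD t s : expi (t + s) = expi t * expi s.
Proof.
apply: complex_ext.
  by rewrite (ReM (expi t)) !Re_expi !Im_expi cosD.
by rewrite (ImM (expi t)) !Re_expi !Im_expi sinD addrC.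
Qed.

Lemma expi0 : expi (0 : R) = 1.
Proof. by rewrite expiE cos0 sin0. Qed.

Lemma expiN t : expi (- t) = (expi t)^*%C.
Proof. by rewrite !expiE cosN sinN. Qed.

Lemma modc_expi t : normc (expi t) = 1.
Proof. by rewrite expiE /= cos2Dsin2 sqrtr1. Qed.

Lemma expi_conjM t : expi t * (expi t)^*%C = 1.
Proof. by rewrite -expiN -expiD subrr expi0. Qed.

Lemma expiX (k : nat) t : expi t ^+ k = expi (k%:R * t).
Proof.
elim: k => [|k IH]; first by rewrite mul0r expi0.
by rewrite exprS IH -expiD -nat1r mulrDl mul1r.
Qed.

End ComplexExponential.

(** * Complex-valued measurable and square integrable functions *)

Section Measurability.
Variable R : realType.
Local Notation C := R[i].
Implicit Types (F G : R -> C).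

Definition cmeas F := measurable_fun setT (fun t => complex.Re (F t)) /\
  measurable_fun setT (fun t => complex.Im (F t)).

Lemma cmeas_cst c : cmeas (fun=> c).
Proof. by split; exact: measurable_cst. Qed.

Lemma cmeasD F G : cmeas F -> cmeas G -> cmeas (fun t => F t + G t).
Proof.
move=> [h1 h2] [h3 h4]; split.
  by under eq_fun do rewrite ReD; exact: measurable_funD.
by under eq_fun do rewrite ImD; exact: measurable_funD.
Qed.

Lemma cmeasM F G : cmeas F -> cmeas G -> cmeas (fun t => F t * G t).
Proof.
move=> [h1 h2] [h3 h4]; split.
  by under eq_fun do rewrite ReM; apply: measurable_funB; exact: measurable_funM.
by under eq_fun do rewrite ImM; apply: measurable_funD; exact: measurable_funM.
Qed.

Lemma cmeas_prod (I : Type) (s : seq I) (F : I -> R -> C) :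
  (forall i, cmeas (F i)) -> cmeas (fun t => \prod_(i <- s) F i t).
Proof.
move=> h; elim: s => [|i s IH].
  by under eq_fun do rewrite big_nil; exact: cmeas_cst.
by under eq_fun do rewrite big_cons; exact: cmeasM.
Qed.

Lemma cmeas_real (f : R -> R) : measurable_fun setT f -> cmeas (fun t => (f t)%:C).
Proof. by move=> h; split => //=; exact: measurable_cst. Qed.

Lemma cmeas_cexp F : cmeas F -> cmeas (fun t => cexp (F t)).
Proof.
move=> [h1 h2]; split.
  under eq_fun do rewrite Re_cexp; apply: measurable_funM.
    by apply: measurableT_comp h1; exact: measurable_expR.
  by apply: measurableT_comp h2; apply: continuous_measurable_fun; exact: continuous_cos.
under eq_fun do rewrite Im_cexp; apply: measurable_funM.
  by apply: measurableT_comp h1; exact: measurable_expR.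
by apply: measurableT_comp h2; apply: continuous_measurable_fun; exact: continuous_sin.
Qed.

Lemma cmeas_expi (f : R -> R) : measurable_fun setT f -> cmeas (fun t => expi (f t)).
Proof.
move=> h; rewrite /expi; apply: cmeas_cexp; apply: cmeasM; [exact: cmeas_cst|exact: cmeas_real].
Qed.

Lemma measurable_modc2 F : cmeas F -> measurable_fun setT (fun t => normc (F t) ^+ 2).
Proof.
move=> [h1 h2]; under eq_fun do rewrite modcE.
by apply: measurable_funD; exact: measurable_funX.
Qed.

End Measurability.

Section Integration.
Variable R : realType.
Local Notation C := R[i].
Local Notation mu := (@lebesgue_measure R).
Local Notation D := (`[0, 2 * pi]%classic : set R).
Implicit Types (F G H : R -> C) (f g : R -> R).

Definition rint f := Rintegral mu D f.
Definition rintegrable f := mu.-integrable D (EFin \o f).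
Definition cintegrable F := rintegrable (fun t => complex.Re (F t)) /\
  rintegrable (fun t => complex.Im (F t)).
Definition cint F := cintegral D F.

Lemma two_pi_gt0 : 0 < 2 * pi :> R.
Proof. by rewrite mulr_gt0// pi_gt0. Qed.

Lemma mu_D : mu D = (2 * pi)%:E.
Proof.
by rewrite lebesgue_measure_itv /= lte_fin two_pi_gt0 -EFinB subr0.
Qed.

Lemma rintegrable_measurable f : measurable_fun setT f ->
  measurable_fun (D : set (measurableTypeR R)) (EFin \o (f : measurableTypeR R -> R)).
Proof.
move=> mf; apply/measurable_EFinP.
have := measurable_funTS (D := D) mf; exact.
Qed.

Lemma rintegrable_le f g : measurable_fun setT f -> (forall t, D t -> `|f t| <= g t) ->
  rintegrable g -> rintegrable f.
Proof.
move=> mf fg ig; apply: (le_integrable _ _ _ ig) => //.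
  exact: rintegrable_measurable.
move=> t Dt /=; rewrite lee_fin; apply: le_trans (fg t Dt) _; exact: ler_norm.
Qed.

Lemma rintegrable_cst (r : R) : rintegrable (fun=> r).
Proof.
apply: measurable_bounded_integrable; first exact: measurable_itv.
- by have : (mu D < +oo)%E by rewrite mu_D ltry.
- exact: measurable_cst.
by exists `|r|; split => // x rx t _ /=; exact: ltW.
Qed.

Lemma rintegrableD f g : rintegrable f -> rintegrable g -> rintegrable (fun t => f t + g t).
Proof. by move=> hf hg; have := integrableD (D := D) (mu := mu) _ hf hg; exact. Qed.

Lemma rintegrableZ (r : R) f : rintegrable f -> rintegrable (fun t => r * f t).
Proof. by move=> hf; have := integrableZl (D := D) (mu := mu) _ r hf; exact. Qed.

Lemma rintegrableB f g : rintegrable f -> rintegrable g -> rintegrable (fun t => f t - g t).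
Proof. by move=> hf hg; have := integrableB (D := D) (mu := mu) _ hf hg; exact. Qed.

Lemma cintegrableZ c F : cintegrable F -> cintegrable (fun t => c * F t).
Proof.
move=> [h1 h2]; split.
  by under eq_fun do rewrite ReM; apply: rintegrableB; exact: rintegrableZ.
by under eq_fun do rewrite ImM; apply: rintegrableD; exact: rintegrableZ.
Qed.

Lemma cintD F G : cintegrable F -> cintegrable G ->
  cint (fun t => F t + G t) = cint F + cint G.
Proof.
move=> [h1 h2] [h3 h4]; apply: complex_ext; rewrite ?ReD ?ImD /=.
  by under eq_Rintegral do rewrite ReD; rewrite RintegralD.
by under eq_Rintegral do rewrite ImD; rewrite RintegralD.
Qed.

Lemma cintZ c F : cintegrable F -> cint (fun t => c * F t) = c * cint F.
Proof.
move=> [h1 h2]; apply: complex_ext; rewrite ?ReM ?ImM /=.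
  under eq_Rintegral do rewrite ReM.
  by rewrite RintegralB ?RintegralZl//; exact: rintegrableZ.
under eq_Rintegral do rewrite ImM.
by rewrite RintegralD ?RintegralZl//; exact: rintegrableZ.
Qed.

Definition sqint F := cmeas F /\ rintegrable (fun t => normc (F t) ^+ 2).

Lemma sqint_le F (g : R -> R) : cmeas F -> (forall t, D t -> normc (F t) ^+ 2 <= g t) ->
  rintegrable g -> sqint F.
Proof.
move=> mF Fg ig; split => //; apply: rintegrable_le ig; first exact: measurable_modc2.
by move=> t Dt; rewrite ger0_norm ?sqr_ge0//; exact: Fg.
Qed.

Lemma sqint_bounded F (B : R) : cmeas F -> (forall t, D t -> normc (F t) <= B) -> sqint F.
Proof.
move=> mF hB; apply: (sqint_le mF _ (rintegrable_cst (B ^+ 2))) => t Dt.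
by rewrite lerXn2r ?nnegrE ?modc_ge0 ?hB// (le_trans _ (hB t Dt))// modc_ge0.
Qed.

Lemma sqintD F G : sqint F -> sqint G -> sqint (fun t => F t + G t).
Proof.
move=> [mF iF] [mG iG].
apply: (sqint_le (cmeasD mF mG) _ (rintegrableD (rintegrableZ 2 iF) (rintegrableZ 2 iG))).
by move=> t _; have := @modcD_young _ 1 (F t) (G t) ltr01; rewrite invr1; lra.
Qed.

Lemma sqint_boundedM F G (B : R) : cmeas F -> (forall t, D t -> normc (F t) <= B) ->
  sqint G -> sqint (fun t => F t * G t).
Proof.
move=> mF hB [mG iG]; apply: (sqint_le (cmeasM mF mG) _ (rintegrableZ (B ^+ 2) iG)) => t Dt.
rewrite normcM exprMn ler_wpM2r ?sqr_ge0//.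
by rewrite lerXn2r ?nnegrE ?modc_ge0 ?hB// (le_trans _ (hB t Dt))// modc_ge0.
Qed.

Lemma sqintZ c F : sqint F -> sqint (fun t => c * F t).
Proof. by apply: (@sqint_boundedM _ _ (normc c)) => //; exact: cmeas_cst. Qed.

Lemma cintegrableM F G : sqint F -> sqint G -> cintegrable (fun t => F t * G t).
Proof.
move=> [mF iF] [mG iG]; have [m1 m2] := cmeasM mF mG.
have h t : normc (F t * G t) <= 2^-1 * (normc (F t) ^+ 2 + normc (G t) ^+ 2).
  by have := @modc_young _ 1 (F t) (G t) ltr01; rewrite invr1; lra.
have ih := rintegrableZ 2^-1 (rintegrableD iF iG).
split; apply: rintegrable_le ih => // t _; apply: le_trans (h t).
  exact: Re_le_modc.
exact: Im_le_modc.
Qed.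

(** A weighted Cauchy-Schwarz inequality; the crude constant comes from treating
    real and imaginary parts separately. *)
Lemma cintM_le F G (t : R) : 0 < t -> sqint F -> sqint G ->
  normc (cint (fun s => F s * G s)) <=
  t * rint (fun s => normc (F s) ^+ 2) + t^-1 * rint (fun s => normc (G s) ^+ 2).
Proof.
move=> t0 hF hG; have [iR iI] := cintegrableM hF hG;
have [_ iF] := hF; have [_ iG] := hG.
have itF := rintegrableZ t iF; have itG := rintegrableZ t^-1 iG.
have ih := rintegrableD itF itG; have ih2 := rintegrableZ 2^-1 ih.
have hle (f : R -> R) : rintegrable f -> (forall s, `|f s| <= normc (F s * G s)) ->
    `|rint f| <= 2^-1 * (t * rint (fun s => normc (F s) ^+ 2) +
                         t^-1 * rint (fun s => normc (G s) ^+ 2)).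
  move=> fi fle; apply: le_trans (le_normr_Rintegral _ fi) _; first by [].
  have -> : 2^-1 * (t * rint (fun s => normc (F s) ^+ 2) +
       t^-1 * rint (fun s => normc (G s) ^+ 2)) =
     rint (fun s => 2^-1 * (t * normc (F s) ^+ 2 + t^-1 * normc (G s) ^+ 2)).
    by rewrite /rint RintegralZl// RintegralD// !RintegralZl.
  apply: le_Rintegral => //; first exact: integrable_norm.
  by move=> s _; apply: le_trans (fle s) _; have := modc_young (F s) (G s) t0; lra.
apply: le_trans (modc_le_ReIm _) _.
have := hle _ iR (fun s => Re_le_modc _); have := hle _ iI (fun s => Im_le_modc _).
rewrite /rint /cint /cintegral /=; lra.
Qed.

(** The same formula as for [fourier], for a function of the angle rather than of
    the point of the circle. *)
Definition fc F (k : int) : C := ((2 * pi)^-1)%:C * cint (fun t => F t * expi (- (k%:~R * t))).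

End Integration.

(* Simplification would unfold these to formulas in real and imaginary parts. *)
#[local] Arguments normc : simpl never.
#[local] Arguments expi : simpl never.
#[local] Arguments cexp : simpl never.
#[local] Arguments fc : simpl never.

(** * Fourier coefficients and the Bessel inequality *)

Section FourierCoefficients.
Variable R : realType.
Local Notation C := R[i].
Local Notation mu := (@lebesgue_measure R).
Local Notation D := (`[0, 2 * pi]%classic : set R).
Implicit Types (F G : R -> C).

Lemma eq_cint F G : (forall t, F t = G t) -> cint F = cint G.
Proof. by move=> /funext ->. Qed.

Lemma Re_cint F : complex.Re (cint F) = rint (fun t => complex.Re (F t)).
Proof. by []. Qed.

Lemma Im_cint F : complex.Im (cint F) = rint (fun t => complex.Im (F t)).
Proof. by []. Qed.

Lemma rint_cst (r : R) : rint (fun=> r) = r * (2 * pi).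
Proof.
rewrite /rint Rintegral_cst//; congr (_ * _).
exact: (congr1 fine (mu_D R)).
Qed.

Lemma eq_rint (f g : R -> R) : (forall t, f t = g t) -> rint f = rint g.
Proof. by move=> /funext ->. Qed.

Lemma rint_FTC (f P : R -> R) : continuous f -> (forall x : R, is_derive x (1 : R) P (f x)) ->
  rint f = P (2 * pi) - P 0.
Proof.
move=> cf dP; rewrite /rint /Rintegral (@continuous_FTC2 _ f P) //.
- exact: two_pi_gt0.
- exact: continuous_subspaceT.
- have cP : continuous P.
    by move=> x; apply/differentiable_continuous/derivable1_diffP; have [] := dP x.
  split => [x _||]; first by have [] := dP x.
    exact/cvg_at_right_filter/cP.
  exact/cvg_at_left_filter/cP.
- by move=> x _; rewrite derive1E; have [] := dP x.
Qed.

Definition ek (k : int) (t : R) : C := expi (k%:~R * t).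

Lemma ek_period k : ek k (2 * pi) = 1.
Proof.
have h : expi (2 * pi : R) = 1.
  by rewrite expiE mulrC mulr_natr cos2pi sin2pi.
have hn (n : nat) : expi (n%:R * (2 * pi) : R) = 1 by rewrite -expiX h expr1n.
rewrite /ek; case: k => n; first by rewrite -pmulrn hn.
by rewrite NegzE mulrNz mulNr expiN -pmulrn hn conjc1.
Qed.

Lemma rint_cos (a : R) : a != 0 ->
  rint (fun t => cos (a * t)) = a^-1 * sin (a * (2 * pi)).
Proof.
move=> a0.
have dP (x : R) : is_derive x (1 : R) (fun t => a^-1 * sin (a * t)) (cos (a * x)).
  apply: is_derive_eq; rewrite /GRing.scale /= !mulr1; field; exact: a0.
have cf : continuous (fun t : R => cos (a * t)).
  move=> x; apply: (@continuous_comp _ _ _ (fun t => a * t) cos); last exact: continuous_cos.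
  by apply: cvgMr; exact: cvg_id.
by rewrite (rint_FTC cf dP) mulr0 sin0 mulr0 subr0.
Qed.

Lemma rint_sin (a : R) : a != 0 ->
  rint (fun t => sin (a * t)) = a^-1 * (1 - cos (a * (2 * pi))).
Proof.
move=> a0.
have dP (x : R) : is_derive x (1 : R) (fun t => - a^-1 * cos (a * t)) (sin (a * x)).
  apply: is_derive_eq; rewrite /GRing.scale /= !mulr1; field; exact: a0.
have cf : continuous (fun t : R => sin (a * t)).
  move=> x; apply: (@continuous_comp _ _ _ (fun t => a * t) sin); last exact: continuous_sin.
  by apply: cvgMr; exact: cvg_id.
rewrite (rint_FTC cf dP) mulr0 cos0; ring.
Qed.

Lemma cint_ek k : cint (ek k) = if k == 0 then (2 * pi)%:C else 0.
Proof.
case: eqP => [->|/eqP k0].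
  apply: complex_ext; rewrite ?Re_cint ?Im_cint.
    rewrite (@eq_rint _ (fun=> 1)) ?rint_cst ?mul1r// => t.
    by rewrite /ek mulr0z mul0r Re_expi cos0.
  rewrite (@eq_rint _ (fun=> 0)) ?rint_cst ?mul0r// => t.
  by rewrite /ek mulr0z mul0r Im_expi sin0.
have kR : k%:~R != 0 :> R by rewrite intr_eq0.
have := ek_period k; rewrite /ek expiE => /eqP; rewrite eq_complex /= => /andP[/eqP hc /eqP hs].
apply: complex_ext; rewrite ?Re_cint ?Im_cint.
  rewrite (@eq_rint _ (fun t => cos (k%:~R * t))) => [|t]; last by rewrite /ek Re_expi.
  by rewrite (rint_cos kR) hs mulr0.
rewrite (@eq_rint _ (fun t => sin (k%:~R * t))) => [|t]; last by rewrite /ek Im_expi.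
by rewrite (rint_sin kR) hc subrr mulr0.
Qed.

Lemma modc_ek k t : normc (ek k t) = 1. Proof. exact: modc_expi. Qed.

Lemma cmeas_ek k : cmeas (ek k).
Proof.
apply: cmeas_expi; apply: continuous_measurable_fun => x.
by apply: cvgMr; exact: cvg_id.
Qed.

Lemma sqint_ek k : sqint (ek k).
Proof. by apply: (@sqint_bounded _ _ 1); [exact: cmeas_ek|move=> t _; rewrite modc_ek]. Qed.

Lemma ekD k m t : ek (k + m) t = ek k t * ek m t.
Proof. by rewrite /ek intrD mulrDl expiD. Qed.

Lemma ekN k t : ek (- k) t = (ek k t)^*%C.
Proof. by rewrite /ek mulrNz mulNr expiN. Qed.


Lemma fcE F k : fc F k = ((2 * pi)^-1)%:C * cint (fun t => F t * ek (- k) t).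
Proof. by rewrite /fc; congr (_ * _); apply: eq_cint => t; rewrite /ek mulrNz mulNr. Qed.

Lemma eq_fc F G k : (forall t, F t = G t) -> fc F k = fc G k.
Proof. by move=> /funext ->. Qed.

Lemma fcD F G k : sqint F -> sqint G -> fc (fun t => F t + G t) k = fc F k + fc G k.
Proof.
move=> hF hG; rewrite !fcE -mulrDr -cintD; try by apply: cintegrableM => //; exact: sqint_ek.
by congr (_ * _); apply: eq_cint => t; rewrite mulrDl.
Qed.

Lemma fcZ c F k : sqint F -> fc (fun t => c * F t) k = c * fc F k.
Proof.
move=> hF; rewrite !fcE mulrCA -(cintZ c); last by apply: cintegrableM => //; exact: sqint_ek.
by congr (_ * _); apply: eq_cint => t; rewrite mulrA.
Qed.

Lemma sqint0 : sqint (fun=> 0 : C).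
Proof. by apply: (@sqint_bounded _ _ 0) => [|t _]; [exact: cmeas_cst|rewrite normc0]. Qed.

Lemma fc0 k : fc (fun=> 0 : C) k = 0.
Proof. by have := fcZ 0 k sqint0; rewrite !mul0r. Qed.

Lemma sqint_sum (N : nat) (F : 'I_N -> R -> C) : (forall i, sqint (F i)) ->
  sqint (fun t => \sum_(i < N) F i t).
Proof.
elim: N F => [|N IH] F hF.
  by under eq_fun do rewrite big_ord0; exact: sqint0.
by under eq_fun do rewrite big_ord_recr /=; apply: sqintD; [exact: IH|exact: hF].
Qed.

Lemma fc_sum (N : nat) (F : 'I_N -> R -> C) k : (forall i, sqint (F i)) ->
  fc (fun t => \sum_(i < N) F i t) k = \sum_(i < N) fc (F i) k.
Proof.
elim: N F => [|N IH] F hF.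
  by rewrite big_ord0 -[RHS](fc0 k); apply: eq_fc => t; rewrite big_ord0.
rewrite big_ord_recr /= -(IH (fun i => F (widen_ord (leqnSn N) i))) => [|i]; last exact: hF.
rewrite -fcD; [|exact: sqint_sum|exact: hF].
by apply: eq_fc => t; rewrite big_ord_recr.
Qed.

Lemma fc_ek k m : fc (ek k) m = (k == m)%:R.
Proof.
rewrite fcE (eq_cint (G := ek (k - m))) => [|t]; last by rewrite ekD.
rewrite cint_ek subr_eq0; case: eqP => _; last by rewrite mulr0.
by rewrite -rmorphM mulVf ?rmorph1// gt_eqF// two_pi_gt0.
Qed.

Lemma fc_mul_ek F k m : fc (fun t => F t * ek k t) m = fc F (m - k).
Proof.
rewrite !fcE; congr (_ * _); apply: eq_cint => t.
by rewrite -mulrA -ekD opprB.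
Qed.

Definition msq F : R := (2 * pi)^-1 * rint (fun t => normc (F t) ^+ 2).

Lemma msq_ge0 F : 0 <= msq F.
Proof.
rewrite /msq mulr_ge0 ?invr_ge0 ?(ltW (two_pi_gt0 R))//.
by apply: Rintegral_ge0 => t _; exact: sqr_ge0.
Qed.

Lemma msq_le_rint F : msq F <= rint (fun t => normc (F t) ^+ 2).
Proof.
have p2 := pi_ge2 R.
rewrite /msq ler_piMl//.
  by apply: Rintegral_ge0 => t _; exact: sqr_ge0.
by rewrite invf_le1; lra.
Qed.

(** Completing the square: adding x e_m with x = - fc F m removes the m-th
    coefficient and lowers the mean square by its squared modulus.  Iterated,
    this gives the Bessel inequality, and Parseval for trigonometric sums. *)
Lemma msq_add_ek F x m : sqint F ->
  msq (fun t => F t + x * ek m t) =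
  msq F + 2 * complex.Re (x^*%C * fc F m) + normc x ^+ 2.
Proof.
move=> hF; have hFe := cintegrableM hF (sqint_ek (- m)).
have e t : normc (F t + x * ek m t) ^+ 2 =
    normc (F t) ^+ 2 + (2 * complex.Re (x^*%C * (F t * ek (- m) t)) + normc x ^+ 2).
  rewrite ekN; have := modc_ek m t => /(congr1 (fun r => r ^+ 2)); rewrite expr1n modcE.
  case: (ek m t) => c s /= h; rewrite !modcE; case: (F t) => f1 f2; case: x => x1 x2 /=.
  have -> : x1 ^+ 2 + x2 ^+ 2 = (x1 ^+ 2 + x2 ^+ 2) * (c ^+ 2 + s ^+ 2) by rewrite h mulr1.
  ring.
have hx := cintegrableZ x^*%C hFe; have [i1 _] := hx.
have [_ iF] := hF; have i2 := rintegrableZ 2 i1; have i3 := rintegrable_cst (normc x ^+ 2).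
rewrite /msq; have -> : rint (fun t => normc (F t + x * ek m t) ^+ 2) =
   rint (fun t => normc (F t) ^+ 2) + (2 * complex.Re (x^*%C * cint (fun t => F t * ek (- m) t))
     + normc x ^+ 2 * (2 * pi)).
  rewrite -cintZ// {1}/rint; under eq_Rintegral do rewrite e.
  rewrite RintegralD//; last exact: rintegrableD.
  by rewrite RintegralD// RintegralZl// -(rint_cst (normc x ^+ 2)).
have -> : complex.Re (x^*%C * fc F m) =
    (2 * pi)^-1 * complex.Re (x^*%C * cint (fun t => F t * ek (- m) t)).
  rewrite fcE; set I := cint _; rewrite (mulrCA x^*%C) (ReM (_%:C)).
  by rewrite [complex.Im _%:C]/= mul0r subr0.
have := two_pi_gt0 R; set P := 2 * pi => P0.
by field; rewrite gt_eqF.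
Qed.

(** The family of frequencies is arbitrary, so that the same inequality serves
    for rows and columns of Toeplitz and of Hankel matrices. *)
Lemma bessel F (s : nat -> int) : injective s -> sqint F ->
  l2b (msq F) (fun k => fc F (s k)).
Proof.
move=> sI hF N; elim: N F hF => [|N IH] F hF; first by rewrite big_ord0 msq_ge0.
rewrite big_ord_recr /=; set c := fc F (s N).
pose G t := F t + (- c) * ek (s N) t.
have hG : sqint G by apply: sqintD => //; apply: sqintZ; exact: sqint_ek.
have := IH G hG; rewrite msq_add_ek// -/c modcN.
have -> : complex.Re ((- c)^*%C * c) = - normc c ^+ 2.
  by rewrite modcE; case: (c) => c1 c2 /=; ring.
rewrite (eq_bigr (fun k : 'I_N => normc (fc F (s k)) ^+ 2)).
  by lra.
move=> k _; rewrite /G fcD// ?fcZ ?fc_ek; [|exact: sqint_ek|apply: sqintZ; exact: sqint_ek].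
have /negPf -> : s N != s k by rewrite (inj_eq sI) gtn_eqF.
by rewrite mulr0 addr0.
Qed.

Lemma fc_le F m : sqint F -> normc (fc F m) ^+ 2 <= msq F.
Proof.
move=> hF; have sI : injective (fun k : nat => m + k%:Z) by move=> i j /addrI [].
by have := bessel sI hF 1%N; rewrite big_ord1 addr0.
Qed.

Definition trig (s : nat -> int) (N : nat) (x : nat -> C) (t : R) : C :=
  \sum_(k < N) x k * ek (s k) t.

Lemma sqint_trig s N x : sqint (trig s N x).
Proof. by apply: sqint_sum => k; apply: sqintZ; exact: sqint_ek. Qed.

Lemma fc_trig s N x m : fc (trig s N x) m = \sum_(k < N) x k * (s k == m)%:R.
Proof.
rewrite /trig fc_sum => [|k]; last by apply: sqintZ; exact: sqint_ek.
by apply: eq_bigr => k _; rewrite fcZ ?fc_ek//; exact: sqint_ek.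
Qed.

Lemma msq_trig s N x : injective s ->
  msq (trig s N x) = \sum_(k < N) normc (x k) ^+ 2.
Proof.
move=> sI; elim: N => [|N IH].
  rewrite big_ord0 /msq /rint; under eq_Rintegral do rewrite /trig big_ord0 normc0 expr0n.
  by rewrite Rintegral_cst// mul0r mulr0.
rewrite big_ord_recr /= -IH.
have -> : trig s N.+1 x = (fun t => trig s N x t + x N * ek (s N) t).
  by apply/funext => t; rewrite /trig big_ord_recr.
have z : fc (trig s N x) (s N) = 0.
  rewrite fc_trig big1// => k _.
  have /negPf -> : s k != s N by rewrite (inj_eq sI) ltn_eqF.
  by rewrite mulr0.
by rewrite msq_add_ek ?z ?mulr0 ?addr0//; exact: sqint_trig.
Qed.

Lemma fc_mul_trig F s N x m : sqint F ->
  fc (fun t => F t * trig s N x t) m = \sum_(k < N) fc F (m - s k) * x k.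
Proof.
move=> hF; have h k : sqint (fun t => F t * ek k t).
  under eq_fun do rewrite mulrC.
  apply: (@sqint_boundedM _ (ek k) F 1 (cmeas_ek k) _ hF) => t _.
  by rewrite modc_ek.
transitivity (fc (fun t => \sum_(k < N) x k * (F t * ek (s k) t)) m).
  by apply: eq_fc => t; rewrite /trig mulr_sumr; apply: eq_bigr => k _; rewrite mulrCA.
rewrite fc_sum => [|k]; last exact: sqintZ.
by apply: eq_bigr => k _; rewrite fcZ// fc_mul_ek mulrC.
Qed.

Lemma msq_mul_le F G (B : R) : cmeas F -> (forall t, D t -> normc (F t) <= B) -> sqint G ->
  msq (fun t => F t * G t) <= B ^+ 2 * msq G.
Proof.
move=> mF hB hG; have [_ iFG] := sqint_boundedM mF hB hG; have [_ iG] := hG.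
rewrite /msq mulrCA ler_wpM2l ?invr_ge0 ?(ltW (two_pi_gt0 R))//.
rewrite /rint -RintegralZl//; apply: le_Rintegral => //; first exact: rintegrableZ.
move=> t Dt; rewrite normcM exprMn ler_wpM2r ?sqr_ge0//.
by rewrite lerXn2r ?nnegrE ?modc_ge0 ?hB// (le_trans _ (hB t Dt))// modc_ge0.
Qed.

(** The image of a finite sequence x consists of Fourier coefficients of F times a
    trigonometric sum of mean square sum |x_k|^2.  The frequencies s k = k give
    Toeplitz and s k = - k - 1 Hankel matrices. *)
Lemma symbol_opb F (s : nat -> int) (B : R) : injective s -> cmeas F ->
  (forall t, D t -> normc (F t) <= B) ->
  opb (B ^+ 2) (fun x (j : nat) => dot (fun k => fc F (j%:Z - s k)) x).
Proof.
move=> sI mF hB; have hF := sqint_bounded mF hB.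
apply: mop_opb => [|j|x J N]; first exact: sqr_ge0.
  exists (msq F); apply: (@bessel F (fun k => j%:Z - s k)) => // a b /addrI/oppr_inj; exact: sI.
rewrite -(msq_trig N x sI).
under eq_bigr do rewrite -fc_mul_trig//.
apply: le_trans (msq_mul_le mF hB (sqint_trig _ _ _)).
apply: (@bessel _ (fun j => j%:Z)) => [a b []//|].
by apply: (sqint_boundedM mF hB); exact: sqint_trig.
Qed.

Lemma symbol_row F (s : nat -> int) j : injective s -> sqint F ->
  l2 (fun k => fc F (j - s k)).
Proof.
move=> sI hF; exists (msq F).
by apply: (@bessel F (fun k => j - s k)) => // a b /addrI/oppr_inj; exact: sI.
Qed.

Lemma symbol_bop F (s : nat -> int) (B : R) : injective s -> cmeas F ->
  (forall t, D t -> normc (F t) <= B) ->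
  bop (fun x (j : nat) => dot (fun k => fc F (j%:Z - s k)) x).
Proof.
move=> sI mF hB; apply: (mop_bop _ (symbol_opb sI mF hB)) => j.
by apply: symbol_row => //; exact: sqint_bounded hB.
Qed.

End FourierCoefficients.

(** * Mean square limits of polynomials *)

Section HardyClass.
Variable R : realType.
Local Notation C := R[i].
Local Notation D := (`[0, 2 * pi]%classic : set R).
Variable e : int.
Hypothesis e0 : e != 0.
Implicit Types (F G : R -> C) (p : {poly C}).

Local Notation freq := (fun k : nat => e * k%:Z).

Lemma freq_inj : injective freq.
Proof. by move=> i j /(mulfI e0) []. Qed.

Lemma ekX k t : ek e t ^+ k = ek (e * k%:Z) t :> C.
Proof. by rewrite /ek expiX intrM -pmulrn mulrA [_%:~R * k%:R]mulrC. Qed.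

Lemma horner_trig p N t : (size p <= N)%N ->
  p.[ek e t] = trig freq N (fun k => p`_k) t.
Proof.
by move=> h; rewrite (horner_coef_wide _ h); apply: eq_bigr => k _; rewrite ekX.
Qed.

Lemma sqint_horner p : sqint (fun t => p.[ek e t]).
Proof. by under eq_fun do rewrite (horner_trig _ (leqnn _)); exact: sqint_trig. Qed.

Lemma fc_horner p k : fc (fun t => p.[ek e t]) (freq k) = p`_k.
Proof.
under eq_fun do rewrite (horner_trig _ (leq_maxl (size p) k.+1)).
rewrite fc_trig (bigD1 (Ordinal (leq_maxr (size p) k.+1)))//= eqxx mulr1.
rewrite big1 ?addr0// => i ik.
have /negPf -> : freq i != freq k by rewrite (inj_eq freq_inj).
by rewrite mulr0.
Qed.

Lemma horner_bounded p : exists2 B : R, 0 <= B &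
  forall z, normc z = 1 -> normc p.[z] <= B.
Proof.
exists (\sum_(i < size p) normc p`_i) => [|z z1]; first by rewrite sumr_ge0// => i _; exact: modc_ge0.
rewrite horner_coef; apply: le_trans (modc_sum _ _ _) _; apply: ler_sum => i _.
by rewrite normcM modcX z1 expr1n mulr1.
Qed.

(** Uniform limits on the circle of polynomials with constant coefficient 1: the
    boundary values of functions analytic in the open disc, continuous up to
    the circle, with value 1 at the centre. *)
Definition disc_class (P : C -> C) := forall d : R, 0 < d ->
  exists2 p : {poly C}, p`_0 = 1 & forall z, normc z = 1 -> normc (P z - p.[z]) <= d.

(** The mean square analogue of [disc_class], along z = e^(i t) for e = 1 and along
    z = e^(- i t) for e = - 1.  The normalization at the centre is what makes
    the triangular matrices unitriangular. *)
Definition hardy F := sqint F /\ forall d : R, 0 < d ->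
  exists2 p : {poly C}, p`_0 = 1 & rint (fun t => normc (F t - p.[ek e t]) ^+ 2) <= d.

Lemma disc_bounded P : disc_class P ->
  exists2 B : R, 0 <= B & forall z, normc z = 1 -> normc (P z) <= B.
Proof.
move=> /(_ 1 ltr01)[p _ hp]; have [B B0 hB] := horner_bounded p.
exists (1 + B) => [|z z1]; first by rewrite addr_ge0.
have -> : P z = (P z - p.[z]) + p.[z] by rewrite subrK.
by apply: le_trans (modcD _ _) _; rewrite lerD ?hp ?hB.
Qed.

Lemma disc1 : disc_class (fun=> 1).
Proof.
move=> d d0; exists 1 => [|z _]; first by rewrite coef1.
by rewrite hornerC subrr normc0 ltW.
Qed.

Lemma discM P Q : disc_class P -> disc_class Q -> disc_class (fun z => P z * Q z).
Proof.
move=> pP pQ; have [BP BP0 hBP] := disc_bounded pP => d d0.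
have [|q q0 hq] := pQ (d / 2 / (BP + 1)); first by rewrite !divr_gt0// ltr_wpDl.
have [Bq Bq0 hBq] := horner_bounded q.
have [|p p0 hp] := pP (d / 2 / (Bq + 1)); first by rewrite !divr_gt0// ltr_wpDl.
exists (p * q) => [|z z1]; first by rewrite coef0M p0 q0 mulr1.
have -> : P z * Q z - (p * q).[z] =
    P z * (Q z - q.[z]) + (P z - p.[z]) * q.[z] by rewrite hornerM; ring.
apply: le_trans (modcD _ _) _; rewrite !normcM [d]splitr; apply: lerD.
  apply: (@le_trans _ _ (BP * (d / 2 / (BP + 1)))).
    by apply: ler_pM; rewrite ?modc_ge0 ?hBP ?hq.
  by rewrite mulrA ler_pdivrMr ?ltr_wpDl// mulrC ler_wpM2l ?lerDl// ltW// divr_gt0.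
apply: (@le_trans _ _ (d / 2 / (Bq + 1) * Bq)).
  by apply: ler_pM; rewrite ?modc_ge0 ?hp ?hBq.
by rewrite mulrAC ler_pdivrMr ?ltr_wpDl// ler_wpM2l ?lerDl// ltW// divr_gt0.
Qed.

Lemma disc_prod (I : Type) (s : seq I) (P : I -> C -> C) :
  (forall i, disc_class (P i)) -> disc_class (fun z => \prod_(i <- s) P i z).
Proof.
move=> h; elim: s => [|i s IH].
  by under eq_fun do rewrite big_nil; exact: disc1.
by under eq_fun do rewrite big_cons; exact: discM.
Qed.

(** It suffices to approximate in mean square by functions of [disc_class], which
    in turn are uniformly close to polynomials. *)
Lemma hardy_lim F : sqint F ->
  (forall d : R, 0 < d -> exists P, [/\ disc_class P, cmeas (fun t => P (ek e t)) &
     rint (fun t => normc (F t - P (ek e t)) ^+ 2) <= d]) ->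
  hardy F.
Proof.
move=> hF h; split => // d d0.
have [|P [dP mP hP]] := h (d / 4); first by rewrite divr_gt0.
pose G t := P (ek e t); have [B _ hB] := disc_bounded dP.
pose z := Num.sqrt (d / (8 * pi)).
have z0 : 0 < z by rewrite sqrtr_gt0 divr_gt0// mulr_gt0// pi_gt0.
have [p p0 hp'] := dP z z0; exists p => //.
have hp t : normc (G t - p.[ek e t]) <= z by apply: hp'; exact: modc_ek.
have sG : sqint G by apply: (sqint_bounded mP (B := B)) => t _; apply: hB; exact: modc_ek.
have i1 : rintegrable (fun t => normc (F t - G t) ^+ 2).
  have := (sqintD hF (sqintZ (-1) sG)).2; by under eq_fun do rewrite mulN1r.
have i2 : rintegrable (fun t => normc (F t - p.[ek e t]) ^+ 2).
  have := (sqintD hF (sqintZ (-1) (sqint_horner p))).2; by under eq_fun do rewrite mulN1r.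
have i3 := rintegrableD (rintegrableZ 2 i1) (rintegrable_cst (2 * z ^+ 2)).
apply: (@le_trans _ _ (rint (fun t => 2 * normc (F t - G t) ^+ 2 + 2 * z ^+ 2))).
  apply: le_Rintegral => // t _.
  have -> : F t - p.[ek e t] = (F t - G t) + (G t - p.[ek e t]) by ring.
  have := @modcD_young _ 1 (F t - G t) (G t - p.[ek e t]) ltr01; rewrite invr1.
  have : normc (G t - p.[ek e t]) ^+ 2 <= z ^+ 2.
    by rewrite lerXn2r ?nnegrE ?modc_ge0// ltW.
  lra.
rewrite /rint RintegralD//; [|exact: rintegrableZ|exact: rintegrable_cst].
rewrite RintegralZl// -!/(rint _) rint_cst /z sqr_sqrtr; last by rewrite ltW// divr_gt0// mulr_gt0// pi_gt0.
have -> : 2 * (d / (8 * pi)) * (2 * pi) = d / 2 :> R.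
  by move: (@pi R) (pi_gt0 R) => c c0; field; rewrite gt_eqF.
move: hP; rewrite /rint; lra.
Qed.

Lemma disc_hardy P : disc_class P -> cmeas (fun t => P (ek e t)) ->
  hardy (fun t => P (ek e t)).
Proof.
move=> dP mP; have [B _ hB] := disc_bounded dP; apply: hardy_lim.
  by apply: (@sqint_bounded _ _ B) => // t _; apply: hB; exact: modc_ek.
move=> d d0; exists P; split => //; rewrite (@eq_rint _ _ (fun=> 0)) => [|t].
  by rewrite rint_cst mul0r ltW.
by rewrite subrr normc0 expr0n.
Qed.

Lemma sqintB F G : sqint F -> sqint G -> sqint (fun t => F t - G t).
Proof.
by move=> hF hG; under eq_fun do rewrite -mulN1r; apply: sqintD => //; exact: sqintZ.
Qed.

Lemma fcB F G k : sqint F -> sqint G -> fc (fun t => F t - G t) k = fc F k - fc G k.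
Proof.
move=> hF hG; under eq_fun do rewrite -mulN1r.
by rewrite fcD ?fcZ ?mulN1r//; exact: sqintZ.
Qed.

Lemma hardy_fc_approx F k : hardy F -> forall d : R, 0 < d ->
  exists2 p : {poly C}, p`_0 = 1 & normc (fc F k - fc (fun t => p.[ek e t]) k) ^+ 2 <= d.
Proof.
move=> [hF h] d /h[p p0 hp]; exists p => //.
have hp' := sqint_horner p.
rewrite -fcB//; apply: le_trans (fc_le _ (sqintB hF hp')) _.
exact: le_trans (msq_le_rint _) hp.
Qed.

(** Each polynomial has no coefficient at such a frequency, and Fourier
    coefficients are continuous in mean square. *)
Lemma hardy_fc_out F k : hardy F -> (forall l : nat, k != e * l%:Z) -> fc F k = 0.
Proof.
move=> hF hk; apply: modc_eq0; apply/eqP; rewrite -sqrf_eq0 eq_le sqr_ge0 andbT.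
apply/ler_addgt0Pr => d d0; rewrite add0r; have [p _] := hardy_fc_approx k hF d0.
have -> : (fun t => p.[ek e t]) = trig freq (size p) (fun k => p`_k).
  by apply/funext => t; exact: horner_trig.
rewrite fc_trig big1 ?subr0// => i _.
have /negPf -> : e * (i : nat)%:Z != k by rewrite eq_sym.
by rewrite mulr0.
Qed.

Lemma hardy_fc0 F : hardy F -> fc F 0 = 1.
Proof.
move=> hF; apply/eqP; rewrite -subr_eq0; apply/eqP/modc_eq0/eqP.
rewrite -sqrf_eq0 eq_le sqr_ge0 andbT.
apply/ler_addgt0Pr => d d0; rewrite add0r; have [p p0] := hardy_fc_approx 0 hF d0.
by have := fc_horner p 0; rewrite mulr0 => ->; rewrite p0.
Qed.

(** The convolution formula for a product of two square integrable functions.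
    For a polynomial F it is a finite identity; the error made by replacing F
    by a close polynomial is controlled in the sum by the Bessel inequality and in
    the integral by Cauchy-Schwarz. *)
Lemma hardy_mul F G (j : int) : hardy F -> sqint G ->
  ccvg (fun N => \sum_(l < N) fc F (e * (l : nat)%:Z) * fc G (j - e * (l : nat)%:Z))
       (fc (fun t => F t * G t) j).
Proof.
move=> [hF h] hG; apply/ccvgP => z z0.
set g := rint (fun t => normc (G t) ^+ 2).
have g0 : 0 <= g by apply: Rintegral_ge0 => t _; exact: sqr_ge0.
(* s makes s^-1 g small; then p is taken close enough to F for s f to be small *)
pose s : R := 4 * (g + 1) / z; have s0 : 0 < s.
  by rewrite /s divr_gt0// mulr_gt0// ltr_wpDl.
have [|p p0 hp] := h (z / (4 * s)); first by rewrite divr_gt0// mulr_gt0.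
have hp' := sqint_horner p; have hFp := sqintB hF hp'.
set H := fun t => F t - p.[ek e t] in hFp; set f := rint _ in hp.
have hle : s * f + s^-1 * g <= z / 2.
  have h1 : s * f <= z / 4.
    apply: (@le_trans _ _ (s * (z / (4 * s)))); first by rewrite ler_pM2l.
    by rewrite le_eqVlt; apply/orP; left; apply/eqP; field; rewrite gt_eqF.
  have h2 : s^-1 * g <= z / 4.
    have g1 : 0 < g + 1 by rewrite ltr_wpDl.
    have -> : s^-1 * g = z / 4 * (g / (g + 1)).
      by rewrite /s; field; rewrite !gt_eqF.
    by rewrite ler_piMr ?divr_ge0 ?(ltW z0)// ler_pdivrMr// mul1r lerDl.
  lra.
exists (size p) => N pN.
have fcp : \sum_(l < N) p`_l * fc G (j - e * (l : nat)%:Z) =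
    fc (fun t => p.[ek e t] * G t) j.
  under [RHS]eq_fc do rewrite mulrC (horner_trig _ pN).
  by rewrite fc_mul_trig//; apply: eq_bigr => l _; rewrite mulrC.
have e1 : \sum_(l < N) fc F (e * (l : nat)%:Z) * fc G (j - e * (l : nat)%:Z) =
    \sum_(l < N) fc H (e * (l : nat)%:Z) * fc G (j - e * (l : nat)%:Z) +
    fc (fun t => p.[ek e t] * G t) j.
  rewrite -fcp -big_split /=; apply: eq_bigr => l _.
  by rewrite /H fcB// fc_horner; ring.
pose Gj t := G t * ek (- j) t.
have hGj : sqint Gj.
  rewrite /Gj; under eq_fun do rewrite mulrC.
  by apply: (@sqint_boundedM _ _ _ 1) => [|t _|]; rewrite ?modc_ek//; exact: cmeas_ek.
have gE : rint (fun t => normc (Gj t) ^+ 2) = g.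
  by apply: eq_rint => t; rewrite normcM modc_ek mulr1.
have e2 : fc (fun t => F t * G t) j =
    ((2 * pi)^-1)%:C * cint (fun t => H t * Gj t) + fc (fun t => p.[ek e t] * G t) j.
  rewrite !fcE -mulrDr.
  rewrite (eq_cint (F := fun t => p.[ek e t] * G t * ek (- j) t)
    (G := fun t => p.[ek e t] * Gj t)) => [|t]; last exact: (esym (mulrA _ _ _)).
  rewrite -cintD; [|exact: (cintegrableM hFp hGj)|exact: (cintegrableM hp' hGj)].
  by congr (_ * _); apply: eq_cint => t; rewrite /Gj /H; ring.
rewrite e1 e2 opprD addrACA subrr addr0.
apply: le_trans (modcD _ _) _; rewrite modcN [z]splitr; apply: lerD.
  rewrite -(big_mkord xpredT (fun l => fc H (e * l%:Z) * fc G (j - e * l%:Z))).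
  have /(_ N) b1 := bessel freq_inj hFp; rewrite -(big_mkord xpredT (fun l => normc (fc H (e * l%:Z)) ^+ 2)) in b1.
  have jI : injective (fun l : nat => j - e * l%:Z) by move=> a b /addrI/oppr_inj/freq_inj.
  have /(_ N) b2 := bessel jI hG; rewrite -(big_mkord xpredT (fun l => normc (fc G (j - e * l%:Z)) ^+ 2)) in b2.
  apply: le_trans (dot_range s0 b1 b2) _.
  have := msq_le_rint H; have := msq_le_rint G; rewrite -/f -/g => u1 u2.
  have u3 : s * msq H <= s * f by rewrite ler_pM2l.
  have u4 : s^-1 * msq G <= s^-1 * g by rewrite ler_pM2l// invr_gt0.
  have u5 : 0 <= s * f + s^-1 * g.
    apply: le_trans (lerD u3 u4); apply: addr_ge0; apply: mulr_ge0; rewrite ?msq_ge0 ?invr_ge0//; exact: ltW.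
  lra.
have p2 := pi_ge2 R.
rewrite normcM modc_real ger0_norm; last by rewrite invr_ge0 ltW// two_pi_gt0.
apply: le_trans (ler_piMl (modc_ge0 _) _) _; first by rewrite invf_le1; lra.
by apply: le_trans (cintM_le s0 hFp hGj) _; rewrite gE.
Qed.

End HardyClass.

(** * The functions (1 - r w)^g for w on the circle *)

Section ComplexDerivative.
Variable R : realType.
Local Notation C := R[i].
Implicit Types (x : R).

Definition cder (F : R -> C) (F' : C) x :=
  is_derive x (1 : R) (fun s => complex.Re (F s)) (complex.Re F') /\
  is_derive x (1 : R) (fun s => complex.Im (F s)) (complex.Im F').

Lemma cder_eq F F' F'' x : cder F F' x -> F' = F'' -> cder F F'' x.
Proof. by move=> h <-. Qed.

Lemma cder_cst (c : C) x : cder (fun=> c) 0 x.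
Proof. by split; exact: is_derive_cst. Qed.

Lemma cder_id x : cder (fun s => s%:C) 1 x.
Proof. by split => /=; [exact: is_derive_id|exact: is_derive_cst]. Qed.

Lemma cderD F G F' G' x : cder F F' x -> cder G G' x ->
  cder (fun s => F s + G s) (F' + G') x.
Proof.
move=> [h1 h2] [h3 h4]; split.
  by under eq_fun do rewrite ReD; rewrite ReD; exact: is_deriveD.
by under eq_fun do rewrite ImD; rewrite ImD; exact: is_deriveD.
Qed.

Lemma cderM F G F' G' x : cder F F' x -> cder G G' x ->
  cder (fun s => F s * G s) (F' * G x + F x * G') x.
Proof.
move=> [h1 h2] [h3 h4]; split.
  under eq_fun do rewrite ReM.
  apply: (is_derive_eq (is_deriveB (is_deriveM h1 h3) (is_deriveM h2 h4))).
  by rewrite ReD !ReM /GRing.scale /=; ring.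
under eq_fun do rewrite ImM.
apply: (is_derive_eq (is_deriveD (is_deriveM h1 h4) (is_deriveM h2 h3))).
by rewrite ImD !ImM /GRing.scale /=; ring.
Qed.

Lemma cderX F F' x n : cder F F' x ->
  cder (fun s => F s ^+ n) (n%:R * F x ^+ n.-1 * F') x.
Proof.
move=> h; elim: n => [|n IH].
  by rewrite !mul0r; under eq_fun do rewrite expr0; exact: cder_cst.
under eq_fun do rewrite exprS; apply: cder_eq (cderM h IH) _.
case: n {IH} => [|n] /=; first by rewrite expr0; ring.
by rewrite -[n.+2%:R]natr1 exprS; ring.
Qed.

Lemma cder_sum (n : nat) (F : 'I_n -> R -> C) (F' : 'I_n -> C) x :
  (forall i, cder (F i) (F' i) x) ->
  cder (fun s => \sum_(i < n) F i s) (\sum_(i < n) F' i) x.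
Proof.
elim: n F F' => [|n IH] F F' h.
  by rewrite big_ord0; under eq_fun do rewrite big_ord0; exact: cder_cst.
rewrite big_ord_recr; under eq_fun do rewrite big_ord_recr.
by apply: cderD => //=; apply: IH => i; exact: h.
Qed.

Lemma cder_cexp F F' x : cder F F' x -> cder (fun s => cexp (F s)) (F' * cexp (F x)) x.
Proof.
move=> [h1 h2].
have dE : is_derive x (1 : R) (fun s => expR (complex.Re (F s))) (expR (complex.Re (F x)) * complex.Re F').
  exact: (@is_derive1_comp _ _ _ _ _ _ (is_derive_expR _) h1).
have dC : is_derive x (1 : R) (fun s => cos (complex.Im (F s))) (- sin (complex.Im (F x)) * complex.Im F').
  exact: (@is_derive1_comp _ _ _ _ _ _ (is_derive_cos _) h2).
have dS : is_derive x (1 : R) (fun s => sin (complex.Im (F s))) (cos (complex.Im (F x)) * complex.Im F').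
  exact: (@is_derive1_comp _ _ _ _ _ _ (is_derive_sin _) h2).
split.
  under eq_fun do rewrite Re_cexp; apply: (is_derive_eq (is_deriveM dE dC)).
  by rewrite (ReM F') Re_cexp Im_cexp /GRing.scale /=; ring.
under eq_fun do rewrite Im_cexp; apply: (is_derive_eq (is_deriveM dE dS)).
by rewrite (ImM F') Re_cexp Im_cexp /GRing.scale /=; ring.
Qed.

Lemma real_mean_value (f f' : R -> R) (r K : R) : 0 <= r ->
  (forall s, 0 <= s <= r -> is_derive s (1 : R) f (f' s)) ->
  (forall s, 0 <= s <= r -> `|f' s| <= K) -> `|f r - f 0| <= K * r.
Proof.
rewrite le_eqVlt => /predU1P[<- _ _|r0 hf hK]; first by rewrite subrr normr0 mulr0.
have hf' s : s \in `]0, r[ -> is_derive s (1 : R) f (f' s).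
  by rewrite in_itv /= => /andP[s0 sr]; apply: hf; rewrite !ltW.
have cf : {within `[0, r], continuous f}.
  apply: derivable_within_continuous => s; rewrite in_itv /= => hs.
  by have [] := hf s hs.
have [s] := MVT r0 hf' cf; rewrite in_itv /= => /andP[s0 sr] ->.
by rewrite subr0 normrM (gtr0_norm r0) ler_wpM2r ?(ltW r0)// hK// !ltW.
Qed.

(** The mean value theorem on real and imaginary parts costs the factor 2. *)
Lemma mean_value F (F' : R -> C) (r K : R) : 0 <= r ->
  (forall s, 0 <= s <= r -> cder F (F' s) s) ->
  (forall s, 0 <= s <= r -> normc (F' s) <= K) -> normc (F r - F 0) <= 2 * (K * r).
Proof.
move=> r0 hF hK; apply: le_trans (modc_le_ReIm _) _.
rewrite ReD ImD ReN ImN mulr_natl mulr2n; apply: lerD.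
  apply: (@real_mean_value (fun s => complex.Re (F s)) (fun s => complex.Re (F' s))) => // s hs.
    by have [] := hF s hs.
  exact: le_trans (Re_le_modc _) (hK s hs).
apply: (@real_mean_value (fun s => complex.Im (F s)) (fun s => complex.Im (F' s))) => // s hs.
  by have [] := hF s hs.
exact: le_trans (Im_le_modc _) (hK s hs).
Qed.

End ComplexDerivative.

Section PowerFunction.
Variable R : realType.
Local Notation C := R[i].
Implicit Types (w g : C) (r s : R).

(** On the unit circle, [dist2 r w] is |1 - r w|^2, - [ang r w] is the principal
    argument of 1 - r w, which has nonnegative real part, and [clog r w] its
    principal logarithm.  Working with these real formulas avoids choosing a
    branch of the logarithm, and at the singular point r = 1, w = 1 the
    values are harmless since ln 0 = 0 and 1 / 0 = 0. *)
Definition dist2 r w : R := 1 - 2 * r * complex.Re w + r ^+ 2.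
Definition ang r w : R := atan (r * complex.Im w / (1 - r * complex.Re w)).
Definition clog r w : C := (ln (dist2 r w) / 2) +i* (- ang r w).
Definition eta g r w : C := cexp (g * clog r w).

Lemma circle_ReIm w : normc w = 1 -> complex.Re w ^+ 2 + complex.Im w ^+ 2 = 1.
Proof. by move=> w1; rewrite -modcE w1 expr1n. Qed.

Lemma circle_Re w : normc w = 1 -> -1 <= complex.Re w <= 1.
Proof. by move=> w1; rewrite -ler_norml -w1 Re_le_modc. Qed.

Lemma dist2E r w : normc w = 1 ->
  dist2 r w = (1 - r * complex.Re w) ^+ 2 + (r * complex.Im w) ^+ 2.
Proof.
move=> /circle_ReIm h; rewrite /dist2.
transitivity (1 - 2 * r * complex.Re w + r ^+ 2 * (complex.Re w ^+ 2 + complex.Im w ^+ 2)).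
  by rewrite h mulr1.
by ring.
Qed.

Lemma dist2_modc r w : normc w = 1 -> dist2 r w = normc (1 - r%:C * w) ^+ 2.
Proof.
move=> w1; rewrite dist2E// modcE ReD ImD ReN ImN !(ReM r%:C) !(ImM r%:C) /=.
by ring.
Qed.

Lemma dist2_ge r w : normc w = 1 -> 0 <= r -> (1 - r) ^+ 2 <= dist2 r w.
Proof.
move=> /circle_Re/andP[h1 h2] r0; rewrite /dist2.
have : 0 <= r * (1 - complex.Re w) by rewrite mulr_ge0// subr_ge0.
lra.
Qed.

Lemma dist2_le4 r w : normc w = 1 -> 0 <= r <= 1 -> dist2 r w <= 4.
Proof.
move=> /circle_Re/andP[h1 h2] /andP[r0 r1]; rewrite /dist2.
have : 0 <= r * (1 + complex.Re w) by rewrite mulr_ge0//; lra.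
have : 0 <= (1 - r) * (1 + r) by rewrite mulr_ge0//; lra.
lra.
Qed.

Lemma dist2_gt0 r w : normc w = 1 -> 0 <= r < 1 -> 0 < dist2 r w.
Proof.
move=> w1 /andP[r0 r1]; apply: lt_le_trans (dist2_ge w1 r0).
by rewrite exprn_gt0// subr_gt0.
Qed.

(** The difference is a combination of (1 + Re w) (1 - r)^2 and
    (1 - Re w) (2 r + r^2) with positive coefficients.  The bound keeps the radial
    regularizations from being more singular than the boundary value. *)
Lemma dist2_quarter r w : normc w = 1 -> 0 <= r <= 1 -> dist2 1 w / 4 <= dist2 r w.
Proof.
move=> /circle_Re/andP[h1 h2] /andP[r0 r1]; rewrite /dist2.
have : 0 <= (1 + complex.Re w) * (1 - r) ^+ 2 by rewrite mulr_ge0 ?sqr_ge0//; lra.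
have : 0 <= (1 - complex.Re w) * (2 * r + r ^+ 2).
  by apply: mulr_ge0; [lra|apply: addr_ge0; [lra|exact: sqr_ge0]].
lra.
Qed.

Lemma one_sub_Re_gt0 r w : normc w = 1 -> 0 <= r < 1 -> 0 < 1 - r * complex.Re w.
Proof.
move=> /circle_Re/andP[h1 h2] /andP[r0 r1].
have : 0 <= r * (1 - complex.Re w) by rewrite mulr_ge0// subr_ge0.
lra.
Qed.

Lemma is_derive_ln_dist2 r w : normc w = 1 -> 0 <= r < 1 ->
  is_derive r (1 : R) (fun s => ln (dist2 s w) / 2) ((r - complex.Re w) / dist2 r w).
Proof.
move=> w1 r01; have q0 := dist2_gt0 w1 r01.
have dq : is_derive r (1 : R) (fun s => dist2 s w) (2 * (r - complex.Re w)).
  rewrite /dist2; apply: is_derive_eq.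
  by rewrite /GRing.scale /=; ring.
have dl := @is_derive1_comp _ (@ln R) (fun s => dist2 s w) r _ _ (is_derive1_ln q0) dq.
apply: (is_derive_eq (is_deriveM dl (is_derive_cst (2^-1 : R) r 1))).
by rewrite /cst /GRing.scale /=; field; rewrite gt_eqF.
Qed.

Lemma is_derive_ang r w : normc w = 1 -> 0 <= r < 1 ->
  is_derive r (1 : R) (fun s => ang s w) (complex.Im w / dist2 r w).
Proof.
move=> w1 r01; have q0 := dist2_gt0 w1 r01; have d0 := one_sub_Re_gt0 w1 r01.
have dd : is_derive r (1 : R) (fun s => 1 - s * complex.Re w) (- complex.Re w).
  by apply: is_derive_eq; rewrite /GRing.scale /=; ring.
have dn : is_derive r (1 : R) (fun s => s * complex.Im w) (complex.Im w).
  by apply: is_derive_eq; rewrite /GRing.scale /=; ring.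
have dv := @is_deriveV _ (fun s : R => 1 - s * complex.Re w) r _ 1 (lt0r_neq0 d0) dd.
have df := is_deriveM dn dv.
have da := @is_derive1_comp _ (@atan R)
  (fun s => s * complex.Im w / (1 - s * complex.Re w)) r _ _ (is_derive1_atan _) df.
apply: (is_derive_eq da).
move: q0; rewrite (dist2E r w1) /GRing.scale /= => q0.
by field; rewrite !gt_eqF// ?exprn_gt0// addrC.
Qed.

(** The derivative of log (1 - r w) in r, checked on the explicit real and
    imaginary parts. *)
Lemma cder_clog r w : normc w = 1 -> 0 <= r < 1 ->
  cder (fun s => clog s w) (- w / (1 - r%:C * w)) r.
Proof.
move=> w1 r01; have q0 := dist2_gt0 w1 r01.
have h1 := is_derive_ln_dist2 w1 r01; have h2 := is_derive_ang w1 r01.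
apply: (@cder_eq _ _ (((r - complex.Re w) / dist2 r w) +i* (- (complex.Im w / dist2 r w)))).
  by split => //=; exact: is_deriveN.
have z0 : 1 - r%:C * w != 0.
  apply/eqP => z; move: q0; rewrite dist2_modc// z normc0 expr0n /=.
  by rewrite ltxx.
apply: (mulIf z0); rewrite divfK//.
have h := circle_ReIm w1; have q1 := lt0r_neq0 q0; apply: complex_ext.
  rewrite (ReM (_ +i* _)) ReN ReD ReN ImD ImN (ReM r%:C) (ImM r%:C) /=.
  rewrite !(mul0r, subr0, addr0, add0r).
  set a := complex.Re w in h *; set b := complex.Im w in h *.
  have hb : b ^+ 2 = 1 - a ^+ 2 by lra.
  have e : (r - a) * (1 - r * a) - r * b ^+ 2 = - a * dist2 r w.
    by rewrite hb /dist2 -/a; ring.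
  transitivity (((r - a) * (1 - r * a) - r * b ^+ 2) / dist2 r w).
    by field.
  by rewrite e mulfK.
rewrite (ImM (_ +i* _)) ImN ReD ReN ImD ImN (ReM r%:C) (ImM r%:C) /=.
rewrite !(mul0r, subr0, addr0, add0r).
set a := complex.Re w in h *; set b := complex.Im w in h *.
transitivity ((- b * dist2 r w) / dist2 r w); last by rewrite mulfK.
by rewrite {3}/dist2 -/a; field.
Qed.

End PowerFunction.

(** * The binomial series *)

Section Binomial.
Variable R : realType.
Local Notation C := R[i].
Implicit Types (w g z : C) (r s : R).

(** The coefficients of (1 - z)^g. *)
Fixpoint bincoef g (k : nat) : C :=
  if k is k'.+1 then bincoef g k' * (k'%:R - g) / k'.+1%:R else 1.

Definition binpoly g N z : C := \sum_(k < N.+1) bincoef g k * z ^+ k.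
Definition binpoly' g N z : C := \sum_(k < N.+1) bincoef g k * (k%:R * z ^+ k.-1).

Lemma bincoefS g k : bincoef g k.+1 * k.+1%:R = bincoef g k * (k%:R - g).
Proof. by rewrite /= divfK// pnatr_eq0. Qed.

(** The function (1 - z)^g solves (1 - z) y' + g y = 0; its Taylor polynomial
    solves this equation up to the last term. *)
Lemma binpoly_ode g N z :
  (1 - z) * binpoly' g N z + g * binpoly g N z = (g - N%:R) * bincoef g N * z ^+ N.
Proof.
elim: N => [|N IH].
  by rewrite /binpoly /binpoly' !big_ord1 /= !expr0; ring.
have -> : binpoly' g N.+1 z = binpoly' g N z + bincoef g N.+1 * N.+1%:R * z ^+ N.
  by rewrite /binpoly' big_ord_recr /= mulrA.
have -> : binpoly g N.+1 z = binpoly g N z + bincoef g N.+1 * z ^+ N.+1.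
  by rewrite /binpoly big_ord_recr.
transitivity (((g - N%:R) * bincoef g N + bincoef g N.+1 * N.+1%:R) * z ^+ N +
   (g - N.+1%:R) * bincoef g N.+1 * z ^+ N.+1).
  by rewrite [X in _ = X + _]mulrDl -IH exprS; ring.
by rewrite bincoefS; ring.
Qed.

Lemma cder_binpoly g N w r :
  cder (fun s => binpoly g N (s%:C * w)) (w * binpoly' g N (r%:C * w)) r.
Proof.
rewrite /binpoly /binpoly' mulr_sumr.
apply: (@cder_sum _ _ (fun (k : 'I_N.+1) s => bincoef g k * (s%:C * w) ^+ k)) => k.
have h1 := cderM (cder_id r) (cder_cst w r).
apply: cder_eq (cderM (cder_cst (bincoef g k) r) (cderX k h1)) _.
ring.
Qed.

Lemma modc_clog s r w : normc w = 1 -> 0 <= s <= r -> r < 1 ->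
  normc (clog s w) <= (ln 4 - ln ((1 - r) ^+ 2)) / 2 + pi / 2.
Proof.
move=> w1 /andP[s0 sr] r1; have s1 := le_lt_trans sr r1.
have s01 : 0 <= s < 1 by rewrite s0.
have q0 := dist2_gt0 w1 s01.
have q1 : (1 - r) ^+ 2 <= dist2 s w.
  apply: le_trans (dist2_ge w1 s0); rewrite lerXn2r ?nnegrE; lra.
have q4 : dist2 s w <= 4 by apply: dist2_le4; rewrite ?s0 ?ltW.
have r20 : 0 < (1 - r) ^+ 2 by rewrite exprn_gt0// subr_gt0.
have l1 : ln ((1 - r) ^+ 2) <= ln (dist2 s w) by rewrite ler_ln ?posrE.
have l2 : ln (dist2 s w) <= ln 4 by rewrite ler_ln ?posrE.
have l3 : ln ((1 - r) ^+ 2) <= 0.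
  by rewrite ln_le0// expr_le1 ?subr_ge0 ?(ltW r1)// lerBlDr lerDl (le_trans s0).
have l4 : 0 <= ln (4 : R) by rewrite ln_ge0// ler1n.
apply: le_trans (modc_le_ReIm _) _ => /=; apply: lerD.
  by rewrite ler_norml; lra.
have := atan_gtNpi2 (s * complex.Im w / (1 - s * complex.Re w)).
have := atan_ltpi2 (s * complex.Im w / (1 - s * complex.Re w)).
rewrite -/(ang s w) normrN ler_norml => h1 h2; lra.
Qed.

Definition eta_bound g r : R := expR (normc g * ((ln 4 - ln ((1 - r) ^+ 2)) / 2 + pi / 2)).

Lemma modc_eta_le g s r w : normc w = 1 -> 0 <= s <= r -> r < 1 ->
  normc (eta g s w) <= eta_bound g r.
Proof.
move=> w1 sr r1; rewrite /eta modc_cexp ler_expR.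
apply: le_trans (ler_norm _) _; apply: le_trans (Re_le_modc _) _.
by rewrite normcM ler_wpM2l ?modc_ge0//; exact: modc_clog.
Qed.

(** The quotient of consecutive terms tends to r < 1, so from some index on they
    decay at least like powers of (1 + r) / 2. *)
Lemma bincoef_decay g r : 0 <= r < 1 -> forall d : R, 0 < d ->
  exists N : nat, (normc g + N%:R) * normc (bincoef g N) * r ^+ N <= d.
Proof.
move=> /andP[r0 r1] d d0; set G := normc g; have G0 : 0 <= G := modc_ge0 g.
pose c (N : nat) : R := (G + N%:R) * normc (bincoef g N) * r ^+ N.
have c0 N : 0 <= c N by rewrite /c !mulr_ge0 ?exprn_ge0 ?addr_ge0 ?modc_ge0.
have mN (N : nat) : normc (N%:R : C) = N%:R.
  by rewrite -[N%:R in LHS](rmorph_nat (real_complex R)) modc_real ger0_norm.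
have cS N : c N.+1 <= r * (1 + G / N.+1%:R) * c N.
  rewrite /c /= normcM normcM normcV mN exprS.
  have h : normc (N%:R - g) <= G + N%:R by apply: le_trans (modcD _ _) _; rewrite modcN mN addrC.
  have n0 : 0 < N.+1%:R :> R by rewrite ltr0n.
  apply: (@le_trans _ _ ((G + N.+1%:R) * (normc (bincoef g N) * (G + N%:R) / N.+1%:R) * (r * r ^+ N))).
    rewrite ler_wpM2r ?mulr_ge0 ?exprn_ge0// ler_wpM2l ?addr_ge0//.
    by rewrite ler_wpM2r ?invr_ge0// ler_wpM2l ?modc_ge0.
  rewrite le_eqVlt; apply/orP; left; apply/eqP; field.
  by rewrite gt_eqF.
pose q := (1 + r) / 2.
have q0 : 0 <= q by rewrite /q; lra.
have q1 : q < 1 by rewrite /q; lra.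
have r1' : 0 < 1 - r by lra.
have [K hK] : exists K : nat, 2 * G / (1 - r) <= K%:R.
  exists (Num.truncn (2 * G / (1 - r))).+1; apply: ltW; exact: truncnS_gt.
have cK i : c (K + i)%N <= q ^+ i * c K.
  elim: i => [|i IH]; first by rewrite addn0 mul1r.
  rewrite addnS exprS -mulrA; apply: le_trans (cS _) _.
  apply: (@le_trans _ _ (q * c (K + i)%N)); last by rewrite ler_wpM2l.
  rewrite ler_wpM2r//.
  have n0 : 0 < (K + i).+1%:R :> R by rewrite ltr0n.
  have hn : K%:R <= (K + i).+1%:R :> R by rewrite ler_nat leqW// leq_addr.
  have hG : G / (K + i).+1%:R <= (1 - r) / 2.
    rewrite ler_pdivrMr//; move: hK; rewrite ler_pdivrMr// => hK.
    have := ler_wpM2r (ltW r1') hn; lra.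
  move: hG; set x := G / _ => hG; have := ler_wpM2l r0 hG; rewrite /q.
  have : 0 <= (1 - r) * (1 - r) by rewrite mulr_ge0// ltW.
  lra.
have h0 : (fun i => q ^+ i * c K) @ \oo --> (0 : R).
  by rewrite -[X in _ --> X](mul0r (c K)); apply: cvgMl; apply: cvg_expr; rewrite ger0_norm.
move/cvgrPdist_le: h0 => /(_ _ d0)[i _ /(_ i (leqnn i))] /=.
rewrite sub0r normrN ger0_norm; last by apply: mulr_ge0 => //; exact: exprn_ge0.
move=> hi.
by exists (K + i)%N; apply: le_trans (cK i) hi.
Qed.

(** Convergence of the binomial series, uniformly on the circle of radius r.  The
    quotient of the Taylor polynomial by (1 - s w)^g equals 1 at s = 0, and
    [binpoly_ode] bounds its derivative in s by the last term of the polynomial, so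
    the mean value inequality keeps it close to 1. *)
Lemma eta_binpoly g r : 0 <= r < 1 -> forall d : R, 0 < d ->
  exists N, forall w, normc w = 1 -> normc (eta g r w - binpoly g N (r%:C * w)) <= d.
Proof.
move=> r01 d d0; have /andP[r0 r1] := r01.
pose E := eta_bound (- g) r; have E0 : 0 < E by exact: expR_gt0.
pose E' := eta_bound g r; have E'0 : 0 < E' by exact: expR_gt0.
have r1' : 0 < 1 - r by lra.
pose d' := d * (1 - r) / (2 * E * E').
have d'0 : 0 < d' by rewrite /d' divr_gt0 ?mulr_gt0.
have [N hN] := bincoef_decay g r01 d'0; exists N => w w1.
pose f s := eta (- g) s w * binpoly g N (s%:C * w).
pose f' s := eta (- g) s w * (w / (1 - s%:C * w)) * ((g - N%:R) * bincoef g N * (s%:C * w) ^+ N).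
have z0 s : 0 <= s <= r -> 1 - r <= normc (1 - s%:C * w).
  move=> /andP[s0 sr]; have : 1 <= normc (1 - s%:C * w) + normc (s%:C * w).
    by rewrite -[X in X <= _](@normc1 R); apply: le_trans (modcD _ _); rewrite subrK.
  by rewrite (normcM s%:C) w1 mulr1 modc_real ger0_norm//; lra.
have df s : 0 <= s <= r -> cder f (f' s) s.
  move=> hs; have /andP[s0 sr] := hs; have s01 : 0 <= s < 1 by rewrite s0 (le_lt_trans sr).
  have h1 := cder_cexp (cderM (cder_cst (- g) s) (cder_clog w1 s01)).
  have z1 : 1 - s%:C * w != 0.
    by apply/eqP => z; have := z0 s hs; rewrite z normc0; lra.
  apply: cder_eq (cderM h1 (cder_binpoly g N w s)) _.
  rewrite /f' -binpoly_ode /eta.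
  move: (binpoly _ _ _) (binpoly' _ _ _) (cexp _) => B B' X.
  field.
  exact: z1.
have mN : normc (N%:R : C) = N%:R.
  by rewrite -[N%:R in LHS](rmorph_nat (real_complex R)) modc_real ger0_norm.
have hf s : 0 <= s <= r -> normc (f' s) <= E / (1 - r) * d'.
  move=> hs; have /andP[s0 sr] := hs.
  rewrite /f'; have := modc_eta_le (- g) w1 hs r1; rewrite -/E.
  move: (eta (- g) s w) => X hX.
  rewrite !normcM modcX !normcM normcV w1 mul1r mulr1 modc_real (ger0_norm s0).
  apply: ler_pM; rewrite ?mulr_ge0 ?invr_ge0 ?exprn_ge0 ?modc_ge0//.
    apply: ler_pM; rewrite ?invr_ge0 ?modc_ge0//.
    by rewrite lef_pV2 ?posrE// ?z0// (lt_le_trans r1')// z0.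
  apply: le_trans hN; apply: ler_pM; rewrite ?mulr_ge0 ?exprn_ge0 ?modc_ge0//.
    rewrite ler_wpM2r ?modc_ge0//; apply: le_trans (modcD _ _) _; by rewrite modcN mN.
  by rewrite lerXn2r ?nnegrE.
have f0 : f 0 = 1.
  rewrite /f /eta /clog /dist2 /ang !(mul0r, mulr0) expr0n /= subr0 addr0 ln1 atan0 mul0r oppr0.
  have -> : - g * (0 +i* 0) = 0 by rewrite mulr0.
  rewrite cexp0 mul1r /binpoly big_ord_recl expr0 mulr1 big1 ?addr0// => i _.
  by rewrite ?mul0r expr0n mulr0.
have := mean_value r0 df hf; rewrite f0 => hm.
have e1 : eta g r w * f r = binpoly g N (r%:C * w).
  by rewrite /f mulrA /eta -cexpD -mulrDl subrr mul0r cexp0 mul1r.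
rewrite -e1 -{1}[eta g r w]mulr1 -mulrBr normcM modcBC.
apply: (@le_trans _ _ (E' * (2 * (E / (1 - r) * d' * r)))).
  by apply: ler_pM; rewrite ?modc_ge0//; apply: modc_eta_le => //; rewrite r0 lexx.
have -> : E' * (2 * (E / (1 - r) * d' * r)) = d * r.
  by rewrite /d'; field; rewrite !gt_eqF.
by rewrite ler_piMr ?ltW.
Qed.

(** The quantities (i + 1) b_i, with b_i the squared coefficients, decrease from one
    index to the next by at least (1 - 2 k) b_i, so the sum telescopes. *)
Lemma bincoef_sum (k : R) (N : nat) : 0 <= k < 1 / 2 ->
  \sum_(i < N) normc (bincoef (- k)%:C i) ^+ 2 <= (1 - 2 * k)^-1.
Proof.
move=> /andP[k0 k1]; pose b (i : nat) := normc (bincoef (- k)%:C i) ^+ 2.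
have b0 i : 0 <= b i by exact: sqr_ge0.
have mN (n : nat) : normc (n%:R : C) = n%:R.
  by rewrite -[n%:R in LHS](rmorph_nat (real_complex R)) modc_real ger0_norm.
have bS i : b i.+1 * i.+1%:R ^+ 2 = b i * (i%:R + k) ^+ 2.
  rewrite /b -exprMn -(mN i.+1) -normcM bincoefS normcM exprMn; congr (_ * _ ^+ 2).
  rewrite -(rmorph_nat (real_complex R)) -rmorphB modc_real opprK ger0_norm ?addr_ge0//.
have h i : b i * (1 - 2 * k) <= i.+1%:R * b i - i.+2%:R * b i.+1.
  have n0 : 0 < i.+1%:R ^+ 2 :> R by rewrite exprn_gt0// ltr0n.
  rewrite -(ler_pM2r n0).
  have -> : (i.+1%:R * b i - i.+2%:R * b i.+1) * i.+1%:R ^+ 2 =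
      i.+1%:R ^+ 3 * b i - i.+2%:R * (b i.+1 * i.+1%:R ^+ 2) by ring.
  rewrite bS -subr_ge0 -![in i.+2%:R](natr1) -![in i.+1%:R](natr1).
  set m : R := i%:R; have m0 : 0 <= m by exact: ler0n.
  have -> : (m + 1) ^+ 3 * b i - (m + 1 + 1) * (b i * (m + k) ^+ 2) -
     b i * (1 - 2 * k) * (m + 1) ^+ 2 =
     b i * ((1 - k) * (m * (1 + k) + 2 * k)) by ring.
  have k1' : 0 <= 1 - k by lra.
  have k1'' : 0 <= 1 + k by lra.
  apply: mulr_ge0 => //; apply: mulr_ge0 => //; nra.
have tel : (\sum_(i < N) b i) * (1 - 2 * k) <= 1 - N.+1%:R * b N.
  elim: N => [|N IH].
    by rewrite big_ord0 mul0r /b /= normc1 expr1n mulr1 subrr.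
  by rewrite big_ord_recr mulrDl /=; have := h N; lra.
have k2 : 0 < 1 - 2 * k by lra.
rewrite -[leRHS]mul1r ler_pdivlMr//; apply: le_trans tel _.
by rewrite gerBl mulr_ge0.
Qed.

End Binomial.

(** * Passing to the limit under the integral *)

Section ConvergenceTheorems.
Variable R : realType.
Local Notation C := R[i].
Local Notation mu := (@lebesgue_measure R).
Local Notation D := (`[0, 2 * pi]%classic : set R).

(** Inversion is discontinuous at 0, but with the convention 1 / 0 = 0 it is the
    pointwise limit of the continuous functions x / (x^2 + 1 / n). *)
Lemma measurable_inv : measurable_fun setT (fun x : R => x^-1).
Proof.
apply: (@measurable_fun_cvg _ _ _ _ (fun (n : nat) (x : R) => x / (x ^+ 2 + n.+1%:R^-1))).
  move=> n; apply: continuous_measurable_fun => x.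
  have p0 : 0 < x ^+ 2 + n.+1%:R^-1 :> R by rewrite ltr_wpDl ?sqr_ge0// invr_gt0 ltr0n.
  apply: cvgM; first exact: cvg_id.
  apply: cvgV; first exact: lt0r_neq0.
  by apply: cvgD; [exact: exprn_continuous|exact: cvg_cst].
move=> x _; have [->|x0] := eqVneq x 0.
  by rewrite invr0; under eq_fun do rewrite mul0r; exact: cvg_cst.
have x20 : x ^+ 2 + 0 != 0 by rewrite addr0 sqrf_eq0.
have -> : x^-1 = x / (x ^+ 2 + 0) by rewrite addr0; field.
apply: cvgM; first exact: cvg_cst.
apply: cvgV => //; apply: cvgD; first exact: cvg_cst.
exact: cvg_harmonic.
Qed.

Lemma countable_null (N : set R) : countable N ->
  measurable (N : set (measurableTypeR R)) /\ mu N = 0%E.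
Proof.
move=> cN; split; last exact: countable_lebesgue_measure0.
by apply: countable_measurable => // t; exact: measurable_set1.
Qed.

Lemma rint_EFin (f : R -> R) : rintegrable f ->
  (\int[mu]_(x in D) (f x)%:E = (rint f)%:E)%E.
Proof.
by move=> fi; rewrite /rint /Rintegral fineK//; apply: (integrable_fin_num _ fi).
Qed.

(** Fatou's lemma; the exceptional set is countable because it will consist of the
    angles of finitely many points. *)
Lemma sqint_fatou (N : set R) (f_ : nat -> R -> C) (f : R -> C) (B : R) :
  countable N -> cmeas f -> (forall n, sqint (f_ n)) ->
  (forall n, rint (fun t => normc (f_ n t) ^+ 2) <= B) ->
  (forall t, D t -> ~ N t -> ccvg (fun n => f_ n t) (f t)) -> sqint f.
Proof.
move=> cN mf hf hB hc; split => //; have [mN N0] := countable_null cN.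
have mf2 := rintegrable_measurable (measurable_modc2 mf).
have mfn n := rintegrable_measurable (measurable_modc2 (hf n).1).
have mD : measurable (D : set (measurableTypeR R)) by exact: measurable_itv.
have mDN : measurable (D `\` N : set (measurableTypeR R)) by exact: measurableD.
apply/(negligible_integrable mN mD mf2 N0); apply/integrableP; split.
  by apply: measurable_funS mf2 => //; exact: subDsetl.
pose g n := EFin \o (fun t : measurableTypeR R => normc (f_ n t) ^+ 2).
have fatou_g := @fatou _ _ _ mu (D `\` N) mDN g
  (fun n => measurable_funS mD (@subDsetl _ _ _) (mfn n))
  (fun n x _ => _).
have gle n : (\int[mu]_(x in D `\` N) g n x <= B%:E)%E.
  apply: (@le_trans _ _ (\int[mu]_(x in D) g n x)%E).
    apply: ge0_subset_integral => //; first exact: mfn.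
      by move=> x _; rewrite lee_fin sqr_ge0.
  by rewrite (rint_EFin (hf n).2) lee_fin.
apply: (@le_lt_trans _ _ B%:E); last exact: ltry.
apply: le_trans (le_trans (fatou_g _) _).
- rewrite le_eqVlt; apply/orP; left; apply/eqP; apply: eq_integral => x.
  rewrite inE => -[Dx Nx] /=; rewrite is_cvg_limn_einfE.
    apply/esym/cvg_lim => //; rewrite ger0_norm ?sqr_ge0//.
    by apply: cvg_EFin; [exact: nearW|exact: ccvg_mod2 (hc x Dx Nx)].
  apply/cvg_ex; exists (normc (f x) ^+ 2)%:E.
  by apply: cvg_EFin; [exact: nearW|exact: ccvg_mod2 (hc x Dx Nx)].
- by move=> n x; rewrite lee_fin sqr_ge0.
- rewrite limn_einf_lim; apply: lime_le; first exact: is_cvg_einfs.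
  apply: nearW => n; apply: le_trans (gle n); apply: ereal_inf_lbound.
  by exists n => //=.
Qed.

Lemma rint_dominated (N : set R) (f_ : nat -> R -> C) (f : R -> C) (g : R -> R) :
  countable N -> cmeas f -> (forall n, cmeas (f_ n)) -> rintegrable g ->
  (forall n t, D t -> ~ N t -> normc (f_ n t - f t) ^+ 2 <= g t) ->
  (forall t, D t -> ~ N t -> ccvg (fun n => f_ n t) (f t)) ->
  (fun n => rint (fun t => normc (f_ n t - f t) ^+ 2)) @ \oo --> (0 : R).
Proof.
move=> cN mf mfn ig hg hc; have [mN N0] := countable_null cN.
have mD : measurable (D : set (measurableTypeR R)) by exact: measurable_itv.
have md n : cmeas (fun t => f_ n t - f t).
  apply: cmeasD => //; under eq_fun do rewrite -mulN1r.
  by apply: cmeasM => //; exact: cmeas_cst.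
pose h n := EFin \o (fun t : measurableTypeR R => normc (f_ n t - f t) ^+ 2).
have mh n : measurable_fun D (h n) := rintegrable_measurable (measurable_modc2 (md n)).
have m0 : measurable_fun D (cst 0%E : measurableTypeR R -> \bar R) by exact: measurable_cst.
have c1 : {ae mu, forall x, D x -> h n x @[n --> \oo] --> (cst 0%E : _ -> \bar R) x}.
  exists N; split => // x /= /not_implyP[Dx nx]; apply: contrapT => Nx; apply: nx.
  have hh := ccvg_mod2 (ccvgD (hc x Dx Nx) (ccvg_cst (- f x))).
  rewrite subrr normc0 expr0n /= in hh.
  by apply: cvg_EFin; [exact: nearW|exact: hh].
have c2 : {ae mu, forall x n, D x -> (`|h n x| <= (EFin \o g) x)%E}.
  exists N; split => // x /= nx; apply: contrapT => Nx; apply: nx => n Dx.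
  by rewrite /h /= lee_fin ger0_norm ?sqr_ge0//; exact: hg.
have [_ _] := dominated_convergence mD mh m0 c1 ig c2.
by rewrite integral0 => /fine_cvg.
Qed.

Lemma expi_inj (t t0 : R) : 0 <= t <= 2 * pi -> 0 <= t0 <= 2 * pi ->
  expi t = expi t0 -> [\/ t = t0, t = t0 - 2 * pi | t = t0 + 2 * pi].
Proof.
move=> /andP[t1 t2] /andP[t3 t4] et; have pp := pi_gt0 R.
have cd : cos (t - t0) = 1.
  have : expi (t - t0) = 1 by rewrite expiD expiN et expi_conjM.
  by rewrite expiE => /eqP; rewrite eq_complex /= => /andP[/eqP].
have cd' : cos `|t - t0| = 1 by rewrite cos_norm.
have inj (x : R) : 0 <= x <= pi -> cos x = 1 -> x = 0.
  move=> hx hc; apply: cos_inj; rewrite ?in_itv //= ?cos0//.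
  by rewrite lexx pi_ge0.
have [d1|d1] := lerP `|t - t0| pi.
  have : `|t - t0| = 0 by apply: inj => //; rewrite normr_ge0.
  by move=> /normr0_eq0/eqP; rewrite subr_eq0 => /eqP ->; apply: Or31.
have d2 : 2 * pi - `|t - t0| = 0.
  apply: inj.
    have : `|t - t0| <= 2 * pi by rewrite ler_norml; lra.
    by move=> h; apply/andP; split; lra.
  have -> : 2 * pi - `|t - t0| = - `|t - t0| + pi *+ 2 by rewrite mulr_natl addrC.
  by rewrite cosD2pi cosN.
have [h|h] := lerP 0 (t - t0).
  by move: d2; rewrite ger0_norm// => d2; apply: Or33; lra.
by move: d2; rewrite ltr0_norm// => d2; apply: Or32; lra.
Qed.

(** Singular points of the symbols on the circle correspond to a null set of
    angles. *)
Lemma expi_fiber_countable (z : C) : countable (D `&` [set t | expi t = z]).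
Proof.
have [->|/set0P[t0 [Dt0 et0]]] := eqVneq (D `&` [set t | expi t = z]) set0.
  exact: countable0.
apply: (@sub_countable _ _ _ [set t0; t0 - 2 * pi; t0 + 2 * pi]); last first.
  by apply: finite_set_countable; rewrite !finite_setU.
apply: subset_card_le => t [Dt et] /=.
move: Dt Dt0; rewrite /= !in_itv /= => ht ht0.
by case: (expi_inj ht ht0 (etrans et (esym et0))) => ->; [left; left|left; right|right].
Qed.

Lemma ccvgM (s s' : nat -> C) l l' : ccvg s l -> ccvg s' l' ->
  ccvg (fun n => s n * s' n) (l * l').
Proof.
move=> [h1 h2] [h3 h4]; split.
  by under eq_fun do rewrite ReM; rewrite ReM; apply: cvgB; exact: cvgM.
by under eq_fun do rewrite ImM; rewrite ImM; apply: cvgD; exact: cvgM.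
Qed.

Lemma ccvg_prod (I : Type) (r : seq I) (F : I -> nat -> C) (l : I -> C) :
  (forall i, ccvg (F i) (l i)) ->
  ccvg (fun n => \prod_(i <- r) F i n) (\prod_(i <- r) l i).
Proof.
move=> h; elim: r => [|i r IH].
  by rewrite big_nil; under eq_fun do rewrite big_nil; exact: ccvg_cst.
by rewrite big_cons; under eq_fun do rewrite big_cons; exact: ccvgM.
Qed.

Lemma ccvg_cexp (s : nat -> C) l : ccvg s l -> ccvg (fun n => cexp (s n)) (cexp l).
Proof.
move=> [h1 h2].
have hE : (fun n => expR (complex.Re (s n))) @ \oo --> expR (complex.Re l).
  by apply: (@continuous_cvg _ _ _ _ _ (fun n => complex.Re (s n)) expR) => //; exact: continuous_expR.
have hC : (fun n => cos (complex.Im (s n))) @ \oo --> cos (complex.Im l).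
  by apply: (@continuous_cvg _ _ _ _ _ (fun n => complex.Im (s n)) cos) => //; exact: continuous_cos.
have hS : (fun n => sin (complex.Im (s n))) @ \oo --> sin (complex.Im l).
  by apply: (@continuous_cvg _ _ _ _ _ (fun n => complex.Im (s n)) sin) => //; exact: continuous_sin.
split.
  by under eq_fun do rewrite Re_cexp; rewrite Re_cexp; exact: cvgM.
by under eq_fun do rewrite Im_cexp; rewrite Im_cexp; exact: cvgM.
Qed.

End ConvergenceTheorems.

(** * One factor (1 - w)^g on the boundary *)

Section EtaProducts.
Variable R : realType.
Local Notation C := R[i].
Local Notation D := (`[0, 2 * pi]%classic : set R).
Implicit Types (g : C) (r : R).

Lemma cmeas_eta g r (W : R -> C) : cmeas W -> cmeas (fun t => eta g r (W t)).
Proof.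
move=> [mRe mIm]; apply: cmeas_cexp; apply: cmeasM; first exact: cmeas_cst.
have mc (a : R) : measurable_fun setT (fun=> a : R) by exact: measurable_cst.
split => /=.
  apply: measurable_funM => //; apply: measurableT_comp; first exact: measurable_ln.
  rewrite /dist2; apply: measurable_funD => //; apply: measurable_funB => //.
  exact: measurable_funM.
apply: measurableT_comp; first exact: oppr_measurable.
rewrite /ang; apply: measurableT_comp.
  by apply: continuous_measurable_fun => x; exact: continuous_atan.
apply: measurable_funM; first exact: measurable_funM.
apply: measurableT_comp; first exact: measurable_inv.
by apply: measurable_funB => //; exact: measurable_funM.
Qed.

Lemma modc2_eta g r w : normc (eta g r w) ^+ 2 =
  expR (complex.Re g * ln (dist2 r w) + 2 * complex.Im g * ang r w).
Proof.
rewrite /eta modc_cexp expr2 -expRD ReM /=; congr expR; by field.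
Qed.

(** Off the singular point the boundary value is the radial limit. *)
Lemma ccvg_eta g w (r_ : nat -> R) : normc w = 1 -> w != 1 -> r_ @ \oo --> (1 : R) ->
  ccvg (fun n => eta g (r_ n) w) (eta g 1 w).
Proof.
move=> w1 wn1 cr.
have /andP[_ hRe] := circle_Re w1.
have Re1 : complex.Re w < 1.
  rewrite lt_neqAle hRe andbT; apply/eqP => e; case/eqP: wn1.
  have e' : complex.Im w ^+ 2 = 0 by have := circle_ReIm w1; rewrite e expr1n; lra.
  by move/eqP: e'; rewrite sqrf_eq0 => /eqP e'; exact: complex_ext.
have q0 : 0 < dist2 1 w by rewrite /dist2; lra.
have cq : (fun n => dist2 (r_ n) w) @ \oo --> dist2 1 w.
  rewrite /dist2; apply: cvgD.
    apply: cvgB; first exact: cvg_cst.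
    by apply: cvgM; [apply: cvgM => //; exact: cvg_cst|exact: cvg_cst].
  by rewrite expr2; under eq_fun do rewrite expr2; exact: cvgM.
apply: ccvg_cexp; apply: ccvgZ; split => /=.
  apply: cvgM; last exact: cvg_cst.
  apply: (@continuous_cvg _ _ _ _ _ (fun n => dist2 (r_ n) w) (@ln R)) => //.
  exact: continuous_ln.
apply: cvgN; apply: (@continuous_cvg _ _ _ _ _
  (fun n => r_ n * complex.Im w / (1 - r_ n * complex.Re w)) (@atan R)).
  exact: continuous_atan.
have c0 (a : R) : (fun=> a : R) @ \oo --> a by exact: cvg_cst.
apply: cvgM; first exact: cvgM.
apply: cvgV; first by rewrite mul1r subr_eq0 gt_eqF.
by apply: cvgB => //; exact: cvgM.
Qed.

Definition rad (n : nat) : R := 1 - n.+1%:R^-1 / 2.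

Lemma rad01 n : 0 <= rad n < 1.
Proof.
have : 0 < n.+1%:R^-1 :> R by rewrite invr_gt0 ltr0n.
have : n.+1%:R^-1 <= 1 :> R by rewrite invf_le1 ?ltr0n// ler1n.
by rewrite /rad; move: (n.+1%:R^-1) => x h1 h2; apply/andP; split; lra.
Qed.

Lemma cvg_rad : rad @ \oo --> (1 : R).
Proof.
have : (fun n : nat => 1 - n.+1%:R^-1 / 2 : R) @ \oo --> (1 - 0 / 2 : R).
  apply: cvgB; first exact: cvg_cst.
  by apply: cvgM; [exact: cvg_harmonic|exact: cvg_cst].
by rewrite mul0r subr0.
Qed.

Lemma binpoly_horner g N r s z :
  binpoly g N (r%:C * (z * s)) = (\poly_(k < N.+1) (bincoef g k * (r%:C * s) ^+ k)).[z].
Proof.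
rewrite horner_poly /binpoly; apply: eq_bigr => k _.
by rewrite -[RHS]mulrA -exprMn; congr (_ * _ ^+ _); ring.
Qed.

Lemma disc_eta g r s : normc s = 1 -> 0 <= r < 1 -> disc_class (fun z => eta g r (z * s)).
Proof.
move=> s1 r01 d d0; have [N hN] := eta_binpoly g r01 d0.
exists (\poly_(k < N.+1) (bincoef g k * (r%:C * s) ^+ k)) => [|z z1].
  by rewrite coef_poly /= expr0 mulr1.
by rewrite -binpoly_horner; apply: hN; rewrite normcM z1 s1 mulr1.
Qed.

Section OnePoint.
Variables (e : int) (s : C).
Hypothesis e1 : (e == 1) || (e == -1).
Hypothesis s1 : normc s = 1.

Let W t : C := ek e t * s.

Lemma e_neq0 : e != 0.
Proof. by case/orP: e1 => /eqP ->. Qed.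

Lemma modc_W t : normc (W t) = 1.
Proof. by rewrite /W normcM modc_ek s1 mulr1. Qed.

Lemma cmeas_W : cmeas W.
Proof. by apply: cmeasM; [exact: cmeas_ek|exact: cmeas_cst]. Qed.

Lemma W1_countable : countable (D `&` [set t | W t = 1]).
Proof.
have ss : s * s^*%C = 1.
  by apply: complex_ext; have := circle_ReIm s1; case: (s) => a b /=; rewrite ?mulrN ?opprK -?expr2// => _; rewrite mulrC addrC subrr.
have h : exists z : C, forall t, W t = 1 -> expi t = z.
  case/orP: e1 => /eqP ee; rewrite /W ee.
    exists s^*%C => t /(congr1 (fun x => x * s^*%C)).
    by rewrite -mulrA ss mulr1 mul1r /ek mul1r.
  exists s => t; rewrite ekN /ek mul1r => h.
  have : expi t * ((expi t)^*%C * s) = expi t by rewrite h mulr1.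
  by rewrite mulrA expi_conjM mul1r.
have [z hz] := h; apply: sub_countable (expi_fiber_countable z).
by apply: subset_card_le => t [Dt Wt]; split => //; exact: hz.
Qed.

(** The functions |1 - w|^(- 2 k) are integrable for k < 1/2: by Parseval the mean
    squares of the Taylor polynomials of (1 - z)^(- k) on circles of radius tending to 1
    are bounded by the sum of the squared binomial coefficients, and Fatou
    passes to the boundary. *)
Lemma sqint_eta1 (k : R) : 0 <= k < 1 / 2 -> sqint (fun t => eta (- k)%:C 1 (W t)).
Proof.
move=> k01; have /andP[k0 k1] := k01.
have hN n : exists N, forall w, normc w = 1 ->
    normc (eta (- k)%:C (rad n) w - binpoly (- k)%:C N ((rad n)%:C * w)) <= n.+1%:R^-1.
  by apply: eta_binpoly; [exact: rad01|rewrite invr_gt0 ltr0n].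
have [N_ hN_] := choice hN.
pose f n t := binpoly (- k)%:C (N_ n) ((rad n)%:C * W t).
have fE n : f n = trig (fun j : nat => e * j%:Z) (N_ n).+1
    (fun j => bincoef (- k)%:C j * ((rad n)%:C * s) ^+ j).
  apply/funext => t; rewrite /f /binpoly; apply: eq_bigr => j _.
  by rewrite -ekX -[RHS]mulrA -exprMn; congr (_ * _ ^+ _); rewrite /W; ring.
apply: (@sqint_fatou R _ f _ (2 * pi * (1 - 2 * k)^-1) W1_countable).
- by apply: cmeas_eta; exact: cmeas_W.
- by move=> n; rewrite fE; exact: sqint_trig.
- move=> n; have := msq_trig (N_ n).+1 (fun j => bincoef (- k)%:C j * ((rad n)%:C * s) ^+ j)
    (freq_inj e_neq0).
  rewrite -fE /msq => hm.
  have -> : rint (fun t => normc (f n t) ^+ 2) =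
     2 * pi * ((2 * pi)^-1 * rint (fun t => normc (f n t) ^+ 2)).
    by rewrite mulrA mulfV ?mul1r// gt_eqF// two_pi_gt0.
  rewrite hm ler_pM2l ?two_pi_gt0//; apply: le_trans (bincoef_sum (N_ n).+1 k01).
  apply: ler_sum => j _; rewrite lerXn2r ?nnegrE ?modc_ge0//.
  have /andP[r0 r1] := rad01 n.
  rewrite normcM modcX normcM s1 mulr1 modc_real (ger0_norm r0) ler_piMr ?modc_ge0//.
  by rewrite exprn_ile1// ltW.
move=> t Dt Nt; have Wt : W t != 1 by apply/eqP => h; apply: Nt.
apply/ccvgP => d d0; have d2 : 0 < d / 2 by rewrite divr_gt0.
have /ccvgP/(_ _ d2)[n1 h1] := ccvg_eta (- k)%:C (modc_W t) Wt cvg_rad.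
have /cvgrPdist_le/(_ _ d2)[n2 _ h2] := @cvg_harmonic R.
exists (maxn n1 n2) => n; rewrite geq_max => /andP[/h1 a1 /h2 a2].
have -> : f n t - eta (- k)%:C 1 (W t) = (f n t - eta (- k)%:C (rad n) (W t)) +
   (eta (- k)%:C (rad n) (W t) - eta (- k)%:C 1 (W t)) by ring.
apply: le_trans (modcD _ _) _; rewrite [d]splitr; apply: lerD => //.
rewrite modcBC; apply: le_trans (hN_ n _ (modc_W t)) _.
by move: a2; rewrite /= sub0r normrN ger0_norm.
Qed.

(** 16^k |1 - w|^(- 2 k), an integrable majorant of |1 - r w|^(2 a) for all |a| <= k and
    all radii r at once.  The constant 16 = 4^2 accounts for |1 - w|^2 <= 4 when a > 0
    and for [dist2_quarter] when a < 0. *)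
Definition envelope (k : R) t : R := expR (k * (ln 16 - ln (dist2 1 (W t)))).

Lemma rintegrable_envelope (k : R) : 0 <= k < 1 / 2 -> rintegrable (envelope k).
Proof.
move=> k01; have [_ h] := sqint_eta1 k01.
have -> : envelope k = (fun t => expR (k * ln 16) * normc (eta (- k)%:C 1 (W t)) ^+ 2).
  apply/funext => t; rewrite modc2_eta /envelope -expRD /= mulr0 mul0r addr0.
  by congr expR; ring.
exact: rintegrableZ.
Qed.

(** At the singular point itself the formula for r = 1 has the value
    1 by convention and is still dominated. *)
Lemma modc2_eta_le g (k : R) r t : `|complex.Re g| <= k -> 0 <= r <= 1 ->
  (r = 1 \/ W t != 1) ->
  normc (eta g r (W t)) ^+ 2 <= expR (pi * `|complex.Im g|) * envelope k t.
Proof.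
move=> gk r01 hr; have k0 : 0 <= k := le_trans (normr_ge0 _) gk.
have w1 := modc_W t; rewrite modc2_eta /envelope -expRD ler_expR addrC; apply: lerD.
  have := atan_gtNpi2 (r * complex.Im (W t) / (1 - r * complex.Re (W t))).
  have := atan_ltpi2 (r * complex.Im (W t) / (1 - r * complex.Re (W t))).
  rewrite -/(ang r (W t)) => h1 h2.
  apply: le_trans (ler_norm _) _; rewrite 2!normrM ger0_norm//.
  have : `|ang r (W t)| <= pi / 2 by rewrite ler_norml; lra.
  have := normr_ge0 (complex.Im g); nra.
apply: le_trans (ler_norm _) _; rewrite normrM; apply: ler_pM => //.
have l4 : 0 < ln (4 : R) by rewrite ln_gt0// ltr1n.
have e16 : ln (16 : R) = 2 * ln 4.
  have -> : 16 = 4 ^+ 2 :> R by rewrite -natrX.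
  by rewrite lnXn// mulr_natl.
have q1_4 : dist2 1 (W t) <= 4 by apply: dist2_le4; rewrite ?lexx ?ler01.
have [q0|q0] := lerP (dist2 1 (W t)) 0.
  (* W t = 1 can only happen at r = 1, where ln 0 = 0 *)
  have -> : r = 1.
    case: hr => // Wn1; exfalso; case/eqP: Wn1.
    have := dist2E 1 w1; rewrite !mul1r => h.
    have a1 := sqr_ge0 (1 - complex.Re (W t)); have a2 := sqr_ge0 (complex.Im (W t)).
    have b1 : (1 - complex.Re (W t)) ^+ 2 = 0 by lra.
    have b2 : (complex.Im (W t)) ^+ 2 = 0 by lra.
    apply: complex_ext => /=; apply/eqP.
      by rewrite eq_sym -subr_eq0 -sqrf_eq0 b1.
    by rewrite -sqrf_eq0 b2.
  rewrite ln0// normr0 e16 subr0; lra.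
have qr := dist2_quarter w1 r01.
have qr0 : 0 < dist2 r (W t) by apply: lt_le_trans qr; rewrite divr_gt0.
have qr4 := dist2_le4 w1 r01.
have a1 : ln (dist2 1 (W t)) <= ln 4 by rewrite ler_ln ?posrE.
have a2 : ln (dist2 r (W t)) <= ln 4 by rewrite ler_ln ?posrE.
have a3 : ln (dist2 1 (W t)) - ln 4 <= ln (dist2 r (W t)).
  rewrite -ln_div ?posrE// ler_ln ?posrE//; exact: divr_gt0.
rewrite ler_norml e16; lra.
Qed.

End OnePoint.

End EtaProducts.

(** * Products of factors with distinct singularities *)

Section Triangle.
Variable R : realType.

Lemma modc_halves (x y z : R[i]) (d : R) :
  normc (x - y) <= d / 2 -> normc (x - z) <= d / 2 -> normc (y - z) <= d.
Proof.
move=> h1 h2; have -> : y - z = (x - z) - (x - y) by ring.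
by apply: le_trans (modcD _ _) _; rewrite modcN [d]splitr lerD.
Qed.

End Triangle.

Section FiniteFamilies.
Variable R : realType.

Lemma measurable_prod (I : Type) (r : seq I) (f : I -> R -> R) :
  (forall i, measurable_fun setT (f i)) ->
  measurable_fun setT (fun t => \prod_(i <- r) f i t).
Proof.
move=> h; elim: r => [|i r IH].
  by under eq_fun do rewrite big_nil; exact: measurable_cst.
by under eq_fun do rewrite big_cons; exact: measurable_funM.
Qed.

Lemma rintegrable_sum (I : Type) (r : seq I) (f : I -> R -> R) :
  (forall i, rintegrable (f i)) -> rintegrable (fun t => \sum_(i <- r) f i t).
Proof.
move=> h; elim: r => [|i r IH].
  by under eq_fun do rewrite big_nil; exact: rintegrable_cst.
by under eq_fun do rewrite big_cons; exact: rintegrableD.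
Qed.

End FiniteFamilies.

Section EtaProduct.
Variable R : realType.
Local Notation C := R[i].
Local Notation D := (`[0, 2 * pi]%classic : set R).
Variables (J : finType) (g s : J -> C) (k : R).
Hypothesis s1 : forall j, normc (s j) = 1.
Hypothesis s_inj : injective s.
Hypothesis gk : forall j, `|complex.Re (g j)| <= k.
Hypothesis k01 : 0 <= k < 1 / 2.

(** The Wiener-Hopf factors are products of this form; s is the family of the
    reciprocals of the singular points. *)
Definition etas r z : C := \prod_j eta (g j) r (z * s j).

(** Stated for squared distances, in the form that [separated] uses: at most one of
    the factors is singular near a given point of the circle. *)
Lemma separation : exists2 d : R, 0 < d <= 1 &
  forall i j, i != j -> 4 * d <= normc (s i - s j) ^+ 2.
Proof.
pose F (p : J * J) : R := 4 / normc (s p.1 - s p.2) ^+ 2.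
have F0 p : 0 <= F p by rewrite divr_ge0 ?sqr_ge0.
pose S := 1 + \sum_(p : J * J | p.1 != p.2) F p.
have S1 : 1 <= S by rewrite lerDl sumr_ge0.
have S0 : 0 < S by apply: lt_le_trans S1.
exists S^-1 => [|i j ij]; first by rewrite invr_gt0 S0 invf_le1.
have n0 : 0 < normc (s i - s j) ^+ 2.
  rewrite exprn_gt0// lt_neqAle modc_ge0 andbT eq_sym; apply/eqP => /modc_eq0/eqP.
  by rewrite subr_eq0 (inj_eq s_inj) (negPf ij).
have : F (i, j) <= S.
  by rewrite /S (bigD1 (i, j))//= addrCA lerDl addr_ge0 ?sumr_ge0.
rewrite /F /= ler_pdivrMr// => h; rewrite ler_pdivrMr//.
by rewrite mulrC.
Qed.

Lemma separated (d : R) z i j : (forall i j, i != j -> 4 * d <= normc (s i - s j) ^+ 2) ->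
  normc z = 1 -> i != j -> dist2 1 (z * s i) < d -> d <= dist2 1 (z * s j).
Proof.
move=> hd z1 ij hi; rewrite leNgt; apply/negP => hj.
have zs l : normc (z * s l) = 1 by rewrite normcM z1 s1 mulr1.
have := hd i j ij; rewrite leNgt; apply/negP/negPn.
have -> : normc (s i - s j) ^+ 2 = normc ((1 - 1%:C * (z * s j)) + - (1 - 1%:C * (z * s i))) ^+ 2.
  have -> : normc (s i - s j) = normc (z * (s i - s j)) by rewrite normcM z1 mul1r.
  by congr (normc _ ^+ 2); rewrite !mul1r; ring.
have := @modcD_young _ 1 (1 - 1%:C * (z * s j)) (- (1 - 1%:C * (z * s i))) ltr01.
rewrite modcN -!dist2_modc// invr1; lra.
Qed.

Section Sign.
Variable e : int.
Hypothesis e1 : (e == 1) || (e == -1).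

Definition envelopes t : R := \prod_j envelope e (s j) k t.

Let k0 : 0 <= k. Proof. by case/andP: k01. Qed.

Lemma measurable_envelope j : measurable_fun setT (envelope e (s j) k).
Proof.
have -> : envelope e (s j) k =
    (fun t => expR (k * ln 16) * normc (eta (- k)%:C 1 (ek e t * s j)) ^+ 2).
  apply/funext => t; rewrite modc2_eta /envelope -expRD /= mulr0 mul0r addr0.
  by congr expR; ring.
apply: measurable_funM; first exact: measurable_cst.
by apply: measurable_modc2; apply: cmeas_eta; exact: cmeas_W.
Qed.

(** Near a point of the circle all envelopes but one are bounded, so the product is
    dominated by a constant times one plus their sum. *)
Lemma rintegrable_envelopes : rintegrable envelopes.
Proof.
have [d /andP[d0 d1] hd] := separation.
pose B : R := expR (k * (ln 16 - ln d)).
have ld : ln d <= 0 by apply: ln_le0.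
have l16 : 0 <= ln (16 : R) by rewrite ln_ge0// ler1n.
have B1 : 1 <= B by rewrite -expR0 ler_expR mulr_ge0// subr_ge0 (le_trans ld).
have B0 : 0 < B by apply: lt_le_trans B1.
have env0 j t : 0 <= envelope e (s j) k t by exact: expR_ge0.
have small j t : d <= dist2 1 (ek e t * s j) -> envelope e (s j) k t <= B.
  move=> h; rewrite /envelope ler_expR ler_wpM2l// lerB// ler_ln ?posrE//.
  exact: lt_le_trans h.
have BJ : 0 <= B ^+ #|J| by rewrite exprn_ge0// ltW.
have key t : envelopes t <= B ^+ #|J| * (1 + \sum_j envelope e (s j) k t).
  have [/existsP[j hj]|/existsPn nj] := boolP [exists j, dist2 1 (ek e t * s j) < d].
    apply: (@le_trans _ _ (envelope e (s j) k t * B ^+ #|J|)).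
      rewrite /envelopes (bigD1 j)//= ler_wpM2l//.
      apply: (@le_trans _ _ (\prod_(i | i != j) B)).
        apply: ler_prod => i ij; rewrite env0/=; apply: small.
        by apply: (separated hd (modc_ek e t) _ hj); rewrite eq_sym.
      rewrite -(prodr_const J B) [leRHS](bigD1 j)//= ler_peMl//.
      by apply: prodr_ge0 => i _; exact: ltW.
    rewrite mulrC ler_wpM2l// (bigD1 j)//= addrCA lerDl addr_ge0//.
    by apply: sumr_ge0 => i _.
  apply: (@le_trans _ _ (B ^+ #|J|)); last by rewrite ler_peMr// lerDl sumr_ge0.
  rewrite -(prodr_const J B); apply: ler_prod => i _; rewrite env0/=; apply: small.
  by rewrite leNgt; exact: nj.
have isum : rintegrable (fun t => \sum_j envelope e (s j) k t).
  by apply: rintegrable_sum => j; exact: rintegrable_envelope.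
have := rintegrableZ (B ^+ #|J|) (rintegrableD (rintegrable_cst 1) isum).
apply: rintegrable_le => [|t _]; last first.
  by rewrite ger0_norm//; apply: prodr_ge0.
by apply: measurable_prod => j; exact: measurable_envelope.
Qed.

Definition etas_const : R := \prod_j expR (pi * `|complex.Im (g j)|).

Lemma modc2_etas_le r t : 0 <= r <= 1 -> (r = 1 \/ forall j, ek e t * s j != 1) ->
  normc (etas r (ek e t)) ^+ 2 <= etas_const * envelopes t.
Proof.
move=> r01 hr; rewrite /etas modc_prod -prodrXl -big_split /=.
apply: ler_prod => j _; rewrite sqr_ge0 /=; apply: modc2_eta_le => //.
by case: hr => [->|h]; [left|right].
Qed.

Lemma cmeas_etas r : cmeas (fun t => etas r (ek e t)).
Proof. by apply: cmeas_prod => j; apply: cmeas_eta; exact: cmeas_W. Qed.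

Lemma sqint_etas : sqint (fun t => etas 1 (ek e t)).
Proof.
apply: (sqint_le (cmeas_etas 1) _ (rintegrableZ etas_const rintegrable_envelopes)) => t _.
by apply: modc2_etas_le; [rewrite lexx ler01|left].
Qed.

Lemma singular_countable : countable (D `&` [set t | exists j, ek e t * s j = 1]).
Proof.
have -> : D `&` [set t | exists j, ek e t * s j = 1] =
    \bigcup_(j in [set: J]) (D `&` [set t | ek e t * s j = 1]).
  apply/seteqP; split=> [t [Dt [j hj]]|t [j _ [Dt hj]]]; first by exists j.
  by split => //; exists j.
apply: bigcup_countable => [|j _]; first exact: countableP.
exact: W1_countable.
Qed.

(** Dominated convergence: both the regularizations and the limit are bounded by
    the product of the envelopes. *)
Lemma etas_cvg :
  (fun n => rint (fun t => normc (etas (rad R n) (ek e t) - etas 1 (ek e t)) ^+ 2)) @ \oo --> (0 : R).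
Proof.
apply: (@rint_dominated R _ (fun n t => etas (rad R n) (ek e t)) (fun t => etas 1 (ek e t))
   (fun t => (4 * etas_const) * envelopes t) singular_countable).
- exact: cmeas_etas.
- by move=> n; exact: cmeas_etas.
- exact: rintegrableZ rintegrable_envelopes.
- move=> n t Dt Nt; have /andP[r0 r1] := rad01 R n.
  have b1 : normc (etas (rad R n) (ek e t)) ^+ 2 <= etas_const * envelopes t.
    apply: modc2_etas_le; first by rewrite r0 ltW.
    by right => j; apply/eqP => h; apply: Nt; split => //; exists j.
  have b2 : normc (etas 1 (ek e t)) ^+ 2 <= etas_const * envelopes t.
    by apply: modc2_etas_le; [rewrite lexx ler01|left].
  have := @modcD_young _ 1 (etas (rad R n) (ek e t)) (- etas 1 (ek e t)) ltr01.
  by rewrite modcN invr1; lra.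
- move=> t Dt Nt; apply: ccvg_prod => j; apply: ccvg_eta; last exact: cvg_rad.
    exact: modc_W.
  by apply/eqP => h; apply: Nt; split => //; exists j.
Qed.

Lemma etas_near (d : R) : 0 < d -> exists N, forall n, (N <= n)%N ->
  rint (fun t => normc (etas (rad R n) (ek e t) - etas 1 (ek e t)) ^+ 2) <= d.
Proof.
move=> d0; have /cvgrPdist_le/(_ _ d0)[N _ hN] := etas_cvg.
exists N => n /hN; rewrite /= sub0r normrN; apply: le_trans; exact: ler_norm.
Qed.

Lemma disc_etas r : 0 <= r < 1 -> disc_class (etas r).
Proof. by move=> r01; apply: disc_prod => j; exact: disc_eta. Qed.

(** The products of radius r < 1 are in [disc_class] and tend to the boundary
    value in mean square. *)
Lemma hardy_etas : hardy e (fun t => etas 1 (ek e t)).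
Proof.
apply: hardy_lim sqint_etas _ => d d0.
have [n /(_ n (leqnn n)) h] := etas_near d0; exists (etas (rad R n)); split.
- exact: disc_etas (rad01 R n).
- exact: cmeas_etas.
apply: le_trans h; rewrite le_eqVlt; apply/orP; left; apply/eqP.
by apply: eq_rint => t; rewrite modcBC.
Qed.

End Sign.

(** Both sides are the n-th Taylor coefficient; for a polynomial this is
    [fc_horner]. *)
Lemma disc_flip (P : C -> C) (n : nat) : disc_class P ->
  cmeas (fun t => P (ek 1 t)) -> cmeas (fun t => P (ek (-1) t)) ->
  fc (fun t => P (ek 1 t)) n%:Z = fc (fun t => P (ek (-1) t)) (- n%:Z).
Proof.
move=> dP m1 m2; have [B _ hB] := disc_bounded dP.
have sP e : cmeas (fun t => P (ek e t)) -> sqint (fun t => P (ek e t)).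
  by move=> m; apply: (@sqint_bounded _ _ B) => // t _; apply: hB; exact: modc_ek.
apply/eqP; rewrite -subr_eq0; apply/eqP/modc_eq0/eqP.
rewrite eq_le modc_ge0 andbT; apply/ler_addgt0Pr => d d0; rewrite add0r.
have d2 : 0 < d / 2 by rewrite divr_gt0.
have [p p0 hp] := dP _ d2.
have near e l : e != 0 -> cmeas (fun t => P (ek e t)) ->
    normc (fc (fun t => P (ek e t)) (e * l%:Z) - p`_l) <= d / 2.
  move=> e0 m; rewrite -(fc_horner e0 p l) -fcB; [|exact: sP|exact: sqint_horner].
  rewrite -ler_sqr ?nnegrE ?modc_ge0 ?(ltW d2)//.
  apply: le_trans (fc_le _ (sqintB (sP _ m) (sqint_horner e p))) _.
  have ed : (d / 2) ^+ 2 = (2 * pi)^-1 * ((d / 2) ^+ 2 * (2 * pi)).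
    by rewrite mulrCA mulVf ?mulr1// gt_eqF// two_pi_gt0.
  rewrite [leRHS]ed /msq ler_pM2l ?invr_gt0 ?two_pi_gt0// -rint_cst.
  apply: le_Rintegral => //; [|exact: rintegrable_cst|].
    exact: (sqintB (sP _ m) (sqint_horner e p)).2.
  move=> t _; rewrite lerXn2r ?nnegrE ?modc_ge0 ?(ltW d2)//; apply: hp; exact: modc_ek.
have h1 := near 1 n isT m1; have h2 := near (-1) n isT m2.
rewrite mul1r in h1; rewrite mulN1r in h2.
by apply: (modc_halves (x := p`_n)); rewrite modcBC.
Qed.

(** Replacing t by - t reverses the Fourier coefficients.  The identity is carried
    over from radius r < 1, which avoids a change of variables in the integral. *)
Lemma etas_flip (n : nat) :
  fc (fun t => etas 1 (ek 1 t)) n%:Z = fc (fun t => etas 1 (ek (-1) t)) (- n%:Z).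
Proof.
apply/eqP; rewrite -subr_eq0; apply/eqP/modc_eq0/eqP.
rewrite eq_le modc_ge0 andbT; apply/ler_addgt0Pr => d d0; rewrite add0r.
have d2 : 0 < (d / 2) ^+ 2 by rewrite exprn_gt0// divr_gt0.
have [n1 c1] := @etas_near 1 isT _ d2; have [n2 c2] := @etas_near (-1) isT _ d2.
pose N := maxn n1 n2; have h1 := c1 N (leq_maxl _ _); have h2 := c2 N (leq_maxr _ _).
have mN e : cmeas (fun t => etas (rad R N) (ek e t)) by exact: cmeas_etas.
have fl := disc_flip n (disc_etas (rad01 R N)) (mN 1) (mN (-1)).
have sN e : sqint (fun t => etas (rad R N) (ek e t)).
  have [B _ hB] := disc_bounded (disc_etas (rad01 R N)).
  apply: (@sqint_bounded _ _ B) => [|t _]; first exact: cmeas_etas.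
  by apply: hB; exact: modc_ek.
have near e l : (e == 1) || (e == -1) ->
    rint (fun t => normc (etas (rad R N) (ek e t) - etas 1 (ek e t)) ^+ 2) <= (d / 2) ^+ 2 ->
    normc (fc (fun t => etas (rad R N) (ek e t)) l - fc (fun t => etas 1 (ek e t)) l) <= d / 2.
  move=> e1 he; rewrite -fcB; [|exact: sN|exact: sqint_etas].
  rewrite -ler_sqr ?nnegrE ?modc_ge0 ?divr_ge0 ?(ltW d0)//.
  apply: le_trans (fc_le _ (sqintB (sN e) (sqint_etas e1))) _.
  exact: le_trans (msq_le_rint _) he.
have a1 := near 1 n%:Z isT h1; have a2 := near (-1) (- n%:Z) isT h2.
by rewrite fl in a1; exact: modc_halves a1 a2.
Qed.

End EtaProduct.

(** * Toeplitz and Hankel operators on l2 *)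

Section ToeplitzHankel.
Variable R : realType.
Local Notation C := R[i].
Local Notation D := (`[0, 2 * pi]%classic : set R).
Implicit Types (F G : R -> C) (x : nat -> C).

Definition toep F x (j : nat) : C := dot (fun k => fc F (j%:Z - k%:Z)) x.
Definition hank F x (j : nat) : C := dot (fun k => fc F (j%:Z + k%:Z + 1)) x.

Definition cbounded F := cmeas F /\ exists B : R, forall t, normc (F t) <= B.

Lemma cbounded_sqint F : cbounded F -> sqint F.
Proof. by move=> [mF [B hB]]; exact: (sqint_bounded mF (fun t _ => hB t)). Qed.

Lemma cboundedM F G : cbounded F -> cbounded G -> cbounded (fun t => F t * G t).
Proof.
move=> [mF [B hB]] [mG [B' hB']]; split; first exact: cmeasM.
by exists (B * B') => t; rewrite normcM ler_pM ?modc_ge0.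
Qed.

Lemma natZ_inj : injective (fun k : nat => k%:Z). Proof. by move=> i j []. Qed.

Lemma toep_row F (j : nat) : sqint F -> l2 (fun k : nat => fc F (j%:Z - k%:Z)).
Proof. by move=> hF; apply: (symbol_row j%:Z natZ_inj hF). Qed.

Lemma toep_wfun F (j : nat) : sqint F -> wfun (fun x => toep F x j).
Proof. by move=> hF; apply: wfun_dot; exact: toep_row. Qed.

Lemma toep_opb F (B : R) : cmeas F -> (forall t, normc (F t) <= B) -> opb (B ^+ 2) (toep F).
Proof. by move=> mF hB; apply: (symbol_opb natZ_inj mF (fun t _ => hB t)). Qed.

Lemma toep_bop F : cbounded F -> bop (toep F).
Proof. by move=> [mF [B hB]]; apply: (symbol_bop natZ_inj mF (fun t _ => hB t)). Qed.

Lemma hank_bop F : cbounded F -> bop (hank F).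
Proof.
move=> [mF [B hB]]; have sI : injective (fun k : nat => - k%:Z - 1) by move=> i j /addIr/oppr_inj[].
have := symbol_bop sI mF (fun t _ => hB t).
suff -> : hank F = (fun x (j : nat) => dot (fun k : nat => fc F (j%:Z - (- k%:Z - 1))) x) by [].
apply/funext => x; apply/funext => j; rewrite /hank; congr (dot _ x); apply/funext => k.
by have -> : j%:Z + k%:Z + 1 = j%:Z - (- k%:Z - 1) by lia.
Qed.

Lemma toep_basis F k j : toep F (basis_vector R k) j = fc F (j%:Z - k%:Z).
Proof. exact: dot_basis. Qed.

Lemma hank_basis F k j : hank F (basis_vector R k) j = fc F (j%:Z + k%:Z + 1).
Proof. exact: dot_basis. Qed.

Lemma ccvg_delay (u v : nat -> C) l (k : nat) : ccvg u l ->
  (forall N, v (k + N)%N = u N) -> ccvg v l.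
Proof.
move=> /ccvgP cu h; apply/ccvgP => d /cu[N hN]; exists (k + N)%N => n hn.
have kn : (k <= n)%N by apply: leq_trans hn; exact: leq_addr.
rewrite -(subnKC kn) h; apply: hN.
by rewrite leq_subRL.
Qed.

Lemma sum_delay (f : nat -> C) (k N : nat) : (forall m, (m < k)%N -> f m = 0) ->
  \sum_(m < k + N) f m = \sum_(l < N) f (k + l)%N.
Proof.
move=> h; rewrite big_split_ord /= big1 ?add0r// => i _; exact: h.
Qed.

(** The (i, k) entry of T(F) T(G) is that of T(F G) when G is analytic: the
    coefficients of G of negative index vanish, so that summing over m >= 0 is
    summing over all integers. *)
Lemma conv_plus F G (i : int) (k : nat) : sqint F -> hardy 1 G ->
  dot (fun m : nat => fc F (i - m%:Z)) (fun m : nat => fc G (m%:Z - k%:Z)) =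
  fc (fun t => F t * G t) (i - k%:Z).
Proof.
move=> hF hG; apply: csum_ccvg.
have e1 : (1 : int) != 0 by [].
have := hardy_mul e1 (i - k%:Z) hG hF; under eq_fc do rewrite mulrC.
move=> /(@ccvg_delay _ _ _ k); apply => N.
rewrite (@sum_delay (fun m : nat => fc F (i - m%:Z) * fc G (m%:Z - k%:Z))) => [|m mk].
  apply: eq_bigr => l _ /=.
  have -> : i - (k + l)%:Z = i - k%:Z - 1 * (l : nat)%:Z by lia.
  have -> : (k + l)%:Z - k%:Z = 1 * (l : nat)%:Z by lia.
  exact: mulrC.
rewrite (hardy_fc_out hG) ?mulr0// => l; apply/eqP => h.
by move: h mk; lia.
Qed.

(** The mirror image of [conv_plus], with the antianalytic factor on the left. *)
Lemma conv_minus F G (i : int) (j : nat) : hardy (-1) F -> sqint G ->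
  dot (fun l : nat => fc F (j%:Z - l%:Z)) (fun l : nat => fc G (l%:Z - i)) =
  fc (fun t => F t * G t) (j%:Z - i).
Proof.
move=> hF hG; apply: csum_ccvg.
have e1 : (-1 : int) != 0 by [].
have := hardy_mul e1 (j%:Z - i) hF hG.
move=> /(@ccvg_delay _ _ _ j); apply => N.
rewrite (@sum_delay (fun l : nat => fc F (j%:Z - l%:Z) * fc G (l%:Z - i))) => [|m mk].
  apply: eq_bigr => l _ /=.
  have -> : j%:Z - (j + l)%:Z = -1 * (l : nat)%:Z by lia.
  by have -> : (j + l)%:Z - i = j%:Z - i - -1 * (l : nat)%:Z by lia.
rewrite (hardy_fc_out hF) ?mul0r// => l; apply/eqP => h.
by move: h mk; lia.
Qed.

(** The matrix form of H(F G~) = H(F) T(G); the reflection of the analytic factor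
    G is given through its coefficients. *)
Lemma conv_hankel F G G' (i k : nat) : sqint F -> hardy 1 G -> hardy (-1) G' ->
  (forall n : nat, fc G n%:Z = fc G' (- n%:Z)) ->
  dot (fun m : nat => fc F (i%:Z + m%:Z + 1)) (fun m : nat => fc G (m%:Z - k%:Z)) =
  fc (fun t => F t * G' t) (i%:Z + k%:Z + 1).
Proof.
move=> hF hG hG' flip; apply: csum_ccvg.
have e1 : (-1 : int) != 0 by [].
have := hardy_mul e1 (i%:Z + k%:Z + 1) hG' hF; under eq_fc do rewrite mulrC.
move=> /(@ccvg_delay _ _ _ k); apply => N.
rewrite (@sum_delay (fun m : nat => fc F (i%:Z + m%:Z + 1) * fc G (m%:Z - k%:Z))) => [|m mk].
  apply: eq_bigr => l _ /=.
  have -> : i%:Z + (k + l)%:Z + 1 = i%:Z + k%:Z + 1 - -1 * (l : nat)%:Z by lia.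
  have -> : (k + l)%:Z - k%:Z = (l : nat)%:Z by lia.
  by rewrite flip mulN1r; exact: mulrC.
rewrite (hardy_fc_out hG) ?mulr0// => l; apply/eqP => h.
by move: h mk; lia.
Qed.

(** The product formula for bounded symbols, from its matrix entries. *)
Lemma toepM_plus F G x : cbounded F -> cbounded G -> hardy 1 G -> l2 x ->
  toep (fun t => F t * G t) x = toep F (toep G x).
Proof.
move=> bF bG hG; apply: (@bop_ext _ (toep _) (fun x => toep F (toep G x))).
  exact/toep_bop/cboundedM.
  by apply: bop_comp; exact: toep_bop.
move=> k j; rewrite toep_basis -conv_plus//; last exact: cbounded_sqint.
rewrite -[RHS]/(dot _ (toep G (basis_vector R k))).
by congr (dot _ _); apply/funext => m; rewrite toep_basis.
Qed.

Lemma toepM_minus F G x : cbounded F -> cbounded G -> hardy (-1) F -> l2 x ->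
  toep (fun t => F t * G t) x = toep F (toep G x).
Proof.
move=> bF bG hF; apply: (@bop_ext _ (toep _) (fun x => toep F (toep G x))).
  exact/toep_bop/cboundedM.
  by apply: bop_comp; exact: toep_bop.
move=> k j; rewrite toep_basis -conv_minus//; last exact: cbounded_sqint.
rewrite -[RHS]/(dot _ (toep G (basis_vector R k))).
by congr (dot _ _); apply/funext => m; rewrite toep_basis.
Qed.

Lemma cbounded1 : cbounded (fun=> 1).
Proof. by split; [exact: cmeas_cst|exists 1 => t; rewrite normc1]. Qed.

Lemma toep1 x : l2 x -> toep (fun=> 1) x = x.
Proof.
apply: (@bop_ext _ (toep _) (fun x => x)); [exact/toep_bop/cbounded1|exact: bop_id|] => k j.
rewrite toep_basis (eq_fc (G := ek 0)) => [|t]; last by rewrite /ek mulr0z mul0r expi0.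
rewrite fc_ek /basis_vector eq_sym subr_eq0.
by congr (_ %:R); congr nat_of_bool; apply/eqP/eqP => [[]|->].
Qed.

(** For c = m / B^2 the symbol 1 - c F is bounded by the square root of
    1 - (m / B)^2 < 1, so T(F) = c^-1 (1 - T(1 - c F)) is inverted by a Neumann series. *)
Lemma toep_sectorial F (m B : R) : 0 < m -> cmeas F ->
  (forall t, m <= complex.Re (F t)) -> (forall t, normc (F t) <= B) ->
  (forall y, l2 y -> exists2 x, l2 x & toep F x = y) /\
  (forall x, l2 x -> toep F x = (fun=> 0) -> x = (fun=> 0)).
Proof.
move=> m0 mF hm hB.
have mB : m <= B.
  by apply: le_trans (hm 0) (le_trans (ler_norm _) (le_trans (Re_le_modc _) (hB 0))).
have B0 : 0 < B := lt_le_trans m0 mB.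
pose c : R := m / B ^+ 2; have c0 : 0 < c by rewrite divr_gt0// exprn_gt0.
pose Q t := 1 + (- c)%:C * F t.
pose q := 1 - (m / B) ^+ 2.
have q01 : 0 <= q < 1.
  have d1 : m / B <= 1 by rewrite ler_pdivrMr// mul1r.
  have d0 : 0 < m / B by rewrite divr_gt0.
  by rewrite /q subr_ge0 expr_le1 ?(ltW d0)// d1 /= gtrBl exprn_gt0.
have /andP[q0 q1] := q01.
have Qle t : normc (Q t) <= Num.sqrt q.
  rewrite -ler_sqr ?nnegrE ?modc_ge0 ?sqrtr_ge0// sqr_sqrtr//.
  have -> : normc (Q t) ^+ 2 = 1 - 2 * c * complex.Re (F t) + c ^+ 2 * normc (F t) ^+ 2.
    rewrite !modcE /Q ReD ImD (ReM (_%:C)) (ImM (_%:C)) /=; ring.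
  have h1 : c * m <= c * complex.Re (F t) by rewrite ler_pM2l.
  have h2 : c ^+ 2 * normc (F t) ^+ 2 <= c ^+ 2 * B ^+ 2.
    by rewrite ler_pM2l ?exprn_gt0// lerXn2r ?nnegrE ?modc_ge0// ltW.
  have e1 : c * m = (m / B) ^+ 2 by rewrite /c; field; rewrite gt_eqF.
  have e2 : c ^+ 2 * B ^+ 2 = (m / B) ^+ 2 by rewrite /c; field; rewrite gt_eqF.
  by move: h1 h2; rewrite e1 e2 /q; lra.
have mQ : cmeas Q.
  apply: cmeasD; first exact: cmeas_cst.
  by apply: cmeasM => //; exact: cmeas_cst.
have bF : cbounded F by split => //; exists B.
have bQ : cbounded Q by split => //; exists (Num.sqrt q).
have oQ : opb q (toep Q) by have := toep_opb mQ Qle; rewrite sqr_sqrtr.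
have QF x : l2 x -> toep Q x = (fun j => x j + (- c)%:C * toep F x j).
  apply: (@bop_ext _ (toep Q) (fun x j => x j + (- c)%:C * toep F x j)); first exact: toep_bop.
    apply: bop_add; first exact: bop_id.
    exact: (bop_comp (bop_scale (- c)%:C) (toep_bop bF)).
  move=> k j; rewrite !toep_basis /Q fcD; [|exact: cbounded_sqint cbounded1|exact/sqintZ/cbounded_sqint].
  by rewrite fcZ; [rewrite -(toep_basis (fun=> 1)) toep1//; exact: l2_basis|exact: cbounded_sqint].
have cC : c%:C != 0 :> C by apply/eqP => -[] h; move: c0; rewrite h ltxx.
split=> [y ly|x lx Fx].
  have [x lx hx] := contraction_fixpoint (toep_bop bQ) oQ q01 (l2Z c%:C ly).
  exists x => //; apply/funext => j; apply: (mulfI cC).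
  have := congr1 (fun f => f j) hx; rewrite /= QF// => h.
  apply/eqP; rewrite eq_sym -subr_eq0; apply/eqP.
  by rewrite -[RHS](subrr (x j)) {1}h; ring.
apply: (contraction_inj oQ q01 lx); rewrite QF// Fx.
by apply/funext => j; rewrite mulr0 addr0.
Qed.

End ToeplitzHankel.

(** * Piecewise continuous symbols with several jumps *)

Section Sector.
Variable R : realType.
Local Notation C := R[i].

Lemma atan_lip (x y : R) : `|atan x - atan y| <= `|x - y|.
Proof.
wlog xy : x y / x < y => [hw|].
  by case: (ltgtP x y) => [|yx|->]; [exact: hw|rewrite distrC [leRHS]distrC; exact: hw|rewrite !subrr].
have d s : s \in `]x, y[ -> is_derive s (1 : R) (@atan R) ((1 + s ^+ 2)^-1).
  by move=> _; exact: is_derive1_atan.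
have c : {within `[x, y], continuous (@atan R)}.
  by apply: continuous_subspaceT => s; exact: continuous_atan.
have [s _ h] := MVT xy d c.
rewrite distrC h normrM [leRHS]distrC ler_piMl// ger0_norm ?invr_ge0 ?addr_ge0 ?sqr_ge0//.
by rewrite invf_le1 ?lerDl ?sqr_ge0// ltr_wpDr ?sqr_ge0.
Qed.

(** Both arguments have the sign of Im w and are at most pi / 2 in modulus. *)
Lemma ang_diff_le (r : R) w : normc w = 1 -> 0 <= r <= 1 ->
  `|ang 1 w - ang r w| <= pi / 2.
Proof.
move=> w1 /andP[r0 r1]; have /andP[h1 h2] := circle_Re w1.
have p0 := pi_gt0 R.
have den (s : R) : 0 <= s <= 1 -> 0 <= 1 - s * complex.Re w.
  move=> /andP[s0 s1]; have : s * complex.Re w <= s * 1 by rewrite ler_wpM2l.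
  lra.
have bnd (s : R) : - (pi / 2) < ang s w < pi / 2 by rewrite atan_gtNpi2 atan_ltpi2.
have /andP[b1 b2] := bnd 1; have /andP[b3 b4] := bnd r.
have [i0|i0] := lerP 0 (complex.Im w).
  have pos (s : R) : 0 <= s <= 1 -> 0 <= ang s w.
    move=> s01; rewrite -(@atan0 R); apply: le_atan; rewrite divr_ge0 ?den//.
    by rewrite mulr_ge0//; case/andP: s01.
  have := pos 1; have := pos r; rewrite r0 r1 lexx ler01 => /(_ isT) a1 /(_ isT) a2.
  by rewrite ler_norml; lra.
have neg (s : R) : 0 <= s <= 1 -> ang s w <= 0.
  move=> s01; rewrite -(@atan0 R); apply: le_atan.
  apply: mulr_le0_ge0; last by rewrite invr_ge0 den.
  by apply: mulr_ge0_le0; [case/andP: s01|exact: ltW].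
have := neg 1; have := neg r; rewrite r0 r1 lexx ler01 => /(_ isT) a1 /(_ isT) a2.
by rewrite ler_norml; lra.
Qed.

(** Away from the jump the argument is Lipschitz in the radius. *)
Lemma ang_diff_small (r d : R) w : normc w = 1 -> 0 <= r <= 1 -> 0 < d <= 1 ->
  d <= dist2 1 w -> `|ang 1 w - ang r w| <= (1 - r) * (4 / d ^+ 2).
Proof.
move=> w1 /andP[r0 r1] /andP[d0 d1] hd; have /andP[h1 h2] := circle_Re w1.
have hI : `|complex.Im w| <= 1 by rewrite -w1 Im_le_modc.
set a := complex.Re w in h1 h2 *; set b := complex.Im w in hI *.
have da : d / 2 <= 1 - a by move: hd; rewrite /dist2 -/a; lra.
have dr : d / 2 <= 1 - r * a.
  have [a0|a0] := lerP 0 a; first by have : r * a <= 1 * a; [rewrite ler_wpM2r|lra].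
  have : r * a <= 0 by rewrite mulr_ge0_le0// ltW.
  lra.
have d2 : 0 < d / 2 by rewrite divr_gt0.
have p1 : 0 < 1 - a := lt_le_trans d2 da.
have p2 : 0 < 1 - r * a := lt_le_trans d2 dr.
rewrite /ang -/a -/b; apply: le_trans (atan_lip _ _) _.
have -> : 1 * b / (1 - 1 * a) - r * b / (1 - r * a) = (1 - r) * (b / ((1 - a) * (1 - r * a))).
  by field; rewrite !gt_eqF.
rewrite normrM ger0_norm ?subr_ge0// ler_wpM2l ?subr_ge0//.
rewrite normrM normfV (gtr0_norm (mulr_gt0 p1 p2)).
apply: (@le_trans _ _ (1 / (d / 2 * (d / 2)))).
  apply: ler_pM; rewrite ?invr_ge0 ?mulr_ge0 ?(ltW p1) ?(ltW p2)//.
  by rewrite lef_pV2 ?posrE ?mulr_gt0// ler_pM// ltW.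
by rewrite le_eqVlt; apply/orP; left; apply/eqP; field; rewrite gt_eqF.
Qed.

Lemma cos_ge (x y : R) : `|x| <= y -> y <= pi -> cos y <= cos x.
Proof.
move=> xy yp; rewrite -(cos_norm x).
have y0 : 0 <= y := le_trans (normr_ge0 _) xy.
rewrite leNgt ltr_cos ?in_itv /= ?normr_ge0 ?y0 ?yp ?(le_trans xy)//.
by rewrite -leNgt.
Qed.

End Sector.

Section PiecewiseSymbol.
Variable R : realType.
Local Notation C := R[i].
Variables (J : finType) (tau : J -> C).
Hypothesis tau1 : forall j, normc (tau j) = 1.
Hypothesis tau_inj : injective tau.
Implicit Types (a : J -> C) (r : R).

(** [jump r b z] is b log ((1 - r z) / conj (1 - r z)), and [jumps a r] the product
    of the corresponding exponentials, one for each point tau_j: the symbol with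
    pure jumps for r = 1, a smooth regularization of it for r < 1. *)
Definition jump (r : R) (b z : C) : C := (-2 * ang r z)%:C * 'i * b.
Definition wind a r t : C := \sum_j jump r (a j) (ek 1 t * (tau j)^*%C).
Definition jumps a r t : C := cexp (wind a r t).

(** [jumps_plus] and [jumps_minus] are the analytic and antianalytic factors of
    [jumps]; the latter is evaluated at the conjugate point ek (-1) t. *)
Definition jumps_plus a r z : C := etas a (fun j => (tau j)^*%C) r z.
Definition jumps_minus a r z : C := etas (fun j => - a j) tau r z.

Lemma tauJ1 j : normc (tau j)^*%C = 1. Proof. by rewrite modcJ. Qed.
Lemma tauJ_inj : injective (fun j => (tau j)^*%C).
Proof. by move=> i j /(can_inj (@conjcK R)); exact: tau_inj. Qed.

Lemma clogJ r z : clog r z^*%C = (clog r z)^*%C.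
Proof.
by case: z => x y; rewrite /clog /dist2 /ang /= mulrN mulNr atanN.
Qed.

Lemma clog_jump r b z : b * clog r z - b * (clog r z)^*%C = jump r b z.
Proof.
apply: complex_ext.
  by rewrite /jump ReD ReN !ReM ?ImM /=; ring.
by rewrite /jump ImD ImN !ImM ?ReM /=; ring.
Qed.

Lemma jumps_split a r t : jumps a r t = jumps_plus a r (ek 1 t) * jumps_minus a r (ek (-1) t).
Proof.
rewrite /jumps /wind cexp_sum /jumps_plus /jumps_minus /etas -big_split /=; apply: eq_bigr => j _.
rewrite /eta -cexpD; congr cexp; rewrite -clog_jump mulNr -clogJ rmorphM /= conjcK.
by rewrite ekN.
Qed.

Lemma etasN (g s : J -> C) r z : etas g s r z * etas (fun j => - g j) s r z = 1.
Proof.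
rewrite /etas -big_split /= big1// => j _.
by rewrite /eta -cexpD mulNr subrr cexp0.
Qed.

Lemma jumps_plusN a r z : jumps_plus a r z * jumps_plus (fun j => - a j) r z = 1.
Proof. exact: etasN. Qed.

Lemma jumps_minusN a r z : jumps_minus a r z * jumps_minus (fun j => - a j) r z = 1.
Proof. exact: etasN. Qed.

Lemma jumpsN a r t : jumps a r t * jumps (fun j => - a j) r t = 1.
Proof.
rewrite /jumps -cexpD /wind -big_split /= big1 ?cexp0// => j _.
by rewrite /jump mulrN subrr.
Qed.

Lemma cmeas_jumps a r : cmeas (jumps a r).
Proof.
rewrite /jumps; under eq_fun do rewrite -/(jumps a r _) jumps_split.
by apply: cmeasM; exact: cmeas_etas.
Qed.

Lemma ang_le (r : R) w : `|ang r w| <= pi / 2.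
Proof.
have := atan_gtNpi2 (r * complex.Im w / (1 - r * complex.Re w)).
have := atan_ltpi2 (r * complex.Im w / (1 - r * complex.Re w)).
by rewrite -/(ang r w) => h1 h2; rewrite ler_norml; lra.
Qed.

Lemma cbounded_jumps a r : cbounded (jumps a r).
Proof.
split; first exact: cmeas_jumps.
exists (expR (\sum_j normc (a j) * pi)) => t; rewrite /jumps modc_cexp ler_expR.
apply: le_trans (ler_norm _) _; apply: le_trans (Re_le_modc _) _.
apply: le_trans (modc_sum _ _ _) _; apply: ler_sum => j _.
rewrite /jump normcM normcM modc_real.
have -> : normc 'i = 1 :> R by rewrite /normc /= expr0n expr1n add0r sqrtr1.
rewrite mulr1 mulrC ler_wpM2l ?modc_ge0// normrM normrN (ger0_norm (ler0n R 2)).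
have := ang_le r (ek 1 t * (tau j)^*%C); lra.
Qed.

Lemma disc_cbounded (P : C -> C) (e : int) : disc_class P -> cmeas (fun t => P (ek e t)) ->
  cbounded (fun t => P (ek e t)).
Proof.
move=> dP mP; split => //; have [B _ hB] := disc_bounded dP.
by exists B => t; apply: hB; exact: modc_ek.
Qed.

Lemma jumps_plus_reg a r : 0 <= r < 1 ->
  cbounded (fun t => jumps_plus a r (ek 1 t)) /\ hardy 1 (fun t => jumps_plus a r (ek 1 t)).
Proof.
move=> r01; have d := @disc_etas R J a (fun j => (tau j)^*%C) tauJ1 r r01.
have m : cmeas (fun t => jumps_plus a r (ek 1 t)) by exact: cmeas_etas.
by split; [exact: disc_cbounded|exact: disc_hardy].
Qed.

Lemma jumps_minus_reg a r : 0 <= r < 1 ->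
  cbounded (fun t => jumps_minus a r (ek (-1) t)) /\ hardy (-1) (fun t => jumps_minus a r (ek (-1) t)).
Proof.
move=> r01; have d := @disc_etas R J (fun j => - a j) tau tau1 r r01.
have m : cmeas (fun t => jumps_minus a r (ek (-1) t)) by exact: cmeas_etas.
by split; [exact: disc_cbounded|exact: disc_hardy].
Qed.

Variables (a : J -> C) (k : R).
Hypothesis ak : forall j, `|complex.Re (a j)| <= k.
Hypothesis k01 : 0 <= k < 1 / 2.

(** The argument of the quotient of [jumps a] at radii 1 and r is a sum of terms
    - 2 Re (a_j) (ang 1 - ang r).  For r close to 1, all of them but the one of the nearest
    jump are arbitrarily small, and that one is at most 2 k (pi / 2) < pi / 2;
    the moduli are bounded above and below. *)
Lemma jumps_sector : exists r m B, [/\ 0 <= r < 1, 0 < m,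
  (forall t, m <= complex.Re (jumps a 1 t * jumps (fun j => - a j) r t)) &
  (forall t, normc (jumps a 1 t * jumps (fun j => - a j) r t) <= B)].
Proof.
have p0 := pi_gt0 R; have /andP[k0 k1] := k01.
have [d d01 hd] := separation tauJ_inj.
have /andP[d0 d1] := d01.
pose n : R := #|J|%:R; have n0 : 0 <= n by exact: ler0n.
(* h is half of the room left by the large term k pi below pi / 2 *)
pose h := (pi / 2 - k * pi) / 2.
have kp : k * pi < pi / 2.
  have : k * pi < 1 / 2 * pi by rewrite ltr_pM2r.
  lra.
have h0 : 0 < h by rewrite /h; lra.
pose c := 4 / d ^+ 2; have c0 : 0 < c by rewrite divr_gt0// exprn_gt0.
have nc0 : 0 < (n + 1) * c by rewrite mulr_gt0// ltr_wpDl.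
(* x = 1 - r is small enough for the remaining n terms to sum to at most h *)
pose x := h / (h + (n + 1) * c).
have hx : 0 < h + (n + 1) * c by rewrite addr_gt0.
have x0 : 0 < x by rewrite divr_gt0.
have x1 : x < 1 by rewrite ltr_pdivrMr// mul1r ltrDl.
have xn : n * (x * c) <= h.
  apply: (@le_trans _ _ (x * (h + (n + 1) * c))); last by rewrite /x divfK// gt_eqF.
  rewrite mulrCA ler_pM2l// mulrDl mul1r.
  by have := c0; lra.
pose r := 1 - x; have r01 : 0 <= r < 1 by rewrite /r; lra.
have r01' : 0 <= r <= 1 by move: r01; lra.
pose w t j : C := ek 1 t * (tau j)^*%C.
have w1 t j : normc (w t j) = 1 by rewrite normcM modc_ek tauJ1 mulr1.
pose dl t j : R := ang 1 (w t j) - ang r (w t j).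
have SE t : jumps a 1 t * jumps (fun j => - a j) r t = cexp (\sum_j ((-2 * dl t j)%:C * 'i * a j)).
  rewrite /jumps -cexpD; congr cexp; rewrite /wind -big_split /=; apply: eq_bigr => j _.
  by rewrite /jump /dl -/(w t j) mulrBr rmorphB /=; ring.
have ReS t : complex.Re (\sum_j ((-2 * dl t j)%:C * 'i * a j)) = \sum_j 2 * dl t j * complex.Im (a j).
  by rewrite Re_sum; apply: eq_bigr => j _; rewrite !ReM !ImM /=; ring.
have ImS t : complex.Im (\sum_j ((-2 * dl t j)%:C * 'i * a j)) = - \sum_j 2 * dl t j * complex.Re (a j).
  by rewrite Im_sum -sumrN; apply: eq_bigr => j _; rewrite !ImM !ReM /=; ring.
pose K := \sum_j pi * `|complex.Im (a j)|.
have ReK t : `|complex.Re (\sum_j ((-2 * dl t j)%:C * 'i * a j))| <= K.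
  rewrite ReS; apply: le_trans (ler_norm_sum _ _ _) _; apply: ler_sum => j _.
  rewrite normrM ler_wpM2r// normrM (ger0_norm (ler0n R 2)).
  by have := ang_diff_le (w1 t j) r01'; rewrite -/(dl t j); lra.
have term t j : `|2 * dl t j * complex.Re (a j)| <= `|dl t j|.
  rewrite !normrM (ger0_norm (ler0n R 2)); have := ak j => hk.
  have : `|dl t j| * `|complex.Re (a j)| <= `|dl t j| * (1 / 2).
    by rewrite ler_wpM2l//; lra.
  lra.
have small t j : d <= dist2 1 (w t j) -> `|2 * dl t j * complex.Re (a j)| <= x * c.
  move=> hj; apply: le_trans (term t j) _.
  have := ang_diff_small (w1 t j) r01' d01 hj.
  by rewrite -/(dl t j) /r subKr.
have xc0 : 0 <= x * c by rewrite mulr_ge0// ltW.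
have ImK t : `|complex.Im (\sum_j ((-2 * dl t j)%:C * 'i * a j))| <= k * pi + h.
  rewrite ImS normrN; apply: le_trans (ler_norm_sum _ _ _) _.
  have cs : \sum_(j : J) x * c = n * (x * c).
    by rewrite sumr_const mulr_natl.
  have [/existsP[j hj]|/existsPn nj] := boolP [exists j, dist2 1 (w t j) < d].
    rewrite (bigD1 j)//=; apply: lerD.
      rewrite !normrM (ger0_norm (ler0n R 2)).
      have := ang_diff_le (w1 t j) r01'; rewrite -/(dl t j) => hdl.
      have : `|dl t j| * `|complex.Re (a j)| <= (pi / 2) * k by rewrite ler_pM.
      lra.
    apply: le_trans xn; rewrite -cs [leRHS](bigD1 j)//=.
    apply: (@le_trans _ _ (\sum_(i | i != j) x * c)); last by rewrite lerDr.
    apply: ler_sum => i ij; apply: small.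
    by apply: (separated tauJ1 hd (modc_ek 1 t) _ hj); rewrite eq_sym.
  apply: (@le_trans _ _ h); last by rewrite lerDr mulr_ge0// ltW.
  apply: le_trans xn; rewrite -cs; apply: ler_sum => j _; apply: small.
  by rewrite leNgt; exact: nj.
exists r, (expR (- K) * cos (k * pi + h)), (expR K); split => //.
- rewrite mulr_gt0 ?expR_gt0// cos_gt0_pihalf// /h; have : 0 <= k * pi by rewrite mulr_ge0// ltW.
  by move=> kp0; apply/andP; split; lra.
- move=> t; rewrite SE Re_cexp; have := ReK t; have := ImK t.
  set Z := \sum_j _ => hI; rewrite ler_norml => /andP[hR _].
  have kp0 : 0 <= k * pi by rewrite mulr_ge0// ltW.
  apply: ler_pM; rewrite ?expR_ge0 ?ler_expR//.
    by apply/ltW/cos_gt0_pihalf; rewrite /h; apply/andP; split; lra.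
  by apply: cos_ge => //; rewrite /h; lra.
- move=> t; rewrite SE modc_cexp ler_expR; exact: le_trans (ler_norm _) (ReK t).
Qed.

(** With psi = N S P, where P and N are the factors of radius r < 1 and S is
    sectorial, T(psi) = T(N) T(S) T(P) and each of the three is invertible: the outer
    ones by the inverse functions, which are again regular factors. *)
Lemma toep_jumps_bijective :
  (forall y, l2 y -> exists2 x, l2 x & toep (jumps a 1) x = y) /\
  (forall x, l2 x -> toep (jumps a 1) x = (fun=> 0) -> x = (fun=> 0)).
Proof.
have [r [m [B [r01 m0 hm hB]]]] := jumps_sector.
pose S t := jumps a 1 t * jumps (fun j => - a j) r t.
pose P a' t := jumps_plus a' r (ek 1 t); pose N a' t := jumps_minus a' r (ek (-1) t).
pose na j := - a j.
have mS : cmeas S by apply: cmeasM; exact: cmeas_jumps.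
have bS : cbounded S by split => //; exists B.
have [sS iS] := toep_sectorial m0 mS hm hB.
have [bP hP] := jumps_plus_reg a r01; have [bP' hP'] := jumps_plus_reg na r01.
have [bN hN] := jumps_minus_reg a r01; have [bN' hN'] := jumps_minus_reg na r01.
have bSP : cbounded (fun t => S t * P a t) by exact: cboundedM.
have fac : jumps a 1 = (fun t => N a t * (S t * P a t)).
  apply/funext => t; rewrite /S /P /N.
  have h : jumps a r t * jumps (fun j => - a j) r t = 1 := jumpsN a r t.
  rewrite jumps_split in h.
  by rewrite -[LHS]mulr1 -h; ring.
have one (F : R -> C) : (forall t, F t = 1) -> forall x, l2 x -> toep F x = x.
  by move=> h x lx; have -> : F = (fun=> 1) by [apply/funext|]; exact: toep1.
have tl (F : R -> C) (x : nat -> C) : cbounded F -> l2 x -> l2 (toep F x) by move=> bF; exact: bop_l2 (toep_bop bF).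
have PP' x : l2 x -> toep (P a) (toep (P na) x) = x.
  move=> lx; rewrite -toepM_plus//; apply: one => // t; exact: jumps_plusN.
have P'P x : l2 x -> toep (P na) (toep (P a) x) = x.
  move=> lx; rewrite -toepM_plus//; apply: one => // t.
  by rewrite mulrC; exact: jumps_plusN.
have NN' x : l2 x -> toep (N a) (toep (N na) x) = x.
  move=> lx; rewrite -toepM_minus//; apply: one => // t; exact: jumps_minusN.
have N'N x : l2 x -> toep (N na) (toep (N a) x) = x.
  move=> lx; rewrite -toepM_minus//; apply: one => // t.
  by rewrite mulrC; exact: jumps_minusN.
have TE x : l2 x -> toep (jumps a 1) x = toep (N a) (toep S (toep (P a) x)).
  by move=> lx; rewrite fac toepM_minus// toepM_plus.
have l0 : l2 (fun=> 0 : C) by apply: (@l2_finite _ _ 0%N).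
have z0 (F : R -> C) : cbounded F -> toep F (fun=> 0) = (fun=> 0).
  by move=> bF; apply/funext => j; exact: (wfun0 (bop_coord (toep_bop bF) j)).
split=> [y ly|x lx].
  have [v lv hv] := sS _ (tl _ _ bN' ly).
  exists (toep (P na) v); first exact: tl.
  by rewrite TE ?PP' ?hv ?NN'//; exact: tl.
rewrite TE// => /(congr1 (toep (N na))); rewrite N'N ?z0//; last by apply: (tl _ _ bS); exact: (tl _ _ bP).
move=> /(iS _ (tl _ _ bP lx)) /(congr1 (toep (P na))).
by rewrite P'P// z0.
Qed.

End PiecewiseSymbol.

(** * The determinant identity for an abstract factorization *)

Section DeterminantIdentity.
Variable R : realType.
Local Notation C := R[i].
(** psi is bounded with bounded inverse, its factors are only square integrable; f and
    h are the symbols of the bounded operator in the middle, and [flip] expresses on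
    the coefficients that plus_factor_refl is the reflection of plus_factor. *)
Variables (psi psi_inv plus_factor plus_factor_refl minus_factor minus_factor_inv : R -> C).
Variables (f h : R -> C).
Hypothesis bpsi : cbounded psi.
Hypothesis bpsi_inv : cbounded psi_inv.
Hypothesis bf : cbounded f.
Hypothesis bh : cbounded h.
Hypothesis hP : hardy 1 plus_factor.
Hypothesis hPt : hardy (-1) plus_factor_refl.
Hypothesis hN : hardy (-1) minus_factor.
Hypothesis hN' : hardy (-1) minus_factor_inv.
Hypothesis flip : forall n : nat, fc plus_factor n%:Z = fc plus_factor_refl (- n%:Z).
Hypothesis psi_inv_plus : forall t, psi_inv t * plus_factor t = minus_factor_inv t.
Hypothesis minus_inv_minus : forall t, minus_factor_inv t * minus_factor t = 1.
Hypothesis minus_inv_psi : forall t, minus_factor_inv t * psi t = plus_factor t.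
Hypothesis toep_psi_inv_inj : forall x, l2 x -> toep psi_inv x = (fun=> 0) -> x = (fun=> 0).

Definition plus_col (l : nat) : nat -> C := fun m => fc plus_factor (m%:Z - l%:Z).

Lemma shifted_fc_l2 (F : R -> C) (i : int) : sqint F -> l2 (fun m : nat => fc F (m%:Z - i)).
Proof.
move=> hF; exists (msq F); apply: (bessel _ hF) => x y /addIr [] //.
Qed.

(** The solution T^-1(psi^-1) e_n = T(psi_+) T(psi_-) e_n, a finite combination of the
    columns of T(psi_+) as psi_- is antianalytic. *)
Definition resolved (n : nat) : nat -> C :=
  fun m => \sum_(l < n.+1) fc minus_factor ((l : nat)%:Z - n%:Z) * plus_col l m.

Lemma resolved_l2 n : l2 (resolved n).
Proof.
apply: (@l2_sum _ n.+1 (fun l m => fc minus_factor ((l : nat)%:Z - n%:Z) * plus_col l m)) => l.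
by apply: l2Z; apply: shifted_fc_l2; exact: hP.1.
Qed.

Lemma wfun_resolved L n : wfun L ->
  L (resolved n) = \sum_(l < n.+1) fc minus_factor ((l : nat)%:Z - n%:Z) * L (plus_col l).
Proof.
move=> hL; have lc (l : nat) : l2 (plus_col l) by apply: shifted_fc_l2; exact: hP.1.
rewrite /resolved (@wfun_sum _ _ n.+1 (fun l m => fc minus_factor ((l : nat)%:Z - n%:Z) * plus_col l m))//.
  by apply: eq_bigr => l _; rewrite (wfunZ hL).
by move=> l; exact: l2Z.
Qed.

(** T(psi^-1) T(psi_+) = T(psi_-^-1) on columns, and T(psi_-^-1) T(psi_-) = 1. *)
Lemma toep_resolved n : toep psi_inv (resolved n) = basis_vector R n.
Proof.
apply/funext => j; have sp := cbounded_sqint bpsi_inv.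
rewrite (@wfun_resolved (fun x => toep psi_inv x j)); last exact: toep_wfun.
have e l : toep psi_inv (plus_col l) j = fc minus_factor_inv (j%:Z - l%:Z).
  rewrite /toep /plus_col conv_plus//; apply: eq_fc => t; exact: psi_inv_plus.
under eq_bigr do rewrite e mulrC.
rewrite -(@csum_finite _ (fun l : nat => fc minus_factor_inv (j%:Z - l%:Z) *
   fc minus_factor (l%:Z - n%:Z)) n.+1); last first.
  move=> l nl; rewrite (hardy_fc_out hN) ?mulr0// => i; apply/eqP => hi.
  by move: hi nl; lia.
rewrite -/(dot (fun l : nat => fc minus_factor_inv (j%:Z - l%:Z))
               (fun l : nat => fc minus_factor (l%:Z - n%:Z))).
rewrite (conv_minus n%:Z j hN' hN.1) (eq_fc (G := fun=> 1)) => [|t]; last exact: minus_inv_minus.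
by rewrite -(toep_basis (fun=> 1)) toep1//; exact: l2_basis.
Qed.

(** T(psi_-^-1) T(psi) = T(psi_+), row by row; rows of T(psi_-^-1) are in l2
    although the operator may be unbounded. *)
Lemma minus_inv_toep_psi x j : l2 x ->
  toep minus_factor_inv (toep psi x) j = toep plus_factor x j.
Proof.
apply: (@wfun_ext _ (fun x => toep minus_factor_inv (toep psi x) j)
                    (fun x => toep plus_factor x j)).
- apply: wfun_comp; last exact: toep_bop.
  by apply: toep_wfun; exact: hN'.1.
- by apply: toep_wfun; exact: hP.1.
move=> l; rewrite toep_basis.
have -> : toep psi (basis_vector R l) = (fun m : nat => fc psi (m%:Z - l%:Z)).
  by apply/funext => m; exact: toep_basis.
rewrite /toep (conv_minus l%:Z j hN' (cbounded_sqint bpsi)).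
by apply: eq_fc => t; exact: minus_inv_psi.
Qed.

Definition toep_hank x : nat -> C := fun j => toep f x j + hank h x j.

Definition full_toep t := minus_factor_inv t * (f t * plus_factor t).
Definition full_hank t := minus_factor_inv t * (h t * plus_factor_refl t).

Lemma toep_hank_bop : bop toep_hank.
Proof. by apply: bop_add; [exact: toep_bop|exact: hank_bop]. Qed.

(** M(a, b) = T(psi_-^-1) M(f, h) T(psi_+), entry by entry, with a and b the
    symbols [full_toep] and [full_hank]. *)
Lemma minus_inv_toep_hank_col l j :
  toep minus_factor_inv (toep_hank (plus_col l)) j =
  fc full_toep (j%:Z - l%:Z) + fc full_hank (j%:Z + l%:Z + 1).
Proof.
have sfP : sqint (fun t => f t * plus_factor t).
  have [mf [B hB]] := bf; apply: (@sqint_boundedM _ f plus_factor B) => //; exact: hP.1.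
have shP : sqint (fun t => h t * plus_factor_refl t).
  have [mh [B hB]] := bh; apply: (@sqint_boundedM _ h plus_factor_refl B) => //; exact: hPt.1.
have -> : toep_hank (plus_col l) = (fun i : nat => fc (fun t => f t * plus_factor t) (i%:Z - l%:Z) +
    fc (fun t => h t * plus_factor_refl t) (i%:Z - (- l%:Z - 1))).
  apply/funext => i; rewrite /toep_hank; congr (_ + _).
    by rewrite /toep /plus_col conv_plus//; exact: cbounded_sqint.
  rewrite /hank /plus_col (conv_hankel i l (cbounded_sqint bh) hP hPt flip).
  by have -> : i%:Z + l%:Z + 1 = i%:Z - (- l%:Z - 1) by lia.
rewrite {1}/toep dotD; [|by apply: toep_row; exact: hN'.1|exact: shifted_fc_l2|exact: shifted_fc_l2].
rewrite (conv_minus l%:Z j hN' sfP) (conv_minus (- l%:Z - 1) j hN' shP).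
by have -> : j%:Z + l%:Z + 1 = j%:Z - (- l%:Z - 1) by lia.
Qed.

Lemma toep_plus_finite x (j n : nat) : (j < n)%N ->
  toep plus_factor x j = \sum_(i < n) fc plus_factor (j%:Z - (i : nat)%:Z) * x i.
Proof.
move=> jn; rewrite /toep /dot; apply: csum_finite => i ni.
rewrite (hardy_fc_out hP) ?mul0r// => l; apply/eqP => hl.
by move: hl ni jn; lia.
Qed.

(** With X the matrix of the right-hand side, A that of M(a, b), and L, U the
    sections of T(psi_+), T(psi_-), one has L X = A U: both sides are
    the section of T(psi_-^-1) M(f, h) T^-1(psi^-1).  Since L is lower and U upper
    triangular, products of sections are sections of products. *)
Lemma det_toep_hank (n : nat) (zs xs : nat -> nat -> C) :
  (forall l, l2 (zs l) /\ toep psi_inv (zs l) = basis_vector R l) ->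
  (forall l, l2 (xs l) /\ toep psi (xs l) = toep_hank (zs l)) ->
  \det (\matrix_(j < n, l < n) (fc full_toep ((j : nat)%:Z - (l : nat)%:Z) +
                               fc full_hank ((j : nat)%:Z + (l : nat)%:Z + 1))) =
  \det (\matrix_(j < n, l < n) xs l j).
Proof.
move=> hz hx.
have zE l : zs l = resolved l.
  have [lz tz] := hz l; have bp := toep_bop bpsi_inv.
  have lr := resolved_l2 l.
  have ld : l2 (fun m => zs l m + (-1) * resolved l m) by apply: l2D => //; exact: l2Z.
  have := toep_psi_inv_inj ld; rewrite (bopD bp lz (l2Z (-1) lr)) (bopZ (-1) bp lr) tz toep_resolved.
  have -> : (fun m => basis_vector R l m + -1 * basis_vector R l m) = (fun=> 0).
    by apply/funext => m; ring.
  move=> /(_ erefl) e; apply/funext => m; apply/eqP; rewrite -subr_eq0 -mulN1r.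
  by apply/eqP; exact: (congr1 (fun x => x m) e).
pose A : 'M[C]_n := \matrix_(j, l) (fc full_toep ((j : nat)%:Z - (l : nat)%:Z) +
                               fc full_hank ((j : nat)%:Z + (l : nat)%:Z + 1)).
pose X : 'M[C]_n := \matrix_(j, l) xs l j.
pose L : 'M[C]_n := \matrix_(j, i) fc plus_factor ((j : nat)%:Z - (i : nat)%:Z).
pose U : 'M[C]_n := \matrix_(l, i) fc minus_factor ((l : nat)%:Z - (i : nat)%:Z).
have LX : L *m X = A *m U.
  apply/matrixP => j i; rewrite !mxE; under eq_bigr do rewrite !mxE.
  under [RHS]eq_bigr do rewrite !mxE.
  rewrite -(toep_plus_finite (xs i) (ltn_ord j)).
  have [lx tx] := hx i.
  rewrite -(minus_inv_toep_psi j lx) tx zE.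
  pose G (l : nat) := (fc full_toep ((j : nat)%:Z - l%:Z) + fc full_hank ((j : nat)%:Z + l%:Z + 1)) *
     fc minus_factor (l%:Z - (i : nat)%:Z).
  have -> : toep minus_factor_inv (toep_hank (resolved i)) j = \sum_(l < i.+1) G l.
    rewrite (@wfun_resolved (fun x => toep minus_factor_inv (toep_hank x) j)).
      by apply: eq_bigr => l _; rewrite /G -minus_inv_toep_hank_col mulrC.
    apply: wfun_comp; last exact: toep_hank_bop.
    by apply: toep_wfun; exact: hN'.1.
  rewrite -(big_mkord xpredT G) -(big_mkord xpredT G) [RHS](@big_cat_nat _ _ _ i.+1)//=.
  rewrite [X in _ + X]big_nat_cond [X in _ + X]big1 ?addr0// => l /andP[/andP[il _] _].
  rewrite /G (hardy_fc_out hN) ?mulr0// => q; apply/eqP => hq.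
  by move: hq il; lia.
have dL : \det L = 1.
  rewrite det_trig; last first.
    apply/is_trig_mxP => i j ij; rewrite mxE (hardy_fc_out hP)// => l; apply/eqP => hl.
    by move: hl ij; lia.
  by apply: big1 => i _; rewrite mxE subrr (hardy_fc0 _ hP).
have dU : \det U = 1.
  rewrite -det_tr det_trig; last first.
    apply/is_trig_mxP => i j ij; rewrite !mxE (hardy_fc_out hN)// => l; apply/eqP => hl.
    by move: hl ij; lia.
  by apply: big1 => i _; rewrite !mxE subrr (hardy_fc0 _ hN).
have := congr1 determinant LX; rewrite !det_mulmx dL dU mul1r mulr1.
by move=> /esym.
Qed.

End DeterminantIdentity.

(** * The functions u and v as boundary values of powers *)

Section PureJumpsAndSizes.
Variable R : realType.
Local Notation C := R[i].
Local Notation D := (`[0, 2 * pi]%classic : set R).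
Implicit Types (w tau : C).

(** The argument in ]0, 2 pi[ of a point w <> 1 of the circle: the chord from w to 1 has
    direction arg (1 - w) = - ang 1 w = (theta - pi) / 2. *)
Lemma expi_ang w : normc w = 1 -> w != 1 ->
  let x := pi - 2 * ang 1 w in 0 < x < 2 * pi /\ expi x = w.
Proof.
move=> w1 wn1 x; have /andP[h1 h2] := circle_Re w1; have hI := circle_ReIm w1.
have b1 := atan_gtNpi2 (1 * complex.Im w / (1 - 1 * complex.Re w)).
have b2 := atan_ltpi2 (1 * complex.Im w / (1 - 1 * complex.Re w)).
rewrite -/(ang 1 w) in b1 b2.
split; first by rewrite /x; apply/andP; split; lra.
have Re1 : complex.Re w < 1.
  rewrite lt_neqAle h2 andbT; apply/eqP => e; case/eqP: wn1.
  have e' : complex.Im w ^+ 2 = 0 by move: hI; rewrite e expr1n; lra.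
  by move/eqP: e'; rewrite sqrf_eq0 => /eqP e'; exact: complex_ext.
set a := complex.Re w in h1 h2 Re1 hI *; set b := complex.Im w in hI *.
have a0 : 0 < 1 - a by rewrite subr_gt0.
pose y := b / (1 - a); have eA : ang 1 w = atan y by rewrite /ang !mul1r.
have y2 : 1 + y ^+ 2 = 2 / (1 - a).
  have hb : b ^+ 2 = 1 - a ^+ 2 by lra.
  by rewrite /y expr_div_n hb; field; rewrite gt_eqF.
have y20 : 0 < 1 + y ^+ 2 by rewrite ltr_wpDr ?sqr_ge0.
have c2 : cos (atan y) ^+ 2 = (1 - a) / 2.
  by rewrite cos_atan exprVn sqr_sqrtr ?(ltW y20)// y2 invf_div.
have c0 : cos (atan y) != 0.
  by rewrite cos_atan invr_eq0 sqrtr_eq0 -ltNge.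
have sA : sin (atan y) = y * cos (atan y).
  by have := atanK y; rewrite /tan => e; rewrite -[X in _ = X * _]e divfK.
have ex : x = pi - (atan y *+ 2) by rewrite /x eA mulr_natl.
rewrite expiE ex; apply: complex_ext => /=.
  rewrite cosB cospi sinpi mul0r addr0 mulN1r cos_mulr2n c2 -/a.
  by rewrite -mulr_natl; field.
rewrite sinB cospi sinpi mul0r sub0r mulN1r opprK sin_mulr2n sA mulrCA -expr2 c2 -/b /y.
by rewrite -mulr_natl; field; rewrite gt_eqF.
Qed.

Lemma arg2piE w : normc w = 1 -> w != 1 -> arg2pi w = pi - 2 * ang 1 w.
Proof.
move=> w1 wn1; have [/andP[x0 x1] ex] := expi_ang w1 wn1.
have [/andP[y0 y1] ey] : [set x : R | 0 < x < 2 * pi /\ expi x = w] (arg2pi w).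
  by apply: xgetPex; exists (pi - 2 * ang 1 w); split => //; apply/andP.
have := expi_inj (t := arg2pi w) (t0 := pi - 2 * ang 1 w) _ _ (etrans ey (esym ex)).
rewrite !ltW//= => /(_ isT isT)[//|h|h]; lra.
Qed.

Lemma circle_inv tau : normc tau = 1 -> tau^-1 = tau^*%C.
Proof.
move=> h; rewrite invc_norm normc_def -modcE sqrtr_sqr ger0_norm ?modc_ge0// h.
by rewrite expr1n invr1 mul1r.
Qed.

(** u and v away from their singular point, as boundary values of powers of
    1 - t / tau and of its conjugate 1 - tau / t. *)
Lemma u_clog tau b (t : C) : normc tau = 1 -> normc t = 1 -> t * tau^*%C != 1 ->
  u tau b t = cexp (b * clog 1 (t * tau^*%C) - b * (clog 1 (t * tau^*%C))^*%C).
Proof.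
move=> h1 h2 h3; rewrite /u circle_inv// clog_jump.
have w1 : normc (t * tau^*%C) = 1 by rewrite normcM modcJ h1 h2 mulr1.
rewrite arg2piE// /jump; congr cexp.
have -> : pi - 2 * ang 1 (t * tau^*%C) - pi = -2 * ang 1 (t * tau^*%C) :> R by ring.
by rewrite mulrC mulrA.
Qed.

Lemma v_clog tau b (t : C) : normc tau = 1 -> normc t = 1 -> t * tau^*%C != 1 ->
  v tau b t = cexp (b * clog 1 (t * tau^*%C) + b * (clog 1 (t * tau^*%C))^*%C).
Proof.
move=> h1 h2 h3; rewrite /v /rpowc circle_inv//; congr cexp.
have w1 : normc (t * tau^*%C) = 1 by rewrite normcM modcJ h1 h2 mulr1.
rewrite arg2piE//; have [_ /(congr1 (@complex.Re R))] := expi_ang w1 h3.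
rewrite Re_expi => ->; rewrite -mulrDr; congr (_ * _).
rewrite addcJ -(rmorph_nat (real_complex R)) -rmorphM /clog /= /dist2.
rewrite mulrCA divff// !mulr1 expr1n.
by have -> : 1 - 2 * complex.Re (t * tau^*%C) + 1 = 2 - 2 * complex.Re (t * tau^*%C) by ring.
Qed.

(** G inherits measurability from F off the null set. *)
Lemma eq_fc_off_countable (N : set R) (F G : R -> C) (k : int) :
  countable N -> cmeas F -> (forall t, D t -> ~ N t -> G t = F t) -> fc G k = fc F k.
Proof.
move=> cN mF h; rewrite !fcE; congr (_ * _).
have mFe := cmeasM mF (cmeas_ek R (- k)); have [mN N0] := countable_null cN.
have mD : measurable (D : set (measurableTypeR R)) by exact: measurable_itv.
have key (f g : R -> R) : measurable_fun setT f -> (forall t, D t -> ~ N t -> g t = f t) ->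
    rint g = rint f.
  move=> mf hg; rewrite /rint /Rintegral; congr fine.
  have mfD := rintegrable_measurable mf.
  apply: ae_eq_integral => //; last first.
    exists N; split => // t /= ht; apply: contrapT => Nt; apply: ht => Dt.
    by rewrite hg.
  have -> : D = (D `&` N) `|` (D `\` N).
    by apply/seteqP; split=> t; [move=> Dt; have [|] := pselect (N t); [left|right]|case=> -[]].
  have mDN : measurable (D `&` N : set (measurableTypeR R)) by exact: measurableI.
  have mDN' : measurable (D `\` N : set (measurableTypeR R)) by exact: measurableD.
  apply/measurable_funU => //; split.
    move=> _ Y _; apply: (countable_null _).1.
    by apply: sub_countable cN; apply: subset_card_le => t [[]].
  apply: (eq_measurable_fun (EFin \o f)) => [t|].
    by rewrite inE => -[Dt Nt] /=; rewrite hg.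
  by apply: measurable_funS mfD => //; exact: subDsetl.
by apply: complex_ext; rewrite ?Re_cint ?Im_cint; apply: key => [|t Dt Nt];
  [exact: mFe.1|rewrite h|exact: mFe.2|rewrite h].
Qed.

(** Continuity along the circle, whose angles may be taken in the compact interval
    [0, 2 pi], gives the bound. *)
Lemma smooth_cbounded (f : C -> C) : smooth_on_circle f -> cbounded (fun t => f (ek 1 t)).
Proof.
move=> [hR hI].
have e1 t : ek 1 t = expi t :> C by rewrite /ek mul1r.
have cR : continuous (fun t => complex.Re (f (expi t))).
  by move=> x; apply/differentiable_continuous/derivable1_diffP; exact: (hR 0%N x).
have cI : continuous (fun t => complex.Im (f (expi t))).
  by move=> x; apply/differentiable_continuous/derivable1_diffP; exact: (hI 0%N x).
under [X in cbounded X]eq_fun do rewrite e1.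
split; first by split; exact: continuous_measurable_fun.
have c2 : continuous (fun t => normc (f (expi t)) ^+ 2).
  have -> : (fun t => normc (f (expi t)) ^+ 2) =
      (fun t => complex.Re (f (expi t)) * complex.Re (f (expi t)) +
                complex.Im (f (expi t)) * complex.Im (f (expi t))).
    by apply/funext => t; rewrite modcE !expr2.
  by move=> x; apply: cvgD; apply: cvgM; [exact: cR|exact: cR|exact: cI|exact: cI].
have [x _ hx] := @EVT_max R (fun t => normc (f (expi t)) ^+ 2) 0 (2 * pi) (ltW (two_pi_gt0 R))
  (continuous_subspaceT c2).
exists (normc (f (expi x))) => t.
have [s [s0 es]] : exists s, s \in `[0, 2 * pi] /\ expi s = expi t.
  have [->|n1] := eqVneq (expi t) 1.
    by exists 0; split; [rewrite in_itv /= lexx ltW// two_pi_gt0|exact: expi0].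
  have [/andP[x0 x1] ex] := expi_ang (modc_expi t) n1.
  by exists (pi - 2 * ang 1 (expi t)); split => //; rewrite in_itv /= !ltW.
by rewrite -es -ler_sqr ?nnegrE ?modc_ge0//; exact: hx.
Qed.

End PureJumpsAndSizes.

(** * Factorization of the symbols a, b and psi *)

Section Factorizations.
Variable R : realType.
Local Notation C := R[i].
Variables (J : finType) (tau : J -> C) (refl : J -> J).
Hypothesis tau1 : forall j, normc (tau j) = 1.
Hypothesis reflK : involutive refl.
Hypothesis tau_refl : forall j, tau (refl j) = (tau j)^*%C.
Implicit Types (a b g : J -> C) (t : R).

Let cl t j : C := clog 1 (ek 1 t * (tau j)^*%C).

Definition regular_point t := forall j, ek 1 t * (tau j)^*%C != 1.

Lemma jumps_plus_clog a t : jumps_plus tau a 1 (ek 1 t) = cexp (\sum_j a j * cl t j).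
Proof. by rewrite cexp_sum. Qed.

Lemma jumps_minus_inv_clog a t :
  jumps_minus tau (fun j => - a j) 1 (ek (-1) t) = cexp (\sum_j a j * (cl t j)^*%C).
Proof.
rewrite cexp_sum; apply: eq_bigr => j _; rewrite /eta opprK /cl -clogJ rmorphM /= conjcK.
by rewrite ekN.
Qed.

Lemma jumps_plus_refl_clog a t :
  jumps_plus tau a 1 (ek (-1) t) = cexp (\sum_j a (refl j) * (cl t j)^*%C).
Proof.
rewrite cexp_sum (reindex_inj (can_inj reflK)); apply: eq_bigr => j _.
rewrite /eta reflK /cl -clogJ tau_refl conjcK rmorphM /= ekN.
by [].
Qed.

Lemma jumps_clog g t : jumps tau g 1 t = cexp (\sum_j (g j * cl t j - g j * (cl t j)^*%C)).
Proof. by congr cexp; apply: eq_bigr => j _; rewrite clog_jump. Qed.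

Lemma prod_u g t : regular_point t ->
  \prod_j u (tau j) (g j) (ek 1 t) = jumps tau g 1 t.
Proof.
move=> h; rewrite jumps_clog cexp_sum; apply: eq_bigr => j _.
by rewrite u_clog// modc_ek.
Qed.

Lemma prod_v a t : regular_point t ->
  \prod_j v (tau j) (a j) (ek 1 t) =
  jumps_minus tau (fun j => - a j) 1 (ek (-1) t) * jumps_plus tau a 1 (ek 1 t).
Proof.
move=> h; rewrite jumps_plus_clog jumps_minus_inv_clog -cexpD -big_split /= cexp_sum.
by apply: eq_bigr => j _; rewrite v_clog ?modc_ek// addrC.
Qed.

(** With the powers of 1 - t / tau_j and of its conjugate collected, the exponents are
    a' + b and a' - b on the left, g and a - g + a (refl j) on the right: they agree
    because g = a' + b and a' is the mean of a over the orbit of the reflection. *)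
Lemma prod_vu a a' b g t : regular_point t ->
  (forall j, a j + a (refl j) = 2 * a' j) -> (forall j, g j = a' j + b j) ->
  \prod_j (v (tau j) (a' j) (ek 1 t) * u (tau j) (b j) (ek 1 t)) =
  jumps_minus tau (fun j => - a j) 1 (ek (-1) t) *
    (jumps tau g 1 t * jumps_plus tau a 1 (ek (-1) t)).
Proof.
move=> h ha hg; rewrite jumps_minus_inv_clog jumps_clog jumps_plus_refl_clog -!cexpD -!big_split cexp_sum.
apply: eq_bigr => j _; rewrite v_clog ?modc_ek// u_clog ?modc_ek// -cexpD -/(cl t j).
congr cexp; rewrite hg.
have -> : a (refl j) = 2 * a' j - a j by rewrite -ha; ring.
by move: ((cl t j)^*%C) => X; move: (cl t j) => Y /=; ring.
Qed.

Lemma irregular_countable :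
  countable ((`[0, 2 * pi]%classic : set R) `&` [set t | exists j, ek 1 t * (tau j)^*%C = 1]).
Proof. exact: (@singular_countable R J _ (tauJ1 tau1) 1 isT). Qed.

Lemma regular_off t :
  (`[0, 2 * pi]%classic : set R) t ->
  ~ ((`[0, 2 * pi]%classic : set R) `&` [set t | exists j, ek 1 t * (tau j)^*%C = 1]) t ->
  regular_point t.
Proof. by move=> Dt Nt j; apply/eqP => h; apply: Nt; split => //; exists j. Qed.

End Factorizations.

(** * Reduction of the statement to the abstract identity *)

Section Assembly.
Variable R : realType.
Local Notation C := R[i].
Variable m : nat.

(** The singular points 1, - 1, tau_r and their conjugates are indexed by
    bool + (I_m + I_m), on which conjugation acts by swapping the last two parts;
    [fam] gives the points and all the families of exponents alike. *)
Definition fam (p q : C) (x y : 'I_m -> C) (j : bool + ('I_m + 'I_m)) : C :=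
  match j with
  | inl true => p | inl false => q | inr (inl r) => x r | inr (inr r) => y r
  end.

Definition fam_refl (j : bool + ('I_m + 'I_m)) : bool + ('I_m + 'I_m) :=
  match j with
  | inl b => inl b | inr (inl r) => inr (inr r) | inr (inr r) => inr (inl r)
  end.

Lemma fam_reflK : involutive fam_refl.
Proof. by case=> [b|[r|r]]. Qed.

Lemma prod_fam (F : bool + ('I_m + 'I_m) -> C) :
  \prod_j F j = F (inl true) * F (inl false) * \prod_(r < m) (F (inr (inl r)) * F (inr (inr r))).
Proof. by rewrite big_sumType /= big_bool big_sumType /= big_split. Qed.

Lemma finite_bound (J : finType) (x : J -> R) (b : R) : 0 < b -> (forall j, x j < b) ->
  exists k, 0 <= k < b /\ forall j, x j <= k.
Proof.
move=> b0 h; exists (\big[Num.max/0]_j x j); split => [|j]; last exact: le_bigmax.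
apply/andP; split; first exact: bigmax_ge_id.
by apply/bigmax_ltP; split.
Qed.

(** Toeplitz operators depend on the symbol through its Fourier coefficients only,
    so its values on a countable set of angles are irrelevant. *)
Lemma T_toep (f : C -> C) (F : R -> C) (N : set R) : countable N -> cmeas F ->
  (forall t, (`[0, 2 * pi]%classic : set R) t -> ~ N t -> f (ek 1 t) = F t) ->
  (forall l, fourier f l = fc F l) /\ T f = toep F.
Proof.
move=> cN mF h; have e l : fourier f l = fc F l.
  rewrite -(eq_fc_off_countable (G := fun t => f (expi t)) l cN mF)// => t Dt Nt.
  by rewrite -h// /ek mul1r.
split => //; apply/funext => x; apply/funext => j; rewrite /T /toep /dot.
by congr csum; apply/funext => k; rewrite e.
Qed.

Lemma H_hank (f : C -> C) (F : R -> C) :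
  (forall l, fourier f l = fc F l) -> H f = hank F.
Proof.
move=> e; apply/funext => x; apply/funext => j; rewrite /H /hank /dot.
by congr csum; apply/funext => k; rewrite e.
Qed.

Lemma ell2_inv_toep (F : R -> C) (y : nat -> C) :
  (exists2 x, l2 x & toep F x = y) ->
  l2 (ell2_inv (toep F) y) /\ toep F (ell2_inv (toep F) y) = y.
Proof.
move=> [x lx ex].
have [h1 h2] : [set x | ell2 x /\ toep F x = y] (ell2_inv (toep F) y).
  by apply: xgetPex; exists x; split => //; exact/ell2P.
by split => //; exact/ell2P.
Qed.

End Assembly.

Theorem theorem3p2 (R : realType) (m : nat) (tau : 'I_m -> R[i])
  (alphap alpham betap betam : R[i])
  (alpharp alpharm betar : 'I_m -> R[i])
  (c d : R[i] -> R[i])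
  (tau_circle : forall r, `|tau r| = 1)
  (tau_inj : injective tau)
  (tau_upper : forall r, 0 < complex.Im (tau r))
  (alphap_lt : `|complex.Re alphap| < 1 / 2)
  (alpham_lt : `|complex.Re alpham| < 1 / 2)
  (alpharp_lt : forall r, `|complex.Re (alpharp r)| < 1 / 2)
  (alpharm_lt : forall r, `|complex.Re (alpharm r)| < 1 / 2)
  (c_smooth : smooth_on_circle c)
  (d_smooth : smooth_on_circle d)
  (c_neq0 : on_circle (fun t => c t <> 0))
  (d_neq0 : on_circle (fun t => d t <> 0))
  (c_wind : has_winding_number c 0)
  (d_wind : has_winding_number d 0)
  (d_tilde : on_circle (fun t => d t * tilde d t = 1))
  (d_1 : d 1 = 1) (d_N1 : d (-1) = 1) :
  let alphar r := (alpharp r + alpharm r) / 2 in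
  let gammap := alphap + betap in
  let gammam := alpham + betam in
  let gammar r := alphar r + betar r in
  let a t := c t * v 1 alphap t * v (-1) alpham t *
    \prod_(r < m) (v (tau r) (alpharp r) t * v (tau r)^*%C (alpharm r) t) in
  let b t := c t * d t * v 1 alphap t * u 1 betap t *
    v (-1) alpham t * u (-1) betam t *
    \prod_(r < m) (v (tau r) (alphar r) t * u (tau r) (betar r) t *
                   v (tau r)^*%C (alphar r) t * u (tau r)^*%C (betar r) t) in
  let psi t := u 1 alphap t * u (-1) alpham t *
    \prod_(r < m) (u (tau r) (alpharp r) t * u (tau r)^*%C (alpharm r) t) in
  let phi t := u 1 gammap t * u (-1) gammam t *
    \prod_(r < m) (u (tau r) (gammar r) t * u (tau r)^*%C (gammar r) t) in
  forall n : nat, (1 <= n)%N ->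
  det_truncation n (M a b) =
  det_truncation n (fun x =>
    ell2_inv (T psi)
      (M c (fun t => c t * d t * phi t)
        (ell2_inv (T (fun t => (psi t)^-1)) x))).
Proof.
move=> alphar gammap gammam gammar a b psi phi n _.
(* All singular points, with their exponents, as families over one index set. *)
pose conj_tau r := (tau r)^*%C.
pose pt := fam 1 (-1) tau conj_tau.
pose al := fam alphap alpham alpharp alpharm.
pose av := fam alphap alpham alphar alphar.
pose be := fam betap betam betar betar.
pose ga := fam gammap gammam gammar gammar.
have tau1 r : normc (tau r) = 1 by apply/eqP; rewrite -modc1P; apply/eqP.
have pt1 j : normc (pt j) = 1.
  case: j => [[]|[r|r]]; [exact: normc1|exact: etrans (modcN _) (normc1 _)|exact: tau1|].
  exact: etrans (modcJ _) (tau1 r).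
have pt_refl j : pt (fam_refl j) = (pt j)^*%C.
  case: j => [[]|[r|r]]; [exact/esym/conjc1|by rewrite /pt /=; apply: complex_ext; rewrite //= !oppr0|by []|].
  exact/esym/conjcK.
have N11 : (1 : R[i]) <> -1.
  by move/eqP; rewrite eq_sym -subr_eq0 -opprD oppr_eq0 -mulr2n pnatr_eq0.
have pt_inj : injective pt.
  have apart (z z' : R[i]) : z = z' -> complex.Im z < complex.Im z' -> False by move=> ->; rewrite ltxx.
  have up r : 0 < complex.Im (tau r) := tau_upper r.
  have low r : complex.Im (conj_tau r) < 0.
    by have := up r; rewrite /conj_tau; case: (tau r) => x y /=; rewrite oppr_lt0.
  have z1 : complex.Im (1 : R[i]) = 0 by [].
  have z2 : complex.Im (-1 : R[i]) = 0 by rewrite /= oppr0.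
  case=> [[]|[r|r]] [[]|[r'|r']] // h.
  - by case: (apart 1 (tau r') h); rewrite z1.
  - by case: (apart (conj_tau r') 1 (esym h)); rewrite z1.
  - by case: (N11 (esym h)).
  - by case: (apart (-1) (tau r') h); rewrite z2.
  - by case: (apart (conj_tau r') (-1) (esym h)); rewrite z2.
  - by case: (apart 1 (tau r) (esym h)); rewrite z1.
  - by case: (apart (-1) (tau r) (esym h)); rewrite z2.
  - by congr (inr (inl _)); exact: tau_inj.
  - by case: (apart (conj_tau r') (tau r) (esym h)); exact: lt_trans (low _) (up _).
  - by case: (apart (conj_tau r) 1 h); rewrite z1.
  - by case: (apart (conj_tau r) (-1) h); rewrite z2.
  - by case: (apart (conj_tau r) (tau r') h); exact: lt_trans (low _) (up _).
  - by congr (inr (inr _)); apply: tau_inj; exact: (can_inj (@conjcK R)).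
have al_lt j : `|complex.Re (al j)| < 1 / 2 by case: j => [[]|[r|r]] /=.
have half0 : 0 < 1 / 2 :> R by rewrite divr_gt0.
have [k [k01 ak]] := finite_bound half0 al_lt.
have nak j : `|complex.Re (- al j)| <= k by rewrite ReN normrN.
have nnak j : `|complex.Re (- - al j)| <= k by rewrite opprK.
pose cc t := c (ek 1 t); pose dd t := d (ek 1 t).
have bc : cbounded cc := smooth_cbounded c_smooth.
have bd : cbounded dd := smooth_cbounded d_smooth.
have bh : cbounded (fun t => cc t * dd t * jumps pt ga 1 t).
  by apply: cboundedM; [exact: cboundedM|exact: cbounded_jumps].
have cN := irregular_countable pt1.
have reg := @regular_off R _ pt.
set N := (X in countable X) in cN; rewrite -/N in reg.
have mN' : cmeas (fun t => jumps_minus pt (fun j => - al j) 1 (ek (-1) t)) by exact: cmeas_etas.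
have mP : cmeas (fun t => jumps_plus pt al 1 (ek 1 t)) by exact: cmeas_etas.
have mPt : cmeas (fun t => jumps_plus pt al 1 (ek (-1) t)) by exact: cmeas_etas.
(* The products of boundary values with which a and b agree at regular points. *)
pose At t := jumps_minus pt (fun j => - al j) 1 (ek (-1) t) * (cc t * jumps_plus pt al 1 (ek 1 t)).
pose Bt t := jumps_minus pt (fun j => - al j) 1 (ek (-1) t) *
  (cc t * dd t * jumps pt ga 1 t * jumps_plus pt al 1 (ek (-1) t)).
have aE t : regular_point pt t -> a (ek 1 t) = At t.
  move=> h; have := prod_v pt1 al h; rewrite prod_fam /= => e.
  by rewrite /At mulrCA -e /a -/(cc t) !mulrA.
have phiE t : regular_point pt t -> phi (ek 1 t) = jumps pt ga 1 t.
  by move=> h; rewrite -(prod_u pt1 ga h) prod_fam.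
have psiE t : regular_point pt t -> psi (ek 1 t) = jumps pt al 1 t.
  by move=> h; rewrite -(prod_u pt1 al h) prod_fam.
have bE t : regular_point pt t -> b (ek 1 t) = Bt t.
  move=> h.
  have s2 j : al j + al (fam_refl j) = 2 * av j.
    case: j => [[]|[r|r]] /=; rewrite /alphar; try by ring.
    - by rewrite mulrC divfK ?pnatr_eq0.
    - by rewrite mulrC divfK ?pnatr_eq0// addrC.
  have s3 j : ga j = av j + be j by case: j => [[]|[r|r]].
  have := prod_vu pt1 (@fam_reflK m) pt_refl h s2 s3; rewrite prod_fam /= => e.
  have -> : Bt t = cc t * dd t * (jumps_minus pt (fun j => - al j) 1 (ek (-1) t) *
    (jumps pt ga 1 t * jumps_plus pt al 1 (ek (-1) t))).
    by rewrite /Bt; move: (jumps_minus _ _ _ _) (jumps _ _ _ _) (jumps_plus _ _ _ _) => X Y Z; ring.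
  rewrite -e /b -/(cc t) -/(dd t).
  have -> : \prod_(r < m) (v (tau r) (alphar r) (ek 1 t) * u (tau r) (betar r) (ek 1 t) *
      v (tau r)^*%C (alphar r) (ek 1 t) * u (tau r)^*%C (betar r) (ek 1 t)) =
    \prod_(r < m) (v (tau r) (alphar r) (ek 1 t) * u (tau r) (betar r) (ek 1 t) *
      (v (conj_tau r) (alphar r) (ek 1 t) * u (conj_tau r) (betar r) (ek 1 t))).
    by apply: eq_bigr => r _; rewrite -[in RHS]mulrA -!mulrA.
  by rewrite !mulrA.
have mA : cmeas At by apply: cmeasM => //; apply: cmeasM => //; exact: bc.1.
have mB : cmeas Bt by apply: cmeasM => //; apply: cmeasM => //; exact: bh.1.
have symbol (f : R[i] -> R[i]) (F : R -> R[i]) : cmeas F ->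
    (forall t, regular_point pt t -> f (ek 1 t) = F t) ->
    (forall l, fourier f l = fc F l) /\ T f = toep F.
  by move=> mF e; apply: (T_toep cN mF) => t Dt Nt; apply: e; exact: reg.
have Ta : T a = toep At := (symbol a At mA aE).2.
have Hb : H b = hank Bt := H_hank (symbol b Bt mB bE).1.
have Tpsi : T psi = toep (jumps pt al 1) := (symbol psi _ (cbounded_jumps pt al 1).1 psiE).2.
pose nal j := - al j.
have psiVE t : regular_point pt t -> (psi (ek 1 t))^-1 = jumps pt nal 1 t.
  move=> h; rewrite (psiE t h).
  have e : jumps pt al 1 t * jumps pt nal 1 t = 1 := jumpsN pt al 1 t.
  move: (jumps pt al 1 t) (jumps pt nal 1 t) e => X Y e.
  have n0 : X != 0 by apply: contra_eq_neq e => ->; rewrite mul0r eq_sym oner_eq0.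
  by apply: (mulfI n0); rewrite e divff.
have Tpsi_inv : T (fun t => (psi t)^-1) = toep (jumps pt nal 1) :=
  (symbol (fun t => (psi t)^-1) _ (cbounded_jumps pt nal 1).1 psiVE).2.
have Mc : M c (fun t => c t * d t * phi t) = toep_hank cc (fun t => cc t * dd t * jumps pt ga 1 t).
  have [_ Tc] := symbol c cc bc.1 (fun t _ => erefl).
  have [hc _] := symbol (fun t => c t * d t * phi t) (fun t => cc t * dd t * jumps pt ga 1 t)
    bh.1 (fun t h => congr1 (fun z => cc t * dd t * z) (phiE t h)).
  by apply/funext => x; apply/funext => j; rewrite /M Tc (H_hank hc).
(* The columns of the inverse of T (psi^-1) and of the operator on the right. *)
pose zs l := ell2_inv (T (fun t => (psi t)^-1)) (basis_vector R l).
pose xs l := ell2_inv (T psi) (M c (fun t => c t * d t * phi t) (zs l)).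
have hz l : l2 (zs l) /\ toep (jumps pt nal 1) (zs l) = basis_vector R l.
  rewrite /zs Tpsi_inv; apply: ell2_inv_toep.
  exact: (toep_jumps_bijective pt1 pt_inj nak k01).1 _ (l2_basis R l).
have hx l : l2 (xs l) /\ toep (jumps pt al 1) (xs l) =
    toep_hank cc (fun t => cc t * dd t * jumps pt ga 1 t) (zs l).
  rewrite /xs Tpsi Mc; apply: ell2_inv_toep.
  apply: (toep_jumps_bijective pt1 pt_inj ak k01).1.
  exact: bop_l2 (toep_hank_bop bc bh) (hz l).1.
have hP : hardy 1 (fun t => jumps_plus pt al 1 (ek 1 t)).
  exact: (hardy_etas (tauJ1 pt1) (@tauJ_inj _ _ _ pt_inj) ak k01 (e := 1) isT).
have hPt : hardy (-1) (fun t => jumps_plus pt al 1 (ek (-1) t)).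
  exact: (hardy_etas (tauJ1 pt1) (@tauJ_inj _ _ _ pt_inj) ak k01 (e := -1) isT).
have hN : hardy (-1) (fun t => jumps_minus pt al 1 (ek (-1) t)).
  exact: (hardy_etas pt1 pt_inj nak k01 (e := -1) isT).
have hN' : hardy (-1) (fun t => jumps_minus pt nal 1 (ek (-1) t)).
  exact: (hardy_etas pt1 pt_inj nnak k01 (e := -1) isT).
have flip (q : nat) : fc (fun t => jumps_plus pt al 1 (ek 1 t)) q%:Z =
    fc (fun t => jumps_plus pt al 1 (ek (-1) t)) (- q%:Z).
  exact: (etas_flip (tauJ1 pt1) (@tauJ_inj _ _ _ pt_inj) ak k01).
have e1 t : jumps pt nal 1 t * jumps_plus pt al 1 (ek 1 t) = jumps_minus pt nal 1 (ek (-1) t).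
  have -> : jumps pt nal 1 t = jumps_plus pt nal 1 (ek 1 t) * jumps_minus pt nal 1 (ek (-1) t) := jumps_split pt nal 1 t.
  have e : jumps_plus pt al 1 (ek 1 t) * jumps_plus pt nal 1 (ek 1 t) = 1 := jumps_plusN pt al 1 (ek 1 t).
  move: (jumps_plus pt al 1 (ek 1 t)) (jumps_plus pt nal 1 (ek 1 t)) (jumps_minus pt nal 1 (ek (-1) t)) e => X Y Z e.
  by rewrite mulrAC [Y * X]mulrC e mul1r.
have e2 t : jumps_minus pt nal 1 (ek (-1) t) * jumps_minus pt al 1 (ek (-1) t) = 1.
  by rewrite mulrC; exact: (jumps_minusN pt al 1 (ek (-1) t)).
have e3 t : jumps_minus pt nal 1 (ek (-1) t) * jumps pt al 1 t = jumps_plus pt al 1 (ek 1 t).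
  have -> : jumps pt al 1 t = jumps_plus pt al 1 (ek 1 t) * jumps_minus pt al 1 (ek (-1) t) := jumps_split pt al 1 t.
  move: (jumps_plus pt al 1 (ek 1 t)) (jumps_minus pt nal 1 (ek (-1) t)) (jumps_minus pt al 1 (ek (-1) t)) (e2 t) => X Y Z e.
  by rewrite mulrCA e mulr1.
have := det_toep_hank (cbounded_jumps pt al 1) (cbounded_jumps pt nal 1) bc bh hP hPt hN hN' flip e1 e2 e3
  (toep_jumps_bijective pt1 pt_inj nak k01).2 n hz hx.
move=> key; rewrite /det_truncation -[RHS]/(\det (\matrix_(j < n, l < n) xs l j)) -key.
by congr determinant; apply/matrixP => j l; rewrite !mxE /M Ta Hb toep_basis hank_basis.
Qed.
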